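(* Consider the random field Ising model with bimodal field in dimension $d=2$. For every $0\le\beta<\beta_c(2)$ there exists $H_1(\beta)>0$, where $$H_1(\beta)=\infty \text{ if } \beta\in[0,\beta_P(2)],\qquad H_1(\beta)\in(0,\infty)\text{ if }\beta\in(\beta_P(2),\beta_c(2)),$$ such that for each $H\in[0,H_1(\beta))$ there is a constant $C_1(\beta,H)\in(0,\infty)$ depending only on $\beta,H$ with the following property: for all finite subsets $\Delta\subseteq\Lambda$ of $\mathbb{Z}^2$ and every realization $\vec h\in\{-1,+1\}^\Lambda$, $$\sup_{\eta,\eta'\in\{-1,+1\}^{\partial_{ex}\Lambda}}TV\left(P^{\vec h}_{\Lambda,\eta,\beta,H}(\sigma_\Delta\in\cdot),P^{\vec h}_{\Lambda,\eta',\beta,H}(\sigma_\Delta\in\cdot)\right)\le\sum_{x\in\partial_{ex}\Delta,\,y\in\partial_{ex}\Lambda}e^{-C_1(\beta,H)|x-y|}.$$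
   Context: For a finite $\Lambda\subseteq\mathbb{Z}^d$, $\partial_{ex}\Lambda$ is the set of vertices of $\mathbb{Z}^d\setminus\Lambda$ having a nearest neighbor in $\Lambda$. For $\beta\ge0$, $H\ge 0$, $\eta\in\{-1,+1\}^{\partial_{ex}\Lambda}$ and $\vec h\in\mathbb{R}^\Lambda$, $P^{\vec h}_{\Lambda,\eta,\beta,H}$ is the probability measure on $\{-1,+1\}^\Lambda$ given by $$P^{\vec h}_{\Lambda,\eta,\beta,H}(\sigma)\propto\exp\Big[\beta\sum_{\{u,v\}}\sigma_u\sigma_v+\beta\sum_{\{u,v\}:u\in\Lambda,v\in\partial_{ex}\Lambda}\sigma_u\eta_v+H\sum_{u\in\Lambda}h_u\sigma_u\Big],$$ where the first sum is over (unordered) nearest neighbor pairs in $\Lambda$ and the second over nearest neighbor pairs. In the random field Ising model (RFIM), $\vec h$ is a realization of i.i.d. random variables $H_u$ of mean $0$ and variance $1$; the bimodal field has $\mathrm{Prob}(H_u=+1)=\mathrm{Prob}(H_u=-1)=1/2$, so $\vec h$ takes values in $\{-1,+1\}^\Lambda$. $\sigma_\Delta$ is the restriction of $\sigma$ to $\Delta$, $TV$ is total variation distance, $|\cdot|$ is the Euclidean norm. $\beta_c(d)$ is the critical inverse temperature of the (homogeneous, nearest neighbor) Ising model on $\mathbb{Z}^d$ with $H=0$. $\beta_P(d)$ is defined by $1-e^{-2\beta_P(d)}=p_c^b(d)$, where $p_c^b(d)$ is the critical probability of independent Bernoulli bond percolation on $\mathbb{Z}^d$. *)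

(* Defs.v *)
From Stdlib Require Relation_Operators.
From HB Require Import structures.
From mathcomp Require Import all_boot all_order all_algebra finmap.
From mathcomp Require Import all_classical all_reals all_analysis.
Set Implicit Arguments.
Unset Strict Implicit.
Unset Printing Implicit Defensive.
Import Order.TTheory GRing.Theory Num.Theory numFieldNormedType.Exports.

Local Open Scope fset_scope.
Local Open Scope classical_set_scope.
Local Open Scope ring_scope.

Notation lattice d := 'rV[int]_d.

Section Lattice.
Variable d : nat.
Implicit Types (x y u v : lattice d) (L : {fset lattice d}).

Definition eucl_dist (R : realType) x y : R :=
  Num.sqrt (\sum_(i < d) ((x 0 i - y 0 i)%:~R ^+ 2)).

Definition adj x y : bool := \sum_(i < d) `|x 0 i - y 0 i| == 1.

Definition box (n : nat) : {fset lattice d} :=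
  [fset \row_i (((f : {ffun 'I_d -> 'I_n.*2.+1}) i)%:Z - n%:Z)
     | f in {ffun 'I_d -> 'I_n.*2.+1}]%fset.

Lemma in_boxE n x : (x \in box n) = [forall i, `|x 0 i| <= n%:Z].
Proof.
apply/imfsetP/forallP => [[f _ ->] i|hx].
  rewrite !mxE ler_norml lerBrDr addNr lerBlDr -PoszD addnn !lez_nat leq0n /=.
  by rewrite -ltnS.
have hb (i : 'I_d) : (absz (x 0 i + n%:Z)%R < n.*2.+1)%N.
  have := hx i; rewrite ler_norml => /andP[h1 h2].
  rewrite ltnS -lez_nat gez0_abs; last by rewrite -lerBlDr sub0r.
  by rewrite -addnn PoszD lerD2r.
exists [ffun i => Ordinal (hb i)] => //.
apply/rowP => i; rewrite !mxE ffunE /= gez0_abs ?addrK //.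
by have := hx i; rewrite ler_norml -lerBlDr sub0r => /andP[].
Qed.

Lemma box_origin n : 0 \in box n.
Proof. by rewrite in_boxE; apply/forallP => i; rewrite mxE normr0. Qed.

(* The enumeration [u + z], [z \in box 1], only serves to make the set visibly
   finite; see [in_ex_boundary]. *)
Definition ex_boundary L : {fset lattice d} :=
  [fset v in [fset (u + z)%R | u in L, z in box 1]
     | (v \notin L) && [exists u : L, adj (val u) v]]%fset.

Lemma in_ex_boundary L v :
  (v \in ex_boundary L) = (v \notin L) && [exists u : L, adj (val u) v].
Proof.
rewrite !inE /=; set b := (X in _ && X).
suff imp : b -> v \in [fset (u + z)%R | u in L, z in box 1]%fset.
  by apply/andP/idP => [[]|vb] //; split=> //; exact: imp.
case/andP => _ /existsP[u uv]; apply/imfset2P.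
exists (val u); first exact: fsvalP.
exists (v - val u); last by rewrite addrC subrK.
rewrite /= in_boxE; apply/forallP => i; rewrite !mxE distrC.
have /eqP <- : \sum_(j < d) `|val u 0 j - v 0 j| == 1%N%:Z := uv.
rewrite (bigD1 i) //= lerDl.
by apply: sumr_ge0 => j _; exact: normr_ge0.
Qed.

End Lattice.

(* Spins are booleans: [true] stands for +1 and [false] for -1. *)
Notation config L := {ffun L -> bool}.

Definition spin (R : realType) (b : bool) : R := if b then 1 else -1.

Definition restrict_config d (D L : {fset lattice d})
  (DL : (D `<=` L)%fset) (s : config L) : config D := [ffun x => s (fincl DL x)].

Section Ising.
Variables (R : realType) (d : nat) (L : {fset lattice d}).
Variables (h : L -> R) (eta : config (ex_boundary L)) (beta H : R).

(* The factor 1/2 in front of the first sum is there because each unordered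
   pair {u, v} is met twice, as (u, v) and as (v, u). *)
Definition gibbs_weight (s : config L) : R :=
  expR (beta * (2^-1 * \sum_(u : L) \sum_(v : L | adj (val u) (val v))
                         spin R (s u) * spin R (s v))
      + beta * (\sum_(u : L) \sum_(v : ex_boundary L | adj (val u) (val v))
                  spin R (s u) * spin R (eta v))
      + H * \sum_(u : L) h u * spin R (s u)).

Definition gibbs (s : config L) : R :=
  gibbs_weight s / \sum_(t : config L) gibbs_weight t.

Definition gibbs_marginal (D : {fset lattice d}) (DL : (D `<=` L)%fset)
  (t : config D) : R := \sum_(s : config L | restrict_config DL s == t) gibbs s.

End Ising.

Definition tv_dist (R : realType) (T : finType) (p q : T -> R) : R :=
  \big[Num.max/0]_(A : {set T}) `|\sum_(t in A) p t - \sum_(t in A) q t|.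

Definition plus_magnetization (R : realType) d (beta : R) (n : nat) : R :=
  \sum_(s : config (box d n))
    gibbs (fun=> 0) [ffun=> true] beta 0 s
    * spin R (s [` box_origin d n]%fset).

(* Supremum of the inverse temperatures at which the spontaneous magnetization
   (the limit over boxes with + boundary condition and no field) vanishes;
   +oo when there is no phase transition. *)
Definition beta_c (R : realType) (d : nat) : \bar R :=
  ereal_sup [set beta%:E | beta in
    [set beta : R | 0 <= beta /\ plus_magnetization d beta @ \oo --> (0 : R)]].

(* [(x, i)] is the bond joining x and x + e_i; every nearest neighbour bond is
   represented exactly once. *)
Definition bond d := (lattice d * 'I_d)%type.

Definition bernoulli_bonds (R : realType) d (p : R) (disp : measure_display)
    (Omega : measurableType disp) (P : probability Omega R)
    (O : bond d -> set Omega) : Prop :=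
  [/\ forall e, measurable (O e),
      forall e, P (O e) = p%:E
    & forall F : {fset bond d},
        P (\bigcap_(e in [set` F]) O e) = (\prod_(e <- F) P (O e))%E].

Definition open_step d (S : set (bond d)) (x y : lattice d) : Prop :=
  exists i : 'I_d, (y = x + delta_mx 0 i /\ S (x, i))
                \/ (x = y + delta_mx 0 i /\ S (y, i)).

Definition open_cluster d (S : set (bond d)) (x : lattice d) : set (lattice d) :=
  [set y | Relation_Operators.clos_refl_trans _ (open_step S) x y].

(* [S] is the random set of open bonds.  The probability below depends only on
   p, so that it does not matter which realization of the model is used. *)
Definition no_percolation (R : realType) d (p : R) : Prop :=
  exists (disp : measure_display) (Omega : measurableType disp)
         (P : probability Omega R) (O : bond d -> set Omega),
    bernoulli_bonds p P O /\
    P [set w | infinite_set (open_cluster [set e | O e w] 0)] = 0%E.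

Definition p_c (R : realType) (d : nat) : R :=
  sup [set p : R | 0 <= p <= 1 /\ no_percolation d p].

(* The solution of 1 - exp (-2 beta_P) = p_c, namely +oo if p_c = 1. *)
Definition beta_P (R : realType) (d : nat) : \bar R :=
  (- lne (1 - p_c R d)%:E * (2^-1)%:E)%E.

Lemma p_c_le1 (R : realType) d : p_c R d <= 1.
Proof.
rewrite /p_c; set A := [set _ | _].
have [->|A0] := eqVneq A set0; first by rewrite sup0.
by apply: ge_sup; [exact/set0P | move=> p [/andP[]]].
Qed.

Lemma beta_PE (R : realType) d :
  (1 - expeR (- 2%:E * beta_P R d))%E = (p_c R d)%:E.
Proof.
have h : 0 <= 1 - p_c R d by rewrite subr_ge0 p_c_le1.
have -> : (- 2%:E * beta_P R d = lne (1 - p_c R d)%:E)%E.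
  rewrite /beta_P; case: (lne _) => [r| |].
  - by rewrite -EFinN -!EFinM !(mulNr, mulrN) opprK mulrCA mulfV ?mulr1 ?pnatr_eq0.
  - by rewrite /= gt0_mulNye ?lte_fin ?invr_gt0// muleC lt0_mulNye ?lte_fin ?oppr_lt0.
  - by rewrite /= gt0_mulye ?lte_fin ?invr_gt0// muleC lt0_mulye ?lte_fin ?oppr_lt0.
rewrite lneK ?in_itv/= ?lee_fin ?h ?leey//.
by rewrite -EFinB subKr.
Qed.

(* Main.v *)
(* Write [m(L, x)] for the magnetization at [x] of the field-free model in [L] with
   + boundary condition.

   1. Revealing the spins on the exterior boundary of [D] one by one and coupling
   monotonically bounds the total variation distance by the sum over [x] in that
   boundary of the difference of P(sigma_x = +) under + and - boundary conditions,
   in the presence of the field.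

   2. That difference is at most [m(L, x)], whatever the field (an inequality of
   Ding, Song and Sun).  It follows from a comparison of the partition functions
   in the four fields [h +- k +- l] with those in the fields [k +- l], proved by
   induction on the number of sites and on the support of [l].

   3. [m(L, x)] is at most the magnetization of the largest cube around [x]
   contained in [L], which decays exponentially below the critical point.  This
   is sharpness in the manner of Duminil-Copin, Raoufi and Tassion: the OSSS
   inequality for monotonic measures, applied to an exploration of the
   random-cluster model, gives a differential inequality for the crossing
   probabilities.

   Hence the bound holds for every [H], and any [H1] with the required finiteness
   will do. *)
Require Import Defs.
From HB Require Import structures.
From mathcomp Require Import all_boot all_order all_algebra finmap.
From mathcomp Require Import all_classical all_reals all_analysis.
From mathcomp Require Import ring lra zify.
(* Restores the lemmas on finite sets shadowed by those on classical sets. *)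
From mathcomp Require Import fintype finset.
Set Implicit Arguments.
Unset Strict Implicit.
Unset Printing Implicit Defensive.
Import Order.TTheory GRing.Theory Num.Theory numFieldNormedType.Exports.
Local Open Scope ring_scope.

(** * A polynomial inequality *)

(** The field has no sign, and the influence of the boundary is not monotone in it. What can be
    compared is the odds ratio at [x] under the two extreme boundary fields: given the spin at [x],
    the other sites see a field shifted by plus or minus the couplings of [x], so the odds ratio is
    a cross ratio of four partition functions, and this is largest when the field vanishes. Among
    pairs of probabilities with a given odds ratio a symmetric pair is furthest apart, which
    produces exactly the magnetization.

    Sharpness is proved in finite volume. The crossing event concerns distances up to [n], with
    wiring at distance [2n], so that a cube of radius up to [n] fits around every explored site. Its
    probability lies between the magnetizations at radii [2n] and [n], and this sandwich closes the
    differential inequality. The parameter is the logarithm of the edge weight, for which the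
    derivative is exactly a sum of covariances.

    The bound to be proved has no prefactor; the one produced by sharpness is absorbed because the
    magnetization at radius at least 1 stays below a constant smaller than 1. *)

Section RealInequality.
Variable R : rcfType.
Implicit Types a b c d x y z q u B C K : R.

Let le_sqr x y : 0 <= x -> 0 <= y -> (x ^+ 2 <= y ^+ 2) = (x <= y).
Proof. by move=> x0 y0; rewrite ler_sqr ?nnegrE. Qed.

(** Only positive [z] are available, so a linear term of favourable sign excuses the discriminant.
    The quadratic is tested at a large [z], at a small [z] and at its vertex. *)
Lemma quadratic_pos_disc (a b x : R) :
  (forall z, 0 < z -> 0 <= a * z ^+ 2 - x * z + b) ->
  [/\ 0 <= a, 0 <= b & x <= 0 \/ x ^+ 2 <= 4 * a * b].
Proof.
move=> H.
have a0 : 0 <= a.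
  rewrite leNgt; apply/negP => a0.
  pose z := 1 + (`|x| + `|b|) / - a.
  have z1 : 1 <= z by rewrite lerDl divr_ge0 // ?addr_ge0 // oppr_ge0 ltW.
  have az : - a * z = - a + (`|x| + `|b|).
    by rewrite mulrDr mulr1 mulrCA divff ?mulr1 // oppr_eq0 lt_eqF.
  have := H z (lt_le_trans ltr01 z1).
  have -> : a * z ^+ 2 = - (- a + (`|x| + `|b|)) * z by rewrite -az; ring.
  have := ler_norm (- x); have := ler_norm b; rewrite normrN => hb hx.
  have : `|b| * 1 <= `|b| * z by rewrite ler_wpM2l.
  have : - x * z <= `|x| * z by rewrite ler_wpM2r //; lra.
  have : a * z <= a * 1 by rewrite ler_wnM2l // ltW.
  lra.
have b0 : 0 <= b.
  rewrite leNgt; apply/negP => b0.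
  pose z := - b / (1 + `|x| + a - b).
  have den : 0 < 1 + `|x| + a - b by have := normr_ge0 x; lra.
  have z0 : 0 < z by rewrite divr_gt0 // oppr_gt0.
  have zE : z * (1 + `|x| + a - b) = - b by rewrite /z divfK // gt_eqF.
  have z1 : z <= 1.
    by rewrite /z ler_pdivrMr // mul1r; have := normr_ge0 x; lra.
  have := H z z0.
  have : a * z ^+ 2 <= a * z by rewrite expr2 mulrA ler_piMr // mulr_ge0 // ltW.
  have : - x * z <= `|x| * z by apply: ler_wpM2r; [exact: ltW | rewrite -normrN; exact: ler_norm].
  have : 0 < z * (1 - b) by rewrite mulr_gt0 //; lra.
  lra.
split => //; have [x0|x0] := leP x 0; [by left | right].
have [a00|a00] := eqVneq a 0.
  exfalso; have := H ((b + 1) / x) (divr_gt0 (ltr_pwDr ltr01 b0) x0).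
  rewrite a00 mul0r [x * _]mulrC divfK ?gt_eqF //; lra.
have ap : 0 < a by rewrite lt_def a00.
have := H (x / (2 * a)) (divr_gt0 x0 (mulr_gt0 (ltr0Sn R 1) ap)).
have -> : a * (x / (2 * a)) ^+ 2 - x * (x / (2 * a)) + b = (4 * a * b - x ^+ 2) / (4 * a).
  by field; rewrite gt_eqF.
by rewrite pmulr_lge0 ?invr_gt0 ?mulr_gt0 // subr_ge0.
Qed.

(** The converse direction, needed only at [z = 1]. *)
Lemma quadratic_disc_pos (a b x : R) : 0 <= a -> 0 <= b ->
  x <= 0 \/ x ^+ 2 <= 4 * a * b -> x <= a + b.
Proof.
move=> a0 b0 [x0|xx]; first by have := addr_ge0 a0 b0; lra.
have ab : 0 <= a + b by exact: addr_ge0.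
have [x0|x0] := leP x 0; first lra.
rewrite -le_sqr // ?(ltW x0) //.
have := sqr_ge0 (a - b); lra.
Qed.

(* With [V = y q], [f = C V - (y - q)] and
   [W = (y^2 + q^2 - B^2 - C^2 V^2) / V = 2 - 2 C f + (f^2 - B^2) / V], the
   discriminant condition on [D] reads [W^2 <= 4 (1 + B^2 C^2 - K)], whose
   right-hand side does not depend on the point, and [W] decreases. *)
Lemma discriminant_transport (B C K y0 q0 y2 q2 : R)
  (D := fun y q => y ^+ 2 + B ^+ 2 - q ^+ 2 * (C ^+ 2 * y ^+ 2 + 1)) :
  0 < B -> 0 < C -> B * C <= 1 -> 2 * B * C <= K ->
  0 < y0 -> y0 <= y2 -> 0 < q0 -> q0 <= q2 ->
  (y2 - q2) - (y0 - q0) <= C * (y2 * q2 - y0 * q0) ->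
  B <= q0 ^+ 2 * C ->
  0 <= D y0 q0 ->
  D y0 q0 ^+ 2 <= 4 * y0 ^+ 2 * (q0 ^+ 4 * C ^+ 2 - K * q0 ^+ 2 + B ^+ 2) ->
  0 < D y2 q2 ->
  D y2 q2 ^+ 2 <= 4 * y2 ^+ 2 * (q2 ^+ 4 * C ^+ 2 - K * q2 ^+ 2 + B ^+ 2).
Proof.
rewrite {}/D /= => B0 C0 BC KBC y00 y02 q00 q02 slope Bq D0 D0' D2.
have y20 : 0 < y2 by exact: lt_le_trans y02.
have q20 : 0 < q2 by exact: lt_le_trans q02.
set V0 := y0 * q0 in slope *; set V2 := y2 * q2 in slope *.
have V00 : 0 < V0 by rewrite mulr_gt0.
have V02 : V0 <= V2 by rewrite ler_pM // ltW.
have V20 : 0 < V2 by exact: lt_le_trans V02.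
pose f0 := C * V0 - (y0 - q0); pose f2 := C * V2 - (y2 - q2).
have f02 : f0 <= f2 by rewrite /f0 /f2; lra.
have Bq2 : B <= q2 ^+ 2 * C.
  by apply: le_trans Bq _; rewrite ler_pM2r // le_sqr // ltW.
have BB : B ^+ 2 <= q2 ^+ 2.
  have : B * B <= q2 ^+ 2 * C * B by rewrite ler_pM2r.
  have : q2 ^+ 2 * (B * C) <= q2 ^+ 2 * 1 by rewrite ler_pM2l // exprn_gt0.
  lra.
have BqC : B ^+ 2 <= q2 ^+ 4 * C ^+ 2.
  rewrite (_ : q2 ^+ 4 * C ^+ 2 = (q2 ^+ 2 * C) ^+ 2); last by ring.
  by rewrite le_sqr ?(ltW B0) // mulr_ge0 // ?exprn_ge0 // ltW.
have prod_lt : (q2 ^+ 2 - y2 ^+ 2) * (1 - q2 ^+ 2 * C ^+ 2) < 0.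
  have -> : (q2 ^+ 2 - y2 ^+ 2) * (1 - q2 ^+ 2 * C ^+ 2) =
    - (y2 ^+ 2 + B ^+ 2 - q2 ^+ 2 * (C ^+ 2 * y2 ^+ 2 + 1))
    + (B ^+ 2 - q2 ^+ 4 * C ^+ 2) by ring.
  lra.
have qC : q2 ^+ 2 * C ^+ 2 < 1.
  rewrite ltNge; apply/negP => qC1.
  have : y2 ^+ 2 * (q2 ^+ 2 * C ^+ 2) >= y2 ^+ 2 * 1.
    by rewrite ler_pM2l // exprn_gt0.
  lra.
have qy : q2 < y2.
  rewrite ltNge -le_sqr ?(ltW q20) ?(ltW y20) // -ltNge -subr_lt0.
  by move: prod_lt; rewrite pmulr_llt0 ?subr_gt0.
(* Since [2 B C <= K], the right-hand side of the discriminant condition is at most a perfect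
   square. Taking roots gives [(y0 + B)^2 <= (q0 (C y0 + 1))^2], and taking roots again gives
   [B <= f0], the sign needed for [W] to decrease. *)
have fB : B <= f0.
  have rhs : 4 * y0 ^+ 2 * (q0 ^+ 4 * C ^+ 2 - K * q0 ^+ 2 + B ^+ 2)
     <= (2 * y0 * (q0 ^+ 2 * C - B)) ^+ 2.
    have : q0 ^+ 2 * (2 * B * C) <= q0 ^+ 2 * K by rewrite ler_pM2l // exprn_gt0.
    move=> h; rewrite (_ : (2 * y0 * (q0 ^+ 2 * C - B)) ^+ 2 =
     4 * y0 ^+ 2 * (q0 ^+ 4 * C ^+ 2 - q0 ^+ 2 * (2 * B * C) + B ^+ 2)); last by ring.
    by rewrite ler_pM2l ?mulr_gt0 ?exprn_gt0 //; lra.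
  have : y0 ^+ 2 + B ^+ 2 - q0 ^+ 2 * (C ^+ 2 * y0 ^+ 2 + 1)
         <= 2 * y0 * (q0 ^+ 2 * C - B).
    rewrite -le_sqr //; first exact: le_trans D0' rhs.
    by apply: mulr_ge0; rewrite ?subr_ge0 // mulr_ge0 // ltW.
  move=> h; have : (y0 + B) ^+ 2 <= (q0 * (C * y0 + 1)) ^+ 2 by lra.
  rewrite le_sqr; first by rewrite /f0 /V0; lra.
    by apply: addr_ge0; apply: ltW.
  apply: mulr_ge0; first exact: ltW.
  by apply: addr_ge0 => //; apply: mulr_ge0; exact: ltW.
pose w0 := y0 ^+ 2 + q0 ^+ 2 - B ^+ 2 - C ^+ 2 * V0 ^+ 2.
pose w2 := y2 ^+ 2 + q2 ^+ 2 - B ^+ 2 - C ^+ 2 * V2 ^+ 2.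
have w0E : w0 = (2 - 2 * C * f0) * V0 + (f0 ^+ 2 - B ^+ 2).
  by rewrite /w0 /f0 /V0; ring.
have w2E : w2 = (2 - 2 * C * f2) * V2 + (f2 ^+ 2 - B ^+ 2).
  by rewrite /w2 /f2 /V2; ring.
have w2p : 0 <= w2.
  rewrite (_ : w2 = y2 ^+ 2 * (1 - q2 ^+ 2 * C ^+ 2) + (q2 ^+ 2 - B ^+ 2)).
    by rewrite addr_ge0 ?mulr_ge0 ?subr_ge0 ?sqr_ge0 // ltW.
  by rewrite /w2 /V2; ring.
(* This is the decrease of [W], with denominators cleared. *)
have ww : w2 * V0 <= w0 * V2.
  rewrite -subr_ge0 w0E w2E.
  rewrite (_ : _ - _ = (f0 ^+ 2 - B ^+ 2) * (V2 - V0)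
    + (f2 - f0) * (V0 * (2 * (C * V2 - f2) + (f2 - f0)))); last by ring.
  have h1 : 0 <= (f0 ^+ 2 - B ^+ 2) * (V2 - V0).
    rewrite mulr_ge0 // subr_ge0 // le_sqr ?(ltW B0) //.
    by apply: le_trans fB; exact: ltW.
  have h2 : 0 <= (f2 - f0) * (V0 * (2 * (C * V2 - f2) + (f2 - f0))).
    rewrite mulr_ge0 ?subr_ge0 // mulr_ge0 ?ltW //.
    have : 0 < C * V2 - f2 by rewrite /f2; lra.
    lra.
  exact: addr_ge0.
have key y q : (y ^+ 2 + q ^+ 2 - B ^+ 2 - C ^+ 2 * (y * q) ^+ 2) ^+ 2
   - 4 * (y * q) ^+ 2 * (1 + B ^+ 2 * C ^+ 2 - K) =
   (y ^+ 2 + B ^+ 2 - q ^+ 2 * (C ^+ 2 * y ^+ 2 + 1)) ^+ 2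
   - 4 * y ^+ 2 * (q ^+ 4 * C ^+ 2 - K * q ^+ 2 + B ^+ 2) by ring.
move: D0'; rewrite -subr_le0 -key -/V0 -/w0 subr_le0 => hw0.
rewrite -subr_le0 -key -/V2 -/w2 subr_le0.
rewrite -(ler_pM2r (exprn_gt0 2 V00)).
apply: (@le_trans _ _ (w0 ^+ 2 * V2 ^+ 2)).
  have w2V : 0 <= w2 * V0 by apply: mulr_ge0 w2p _; exact: ltW.
  by rewrite -!exprMn le_sqr //; exact: le_trans w2V ww.
have h : w0 ^+ 2 * V2 ^+ 2 <= 4 * V0 ^+ 2 * (1 + B ^+ 2 * C ^+ 2 - K) * V2 ^+ 2.
  by rewrite ler_pM2r // exprn_gt0.
by apply: le_trans h _; rewrite le_eqVlt; apply/orP; left; apply/eqP; ring.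
Qed.

End RealInequality.

(** * The one-site inequality behind the induction on the field *)

Section CrossRatio.
Variable R : rcfType.

(** Both sides are values of quadratics in a tilt [z] of the field at one site, and the hypothesis
    for all [z > 0] amounts to a discriminant condition at 1. That condition, rather than the
    inequality itself, is carried from 1 to [y] by [discriminant_transport]; the conclusion is the
    quadratic at [y], evaluated at [z = 1]. In use, [y] is the exponential of twice the value of [l]
    at the site. *)
Lemma cross_ratio_transport (a0 b0 c0 d0 a1 b1 c1 d1 a2 b2 c2 d2 y : R) :
  0 < a0 -> 0 < b0 -> 0 < c0 -> 0 < d0 ->
  0 < a1 -> 0 < b1 -> 0 < c1 -> 0 < d1 ->
  0 < a2 -> 0 < b2 -> 0 < c2 -> 0 < d2 ->
  b0 * c0 <= a0 * d0 -> b1 * c1 <= a1 * d1 -> b2 * c2 <= a2 * d2 ->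
  a1 * a2 * c0 ^+ 2 <= a0 ^+ 2 * (c1 * c2) ->
  a1 * a2 * d0 ^+ 2 <= a0 ^+ 2 * (d1 * d2) ->
  (forall z : R, 0 < z ->
     (a1 * z + b1) * (a2 + b2 * z) * (c0 + d0) ^+ 2
     <= (a0 + b0) ^+ 2 * ((c1 * z + d1) * (c2 + d2 * z))) ->
  1 <= y ->
  (a1 * y + b1) * (a2 * y + b2) * (c0 * y + d0) ^+ 2
  <= (a0 * y + b0) ^+ 2 * ((c1 * y + d1) * (c2 * y + d2)).
Proof.
move=> a00 b00 c00 d00 a10 b10 c10 d10 a20 b20 c20 d20 bc0 bc1 bc2 hc hd H1 y1.
have sqrtM (u v : R) : 0 < u -> 0 < v -> 0 < Num.sqrt (u * v) /\ Num.sqrt (u * v) ^+ 2 = u * v.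
  move=> u0 v0; have uv := mulr_gt0 u0 v0.
  by rewrite sqrtr_gt0 sqr_sqrtr // ltW.
have [] := sqrtM _ _ a10 a20; set a := Num.sqrt _ => ap aE.
have [] := sqrtM _ _ b10 b20; set b := Num.sqrt _ => bp bE.
have [] := sqrtM _ _ c10 c20; set c := Num.sqrt _ => cp cE.
have [] := sqrtM _ _ d10 d20; set d := Num.sqrt _ => dp dE.
have sq_le (u v : R) : 0 <= u -> 0 <= v -> u ^+ 2 <= v ^+ 2 -> u <= v.
  by move=> u0 v0; rewrite ler_sqr.
have ac : a * c0 <= a0 * c.
  apply: sq_le; [by apply: mulr_ge0; exact: ltW | by apply: mulr_ge0; exact: ltW |].
  by rewrite !exprMn aE cE.
have ad : a * d0 <= a0 * d.
  apply: sq_le; [by apply: mulr_ge0; exact: ltW | by apply: mulr_ge0; exact: ltW |].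
  by rewrite !exprMn aE dE.
have bcad : b * c <= a * d.
  apply: sq_le; [by apply: mulr_ge0; exact: ltW | by apply: mulr_ge0; exact: ltW |].
  rewrite !exprMn aE bE cE dE mulrACA [leRHS]mulrACA.
  by apply: ler_pM => //; apply: mulr_ge0; exact: ltW.
(* The four pairs of coefficients enter through their geometric means, except for the mixed products
   collected in [L]. After normalization, [B], [C] and [K] are all that remains. *)
pose B := b / a; pose C := c / d.
have Ba : B * a = b by rewrite /B divfK // gt_eqF.
have Cd : C * d = c by rewrite /C divfK // gt_eqF.
have Bp : 0 < B by rewrite divr_gt0.
have Cp : 0 < C by rewrite divr_gt0.
have BC1 : B * C <= 1.
  rewrite -(ler_pM2r (mulr_gt0 ap dp)) mul1r mulrACA Ba Cd //.
pose L := c1 * d2 * b1 * a2 + d1 * c2 * a1 * b2.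
pose K := L / (a ^+ 2 * d ^+ 2).
have ad0 : 0 < a ^+ 2 * d ^+ 2 by rewrite mulr_gt0 // exprn_gt0.
have KE : K * (a ^+ 2 * d ^+ 2) = L by rewrite /K divfK // gt_eqF.
have L0 : 0 <= L by rewrite /L addr_ge0 // !mulr_ge0 // ltW.
(* Arithmetic-geometric mean inequality for the two terms of [L]. *)
have BCK : 2 * B * C <= K.
  rewrite -(ler_pM2r ad0) KE.
  have -> : 2 * B * C * (a ^+ 2 * d ^+ 2) = 2 * (b * a) * (c * d).
    by rewrite -Ba -Cd; ring.
  apply: sq_le => //; first by rewrite !mulr_ge0 // ltW.
  have -> : (2 * (b * a) * (c * d)) ^+ 2 = 4 * (c1 * d2 * b1 * a2) * (d1 * c2 * a1 * b2).
    rewrite (_ : _ ^+ 2 = 4 * (b ^+ 2 * a ^+ 2) * (c ^+ 2 * d ^+ 2)); last by ring.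
    by rewrite aE bE cE dE; ring.
  by rewrite /L; have := sqr_ge0 (c1 * d2 * b1 * a2 - d1 * c2 * a1 * b2); lra.
pose M t := c0 * t + d0; pose N t := a0 * t + b0.
have Mp t : 0 < t -> 0 < M t by move=> t0; rewrite /M addr_gt0 // mulr_gt0.
have Np t : 0 < t -> 0 < N t by move=> t0; rewrite /N addr_gt0 // mulr_gt0.
pose q t := N t / M t * d / a.
have qp t : 0 < t -> 0 < q t by move=> t0; rewrite /q divr_gt0 // mulr_gt0 // divr_gt0 ?Np ?Mp.
have qE t : 0 < t -> q t * (M t * a) = N t * d.
  by move=> t0; rewrite /q; field; rewrite !gt_eqF ?Mp.
have qmono s t : 0 < s -> s <= t -> q s <= q t.
  move=> s0 st; have t0 : 0 < t by exact: lt_le_trans st.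
  rewrite /q ler_pM2r ?invr_gt0 // ler_pM2r // ler_pdivrMr ?Mp // mulrAC ler_pdivlMr ?Mp //.
  rewrite -subr_ge0 (_ : _ - _ = (a0 * d0 - b0 * c0) * (t - s)).
    by rewrite mulr_ge0 ?subr_ge0.
  by rewrite /M /N; ring.
pose D y q := y ^+ 2 + B ^+ 2 - q ^+ 2 * (C ^+ 2 * y ^+ 2 + 1).
pose al t := N t ^+ 2 * (c1 * d2) - M t ^+ 2 * (a1 * b2).
pose be t := N t ^+ 2 * (d1 * c2) - M t ^+ 2 * (b1 * a2).
have DE t : 0 < t -> D t (q t) * (a ^+ 2 * M t ^+ 2) =
    M t ^+ 2 * (a1 * a2 * t ^+ 2 + b1 * b2) - N t ^+ 2 * (c1 * c2 * t ^+ 2 + d1 * d2).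
  move=> t0; rewrite -aE -bE -cE -dE -Cd -Ba.
  rewrite (_ : N t ^+ 2 * _ = (N t * d) ^+ 2 * (C ^+ 2 * t ^+ 2 + 1)); last by ring.
  by rewrite -qE // /D; ring.
have abE t : 0 < t -> al t * be t =
    (q t ^+ 4 * C ^+ 2 - K * q t ^+ 2 + B ^+ 2) * (a ^+ 2 * M t ^+ 2) ^+ 2.
  move=> t0; transitivity ((N t * d) ^+ 4 * C ^+ 2 - L * (N t * M t) ^+ 2 + b ^+ 2 * a ^+ 2 * M
    t ^+ 4).
    rewrite (_ : (N t * d) ^+ 4 * C ^+ 2 = N t ^+ 4 * (d ^+ 2 * (C * d) ^+ 2)); last by ring.
    by rewrite Cd cE dE bE aE /al /be /L; ring.
  rewrite -KE -Ba.
  rewrite (_ : K * _ * _ = K * (N t * d) ^+ 2 * (M t * a) ^+ 2); last by ring.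
  by rewrite -qE //; ring.
have DD t : 0 < t -> (D t (q t) ^+ 2 <= 4 * t ^+ 2 * (q t ^+ 4 * C ^+ 2 - K * q t ^+ 2 + B ^+ 2))
    = ((D t (q t) * (a ^+ 2 * M t ^+ 2)) ^+ 2 <= 4 * (t * al t) * (t * be t)).
  move=> t0; have aM : 0 < (a ^+ 2 * M t ^+ 2) ^+ 2 by rewrite exprn_gt0 // mulr_gt0 //
    exprn_gt0 // Mp.
  rewrite -(ler_pM2r aM) -exprMn; congr (_ <= _).
  transitivity (4 * t ^+ 2 * (al t * be t)); last by ring.
  by rewrite abE //; ring.
(* Expanded in [z], the hypothesis has outer coefficients [al 1] and [be 1], and its middle
   coefficient is the scaled [D 1 (q 1)] with a minus sign. *)
have {H1} [al1 be1 D1] : [/\ 0 <= al 1, 0 <= be 1 &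
    D 1 (q 1) * (a ^+ 2 * M 1 ^+ 2) <= 0 \/
    (D 1 (q 1) * (a ^+ 2 * M 1 ^+ 2)) ^+ 2 <= 4 * al 1 * be 1].
  apply: quadratic_pos_disc => z z0; rewrite DE //.
  have := H1 z z0; rewrite -subr_ge0 => h; apply: le_trans h _.
  by rewrite le_eqVlt; apply/orP; left; apply/eqP; rewrite /al /be /M /N; ring.
have y0 : 0 < y by exact: lt_le_trans y1.
have mono_ab s u v u' v' : 1 <= s -> 0 < u -> 0 < v -> 0 < u' -> 0 < v' ->
    0 <= N 1 ^+ 2 * (u * v) - M 1 ^+ 2 * (u' * v') ->
    0 <= N s ^+ 2 * (u * v) - M s ^+ 2 * (u' * v').
  move=> s1 u0 v0 u0' v0'; rewrite !subr_ge0 => h.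
  have s0 : 0 < s by exact: lt_le_trans s1.
  have NM : N 1 * M s <= N s * M 1.
    rewrite -subr_ge0 (_ : _ - _ = (a0 * d0 - b0 * c0) * (s - 1)).
      by rewrite mulr_ge0 ?subr_ge0.
    by rewrite /M /N; ring.
  rewrite -(ler_pM2r (exprn_gt0 2 (Mp 1 ltr01))).
  apply: (@le_trans _ _ ((N 1 * M s) ^+ 2 * (u * v))).
    rewrite [leLHS](_ : _ = M 1 ^+ 2 * (u' * v') * M s ^+ 2); last by ring.
    rewrite [leRHS](_ : _ = N 1 ^+ 2 * (u * v) * M s ^+ 2); last by ring.
    by rewrite ler_pM2r // exprn_gt0 // Mp.
  rewrite [leRHS](_ : _ = (N s * M 1) ^+ 2 * (u * v)); last by ring.
  rewrite ler_pM2r ?mulr_gt0 // ler_sqr ?nnegrE // ltW // mulr_gt0 // ?Mp // Np //.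
have al_ge s : 1 <= s -> 0 <= al s by move=> s1; apply: mono_ab.
have be_ge s : 1 <= s -> 0 <= be s by move=> s1; apply: mono_ab.
suff : D y (q y) * (a ^+ 2 * M y ^+ 2) <= y * al y + y * be y.
  rewrite DE // => h; rewrite -subr_ge0; move: h; rewrite -subr_ge0 => h; apply: le_trans h _.
  by rewrite le_eqVlt; apply/orP; left; apply/eqP; rewrite /al /be /M /N; ring.
apply: quadratic_disc_pos; first by rewrite mulr_ge0 ?al_ge // ltW.
  by rewrite mulr_ge0 ?be_ge // ltW.
have aMp t : 0 < t -> 0 < a ^+ 2 * M t ^+ 2 by move=> t0; rewrite mulr_gt0 // exprn_gt0 // Mp.
have [Dy|Dy] := leP (D y (q y)) 0; [left | right].
  by rewrite pmulr_lle0 // aMp.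
rewrite -DD //.
(* If [D] is nonpositive at 1, the squared condition may fail there. As [D] is positive at [y], it
   vanishes somewhere in between, and the transport starts from that zero, where only signs have to
   be checked. *)
have [s [s1 sy Ds Ds']] : exists s : R, [/\ 1 <= s, s <= y, 0 <= D s (q s) &
    D s (q s) ^+ 2 <= 4 * s ^+ 2 * (q s ^+ 4 * C ^+ 2 - K * q s ^+ 2 + B ^+ 2)].
  have [D10|D10] := leP (D 1 (q 1)) 0; last first.
    exists 1; split=> //; first exact: ltW.
    rewrite DD // !mul1r; case: D1 => //.
    by rewrite pmulr_lle0 ?aMp // leNgt D10.
  pose P : {poly R} := (('X ^+ 2 + (B ^+ 2)%:P) * (c0%:P * 'X + d0%:P) ^+ 2 * (a ^+ 2)%:P
    - (d ^+ 2)%:P * (a0%:P * 'X + b0%:P) ^+ 2 * ((C ^+ 2)%:P * 'X ^+ 2 + 1)).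
  have PE t : 0 < t -> P.[t] = D t (q t) * (a ^+ 2 * M t ^+ 2).
    move=> t0; transitivity
      ((t ^+ 2 + B ^+ 2) * (a ^+ 2 * M t ^+ 2) - (q t * (M t * a)) ^+ 2 * (C ^+ 2 * t ^+ 2 + 1)).
      by rewrite qE // /P !hornerE /= /M /N; ring.
    by rewrite /D; ring.
  have [|s /andP[s1 sy] /rootP Ps] := @poly_ivt R P 1 y y1.
    rewrite !PE // pmulr_lle0 ?aMp // D10 /=.
    by rewrite mulr_ge0 // ltW // aMp.
  have s0 : 0 < s by exact: lt_le_trans s1.
  have Ds : D s (q s) * (a ^+ 2 * M s ^+ 2) = 0 by rewrite -PE.
  exists s; split=> //.
    by rewrite -(pmulr_lge0 _ (aMp s s0)) Ds.
  rewrite DD // Ds expr0n /=; apply: mulr_ge0.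
    by rewrite !mulr_ge0 ?al_ge // ltW.
  by rewrite mulr_ge0 ?be_ge // ltW.
have s0 : 0 < s by exact: lt_le_trans s1.
apply: (@discriminant_transport _ B C K s (q s) y (q y)) => //.
- exact: qp.
- exact: qmono.
(* [q] satisfies [a c0 t q + a d0 q = a0 d t + b0 d]. The difference of this relation at [y] and
   [s], with [a c0 <= a0 c] and [a d0 <= a0 d], is the slope bound. *)
- have qs : C * (y * q y - s * q s) + (q y - q s) - (y - s) >= 0.
    pose g := a * d0 / (a0 * d) .
    have gq t : 0 < t -> a * c0 * (t * q t) + a * d0 * q t = a0 * d * t + b0 * d.
      by move=> t0; have := qE t t0; rewrite /M /N; lra.
    have e1 := gq y y0; have e2 := gq s s0.
    have V : 0 <= y * q y - s * q s.
      rewrite subr_ge0; apply: ler_pM => //; [exact: ltW | exact/ltW/qp | exact: qmono].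
    have Q : 0 <= q y - q s by rewrite subr_ge0 qmono.
    have h1 : a * c0 * (y * q y - s * q s) <= a0 * c * (y * q y - s * q s).
      exact: ler_wpM2r.
    have h2 : a * d0 * (q y - q s) <= a0 * d * (q y - q s) by exact: ler_wpM2r.
    rewrite -(pmulr_lge0 _ (mulr_gt0 a00 dp)).
    rewrite (_ : _ * (a0 * d) = a0 * (C * d) * (y * q y - s * q s) + a0 * d * (q y - q s)
      - a0 * d * (y - s)); last by ring.
    rewrite Cd; lra.
  lra.
- have := al_ge s s1; have := be_ge s s1.
  rewrite !subr_ge0 => h1 h2.
  have aM := aMp s s0.
  have h : (b * a) * M s ^+ 2 <= N s ^+ 2 * (c * d).
    apply: sq_le; [by rewrite !mulr_ge0 ?exprn_ge0 // ltW ?Mp |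
      by rewrite !mulr_ge0 ?exprn_ge0 // ltW ?Np |].
    rewrite !exprMn aE bE cE dE.
    rewrite (_ : _ * _ * _ = M s ^+ 2 * (b1 * a2) * (M s ^+ 2 * (a1 * b2))); last by ring.
    rewrite (_ : N s ^+ 2 ^+ 2 * _ = N s ^+ 2 * (d1 * c2) * (N s ^+ 2 * (c1 * d2))); last by ring.
    by apply: ler_pM => //; rewrite !mulr_ge0 ?exprn_ge0 // ltW // Mp.
  rewrite -Ba -Cd in h; rewrite -(ler_pM2r aM).
  rewrite [leRHS](_ : _ = (q s * (M s * a)) ^+ 2 * C); last by ring.
  rewrite qE //; lra.
Qed.

End CrossRatio.

(** * Domination of an arbitrary field by the zero field *)

Section PartitionFunction.
Variables (R : realType) (T : eqType) (c : T -> T -> R).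
Hypothesis c_sym : forall u v, c u v = c v u.
Hypothesis c_ge0 : forall u v, 0 <= c u v.
Implicit Types (r : seq T) (h k l X : T -> R) (u v : T).

(** Partition function of the sites in [r]: summing out the head spin shifts the field on the other
    sites by plus or minus a row of [c]. For duplicate-free [r] each pair is met once and the
    diagonal of [c] is not read. Fields live on all of [T], so the recursion does not change
    types. *)
Fixpoint pfun r k : R := if r is v :: r' then
  expR (k v) * pfun r' (fun u => k u + c v u)
  + expR (- k v) * pfun r' (fun u => k u - c v u) else 1.

Lemma eq_in_pfun r k l : {in r, k =1 l} -> pfun r k = pfun r l.
Proof.
elim: r k l => //= v r IH k l kl; rewrite kl ?mem_head //.
by congr (_ * _ + _ * _); apply: IH => u ur; rewrite kl // inE ur orbT.
Qed.

Lemma eq_pfun r k l : k =1 l -> pfun r k = pfun r l.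
Proof. by move=> kl; apply: eq_in_pfun => u _. Qed.

Lemma pfun_gt0 r k : 0 < pfun r k.
Proof. by elim: r k => //= v r IH k; rewrite addr_gt0 // mulr_gt0 // expR_gt0. Qed.

Lemma pfunN r k : pfun r (fun u => - k u) = pfun r k.
Proof.
elim: r k => //= v r IH k; rewrite opprK addrC; congr (_ * _ + _ * _).
  by rewrite -IH; apply: eq_pfun => u; rewrite opprB opprK addrC.
by rewrite -IH; apply: eq_pfun => u; rewrite opprD opprK.
Qed.

Lemma pfun_rem v r k : v \in r -> pfun r k = pfun (v :: rem v r) k.
Proof.
elim: r k => // u r IH k; rewrite inE [rem _ _]/=; have [<- //|uv /= vr] := eqVneq u v.
rewrite !IH //= !mulrDr !mulrA -!expRD.
rewrite addrACA; congr ((expR _ * _ + expR _ * _) + (expR _ * _ + expR _ * _));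
  solve [by rewrite ?(c_sym u v); ring | by apply: eq_pfun => w; ring].
Qed.

(** Log-supermodularity in the field. After splitting on the head spin, products of equal signs
    match one by one. The two products of opposite signs are dominated together, because [m, n <= p]
    and [m n <= p q] imply [m + n <= p + q]. The four fields are given by equations so that each use
    reduces to ring identities. *)
Lemma pfun_supermodular r X k l f1 f2 f3 f4 :
  (forall u, 0 <= k u) -> (forall u, 0 <= l u) ->
  (forall u, f1 u = X u + k u) -> (forall u, f2 u = X u + l u) ->
  (forall u, f3 u = X u + k u + l u) -> (forall u, f4 u = X u) ->
  pfun r f1 * pfun r f2 <= pfun r f3 * pfun r f4.
Proof.
elim: r X k l f1 f2 f3 f4 => [|v r IH] X k l f1 f2 f3 f4 k0 l0 E1 E2 E3 E4.
  by rewrite /= !mulr1.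
have sum_le (p q m n : R) : 0 < p -> m <= p -> n <= p -> m * n <= p * q -> m + n <= p + q.
  move=> p0 mp np mn; rewrite -subr_ge0 -(pmulr_rge0 _ p0).
  have : 0 <= (p - m) * (p - n) by rewrite mulr_ge0 ?subr_ge0.
  lra.
have cv u : 0 <= c v u by exact: c_ge0.
have kc u : 0 <= k u + 2 * c v u by have := k0 u; have := cv u; lra.
have lc u : 0 <= l u + 2 * c v u by have := l0 u; have := cv u; lra.
have kv := k0 v; have lv := l0 v.
rewrite /=.
set Fp1 := pfun r (fun u => f1 u + _); set Fm1 := pfun r (fun u => f1 u - _).
set Fp2 := pfun r (fun u => f2 u + _); set Fm2 := pfun r (fun u => f2 u - _).
set Fp3 := pfun r (fun u => f3 u + _); set Fm3 := pfun r (fun u => f3 u - _).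
set Fp4 := pfun r (fun u => f4 u + _); set Fm4 := pfun r (fun u => f4 u - _).
have p1 : 0 < Fp1 by exact: pfun_gt0. have m1 : 0 < Fm1 by exact: pfun_gt0.
have p2 : 0 < Fp2 by exact: pfun_gt0. have m2 : 0 < Fm2 by exact: pfun_gt0.
have p3 : 0 < Fp3 by exact: pfun_gt0. have m3 : 0 < Fm3 by exact: pfun_gt0.
have p4 : 0 < Fp4 by exact: pfun_gt0. have m4 : 0 < Fm4 by exact: pfun_gt0.
have hp : Fp1 * Fp2 <= Fp3 * Fp4.
  by apply: (IH (fun u => X u + c v u) k l) => // u; rewrite ?E1 ?E2 ?E3 ?E4; ring.
have hm : Fm1 * Fm2 <= Fm3 * Fm4.
  by apply: (IH (fun u => X u - c v u) k l) => // u; rewrite ?E1 ?E2 ?E3 ?E4; ring.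
have hpm : Fp1 * Fm2 <= Fp3 * Fm4.
  by apply: (IH (fun u => X u - c v u) (fun u => k u + 2 * c v u) l) => // u;
    rewrite ?E1 ?E2 ?E3 ?E4; ring.
have hmp : Fm1 * Fp2 <= Fp3 * Fm4.
  by apply: (IH (fun u => X u - c v u) k (fun u => l u + 2 * c v u)) => // u;
    rewrite ?E1 ?E2 ?E3 ?E4; ring.
have expM (x y p q : R) : expR x * p * (expR y * q) = expR (x + y) * (p * q).
  by rewrite mulrACA -expRD.
have addr4 (p q m n : R) : (p + q) + (m + n) = (p + n) + (q + m) by ring.
rewrite !E1 !E2 !E3 !E4 !mulrDl !mulrDr !expM.
rewrite [leLHS](_ : _ = (expR (2 * X v + k v + l v) * (Fp1 * Fp2)
    + expR (- (2 * X v + k v + l v)) * (Fm1 * Fm2))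
  + (expR (k v - l v) * (Fp1 * Fm2) + expR (l v - k v) * (Fm1 * Fp2))); last first.
  rewrite [LHS]addr4; congr ((expR _ * _ + expR _ * _) + (expR _ * _ + expR _ * _)); ring.
rewrite [leRHS](_ : _ = (expR (2 * X v + k v + l v) * (Fp3 * Fp4)
    + expR (- (2 * X v + k v + l v)) * (Fm3 * Fm4))
  + (expR (k v + l v) * (Fp3 * Fm4) + expR (- (k v + l v)) * (Fm3 * Fp4))); last first.
  rewrite [LHS]addr4; congr ((expR _ * _ + expR _ * _) + (expR _ * _ + expR _ * _)); ring.
apply: lerD.
  by apply: lerD; rewrite ler_pM2l // expR_gt0.
apply: sum_le; first by rewrite mulr_gt0 ?expR_gt0 // mulr_gt0.
- by apply: ler_pM; rewrite ?expR_ge0 ?ler_expR // ?mulr_ge0 ?(ltW p1, ltW m1, ltW p2, ltW m2)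
  //; lra.
- by apply: ler_pM; rewrite ?expR_ge0 ?ler_expR // ?mulr_ge0 ?(ltW p1, ltW m1, ltW p2, ltW m2)
  //; lra.
rewrite !expM.
rewrite (_ : k v - l v + (l v - k v) = 0); last by ring.
rewrite subrr expR0 !mul1r.
rewrite [leLHS](_ : _ = (Fp1 * Fp2) * (Fm1 * Fm2)); last by ring.
rewrite [leRHS](_ : _ = (Fp3 * Fp4) * (Fm3 * Fm4)); last by ring.
by apply: ler_pM => //; rewrite mulr_ge0 // ltW.
Qed.

(** Opposite fields have the same partition function, so the two squares form the value at [h = 0]
    of the cross ratio [Z(h+k+l) Z(h-k-l) / (Z(h+k-l) Z(h-k+l))], which is asserted to be its
    maximum over [h]. *)
Definition field_dominated r := forall h k l,
  (forall u, 0 <= k u) -> (forall u, 0 <= l u) ->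
  pfun r (fun u => h u + k u + l u) * pfun r (fun u => h u - k u - l u)
    * pfun r (fun u => k u - l u) ^+ 2 <=
  pfun r (fun u => h u + k u - l u) * pfun r (fun u => h u - k u + l u)
    * pfun r (fun u => k u + l u) ^+ 2.

Let drop_at l v : T -> R := fun u => if u == v then 0 else l u.

(** Restores [l] at [v]. Expanding in the spin of [v] gives the setting of [cross_ratio_transport].
    Its ordering hypotheses come from [pfun_supermodular], its two coefficient comparisons from the
    statement on [r] with the couplings of [v] added to [l] or to [k], and its quadratic hypothesis
    from the case where [l] vanishes at [v], used for all fields at [v]. *)
Lemma field_dominated_step v r h k l : v \notin r ->
  (forall u, 0 <= k u) -> (forall u, 0 <= l u) -> field_dominated r ->
  (forall h',
  pfun (v :: r) (fun u => h' u + k u + drop_at l v u)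
    * pfun (v :: r) (fun u => h' u - k u - drop_at l v u)
    * pfun (v :: r) (fun u => k u - drop_at l v u) ^+ 2 <=
  pfun (v :: r) (fun u => h' u + k u - drop_at l v u)
    * pfun (v :: r) (fun u => h' u - k u + drop_at l v u)
    * pfun (v :: r) (fun u => k u + drop_at l v u) ^+ 2) ->
  pfun (v :: r) (fun u => h u + k u + l u) * pfun (v :: r) (fun u => h u - k u - l u)
    * pfun (v :: r) (fun u => k u - l u) ^+ 2 <=
  pfun (v :: r) (fun u => h u + k u - l u) * pfun (v :: r) (fun u => h u - k u + l u)
    * pfun (v :: r) (fun u => k u + l u) ^+ 2.
Proof.
move=> vr k0 l0 IHr IHl.
have cv u : 0 <= c v u by exact: c_ge0.
pose e := expR (k v); pose e' := expR (- k v).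
pose H := expR (h v); pose H' := expR (- h v).
have [e0 e'0 H0 H'0] : [/\ 0 < e, 0 < e', 0 < H & 0 < H'] by rewrite !expR_gt0.
have ee : e * e' = 1 by rewrite -expRD subrr expR0.
have HH : H * H' = 1 by rewrite -expRD subrr expR0.
have ele : e' <= e by rewrite ler_expR; have := k0 v; lra.
pose a1 := pfun r (fun u => h u + k u + l u + c v u).
pose b1 := pfun r (fun u => h u + k u + l u - c v u).
pose c1 := pfun r (fun u => h u - k u + l u + c v u).
pose d1 := pfun r (fun u => h u - k u + l u - c v u).
pose a2 := pfun r (fun u => h u - k u - l u - c v u).
pose b2 := pfun r (fun u => h u - k u - l u + c v u).
pose c2 := pfun r (fun u => h u + k u - l u - c v u).
pose d2 := pfun r (fun u => h u + k u - l u + c v u).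
pose a0 := pfun r (fun u => k u + l u + c v u).
pose b0 := pfun r (fun u => k u + l u - c v u).
pose c0 := pfun r (fun u => k u - l u - c v u).
pose d0 := pfun r (fun u => k u - l u + c v u).
have [[p1 p2 p3] [p4 p5 p6] [p7 p8 p9] [p10 p11 p12]] : [/\ [/\ 0 < a1, 0 < b1 & 0 < c1],
  [/\ 0 < d1, 0 < a2 & 0 < b2], [/\ 0 < c2, 0 < d2 & 0 < a0] &
  [/\ 0 < b0, 0 < c0 & 0 < d0]] by do ![split]; apply: pfun_gt0.
pose y := expR (2 * l v); pose f := expR (l v); pose f' := expR (- l v).
have [f0 f'0] : 0 < f /\ 0 < f' by rewrite !expR_gt0.
have y1 : 1 <= y by rewrite -expR0 ler_expR; have := l0 v; lra.
have fE : f = f' * y by rewrite /f /f' /y -expRD; congr expR; ring.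
have crt := @cross_ratio_transport R (e * a0) (e' * b0) (e' * c0) (e * d0)
  (H * e * a1) (H' * e' * b1) (H * e' * c1) (H' * e * d1)
  (H' * e * a2) (H * e' * b2) (H' * e' * c2) (H * e * d2) y.
rewrite /= -/a1 -/b1 -/c1 -/d1 -/a2 -/b2 -/c2 -/d2 -/a0 -/b0 -/c0 -/d0.
rewrite !(opprD, opprK) !expRD -/e -/e' -/H -/H' -/f -/f' fE.
rewrite [leLHS](_ : _ = f' ^+ 4 * ((H * e * a1 * y + H' * e' * b1) *
  (H' * e * a2 * y + H * e' * b2) * (e' * c0 * y + e * d0) ^+ 2)); last by ring.
rewrite [leRHS](_ : _ = f' ^+ 4 * ((e * a0 * y + e' * b0) ^+ 2 *
  ((H * e' * c1 * y + H' * e * d1) * (H' * e' * c2 * y + H * e * d2)))); last by ring.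
rewrite ler_pM2l ?exprn_gt0 //.
have k2 u : 0 <= 2 * k u by have := k0 u; lra.
have c2' u : 0 <= 2 * c v u by have := cv u; lra.
have e'2 : e' * e' <= e * e by apply: ler_pM => //; exact: ltW.
have bc0 : b0 * c0 <= a0 * d0.
  rewrite /c0 -pfunN /d0 -(pfunN _ (fun u => k u - l u + c v u)).
  by apply: (pfun_supermodular _ (X := fun u => - k u + l u - c v u) k2 c2') => u; ring.
have bc1 : b1 * c1 <= a1 * d1.
  by apply: (pfun_supermodular _ (X := fun u => h u - k u + l u - c v u) k2 c2') => u; ring.
have bc2 : b2 * c2 <= d2 * a2.
  by apply: (pfun_supermodular _ (X := fun u => h u - k u - l u - c v u) c2' k2) => u; ring.
have ee'0 : 0 <= e' * e' by rewrite mulr_ge0 // ltW.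
have ee0 : 0 <= e * e by rewrite mulr_ge0 // ltW.
apply: crt; rewrite ?mulr_gt0 //.
- rewrite [leLHS](_ : _ = e' * e' * (b0 * c0)); last by ring.
  rewrite [leRHS](_ : _ = e * e * (a0 * d0)); last by ring.
  by apply: ler_pM => //; rewrite mulr_ge0 // ltW.
- rewrite [leLHS](_ : _ = (H * H') * (e' * e' * (b1 * c1))); last by ring.
  rewrite [leRHS](_ : _ = (H * H') * (e * e * (a1 * d1))); last by ring.
  by rewrite HH !mul1r; apply: ler_pM => //; rewrite mulr_ge0 // ltW.
- rewrite [leLHS](_ : _ = (H * H') * (e' * e' * (b2 * c2))); last by ring.
  rewrite [leRHS](_ : _ = (H * H') * (e * e * (d2 * a2))); last by ring.
  by rewrite HH !mul1r; apply: ler_pM => //; rewrite mulr_ge0 // ltW.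
- have lc u : 0 <= l u + c v u by exact: addr_ge0.
  have := IHr h k (fun u => l u + c v u) k0 lc.
  have -> : pfun r (fun u => h u + k u + (l u + c v u)) = a1 by apply: eq_pfun => u; ring.
  have -> : pfun r (fun u => h u - k u - (l u + c v u)) = a2 by apply: eq_pfun => u; ring.
  have -> : pfun r (fun u => k u - (l u + c v u)) = c0 by apply: eq_pfun => u; ring.
  have -> : pfun r (fun u => h u + k u - (l u + c v u)) = c2 by apply: eq_pfun => u; ring.
  have -> : pfun r (fun u => h u - k u + (l u + c v u)) = c1 by apply: eq_pfun => u; ring.
  have -> : pfun r (fun u => k u + (l u + c v u)) = a0 by apply: eq_pfun => u; ring.
  move=> hh.
  rewrite [leLHS](_ : _ = (H * H') * (e * e') ^+ 2 * (a1 * a2 * c0 ^+ 2)); last by ring.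
  rewrite [leRHS](_ : _ = (H * H') * (e * e') ^+ 2 * (c2 * c1 * a0 ^+ 2)); last by ring.
  by rewrite HH ee expr1n !mul1r.
- have lc u : 0 <= k u + c v u by exact: addr_ge0.
  have := IHr h (fun u => k u + c v u) l lc l0.
  have -> : pfun r (fun u => h u + (k u + c v u) + l u) = a1 by apply: eq_pfun => u; ring.
  have -> : pfun r (fun u => h u - (k u + c v u) - l u) = a2 by apply: eq_pfun => u; ring.
  have -> : pfun r (fun u => k u + c v u - l u) = d0 by apply: eq_pfun => u; ring.
  have -> : pfun r (fun u => h u + (k u + c v u) - l u) = d2 by apply: eq_pfun => u; ring.
  have -> : pfun r (fun u => h u - (k u + c v u) + l u) = d1 by apply: eq_pfun => u; ring.
  have -> : pfun r (fun u => k u + c v u + l u) = a0 by apply: eq_pfun => u; ring.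
  move=> hh.
  rewrite [leLHS](_ : _ = (H * H') * (e ^+ 4 * (a1 * a2 * d0 ^+ 2))); last by ring.
  rewrite [leRHS](_ : _ = (H * H') * (e ^+ 4 * (d2 * d1 * a0 ^+ 2))); last by ring.
  by rewrite HH !mul1r ler_pM2l // exprn_gt0.
(* Adding [ln z / 2] to the field at [v] multiplies the weights of its two spins by [g] and [g']
   with [g = g' z]: this is the variable of the quadratic. *)
move=> z z0.
pose t := ln z / 2; pose g := expR t; pose g' := expR (- t).
have g'0 : 0 < g' by exact: expR_gt0.
have gE : g = g' * z by rewrite /g /g' -[X in _ * X](lnK z0) -expRD /t; congr expR; field.
have := IHl (fun u => if u == v then h v + t else h u).
rewrite /= /drop_at eqxx !(addr0, subr0).
have out u : u \in r -> u != v by move=> ur; apply: contraNneq vr => <-.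
have -> : pfun r (fun u => (if u == v then h v + t else h u) + k u + (if u == v then 0 else l
  u) + c v u) = a1.
  by apply: eq_in_pfun => u ur; rewrite !(negPf (out u ur)); ring.
have -> : pfun r (fun u => (if u == v then h v + t else h u) + k u + (if u == v then 0 else l
  u) - c v u) = b1.
  by apply: eq_in_pfun => u ur; rewrite !(negPf (out u ur)); ring.
have -> : pfun r (fun u => (if u == v then h v + t else h u) - k u - (if u == v then 0 else l
  u) + c v u) = b2.
  by apply: eq_in_pfun => u ur; rewrite !(negPf (out u ur)); ring.
have -> : pfun r (fun u => (if u == v then h v + t else h u) - k u - (if u == v then 0 else l
  u) - c v u) = a2.
  by apply: eq_in_pfun => u ur; rewrite !(negPf (out u ur)); ring.
have -> : pfun r (fun u => k u - (if u == v then 0 else l u) + c v u) = d0.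
  by apply: eq_in_pfun => u ur; rewrite !(negPf (out u ur)); ring.
have -> : pfun r (fun u => k u - (if u == v then 0 else l u) - c v u) = c0.
  by apply: eq_in_pfun => u ur; rewrite !(negPf (out u ur)); ring.
have -> : pfun r (fun u => (if u == v then h v + t else h u) + k u - (if u == v then 0 else l
  u) + c v u) = d2.
  by apply: eq_in_pfun => u ur; rewrite !(negPf (out u ur)); ring.
have -> : pfun r (fun u => (if u == v then h v + t else h u) + k u - (if u == v then 0 else l
  u) - c v u) = c2.
  by apply: eq_in_pfun => u ur; rewrite !(negPf (out u ur)); ring.
have -> : pfun r (fun u => (if u == v then h v + t else h u) - k u + (if u == v then 0 else l
  u) + c v u) = c1.
  by apply: eq_in_pfun => u ur; rewrite !(negPf (out u ur)); ring.
have -> : pfun r (fun u => (if u == v then h v + t else h u) - k u + (if u == v then 0 else l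
  u) - c v u) = d1.
  by apply: eq_in_pfun => u ur; rewrite !(negPf (out u ur)); ring.
have -> : pfun r (fun u => k u + (if u == v then 0 else l u) + c v u) = a0.
  by apply: eq_in_pfun => u ur; rewrite !(negPf (out u ur)); ring.
have -> : pfun r (fun u => k u + (if u == v then 0 else l u) - c v u) = b0.
  by apply: eq_in_pfun => u ur; rewrite !(negPf (out u ur)); ring.
rewrite !(opprD, opprK) !expRD -/e -/e' -/H -/H' -/g -/g' gE => hh.
rewrite -(ler_pM2l (exprn_gt0 2 g'0)).
rewrite [leLHS](_ : _ = (H * (g' * z) * e * a1 + H' * g' * e' * b1) *
  (H * (g' * z) * e' * b2 + H' * g' * e * a2) * (e * d0 + e' * c0) ^+ 2); last by ring.
rewrite [leRHS](_ : _ = (H * (g' * z) * e * d2 + H' * g' * e' * c2) *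
  (H * (g' * z) * e' * c1 + H' * g' * e * d1) * (e * a0 + e' * b0) ^+ 2); last by ring.
exact: hh.
Qed.

(** When [l] vanishes on [r] the two sides coincide. The list [s] contains the sites of [r] where
    [l] may be nonzero, and each of them is moved in turn to the head of [r]. *)
Lemma field_dominatedP r : uniq r -> field_dominated r.
Proof.
elim: {r}(size r).+1 {-2}r (ltnSn (size r)) => // n IHn r rn ur h0 k l' k0.
have main : forall (s : seq T) l h, (forall u, 0 <= l u) ->
    {in r, forall u, u \notin s -> l u = 0} ->
  pfun r (fun u => h u + k u + l u) * pfun r (fun u => h u - k u - l u)
    * pfun r (fun u => k u - l u) ^+ 2 <=
  pfun r (fun u => h u + k u - l u) * pfun r (fun u => h u - k u + l u)
    * pfun r (fun u => k u + l u) ^+ 2; last first.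
  by move=> l0; apply: (main r) => // u ->.
elim=> [|v s IHs] l h' l0 lr.
  rewrite (eq_in_pfun (l := fun u => h' u + k u - l u)); last by move=> u /lr ->;
    rewrite ?subr0 ?addr0.
  rewrite (eq_in_pfun (l := fun u => h' u - k u + l u) (k := fun u => h' u - k u - l u));
    last first.
    by move=> u /lr ->; rewrite ?subr0 ?addr0.
  by rewrite (eq_in_pfun (l := fun u => k u + l u) (k := fun u => k u - l u)) // => u /lr ->;
    rewrite ?subr0 ?addr0.
have [vr|vr] := boolP (v \in r); last first.
  apply: IHs => // u ur' us; apply: lr => //; rewrite inE negb_or us andbT.
  by apply: contraNneq vr => <-.
rewrite !(pfun_rem _ vr); apply: field_dominated_step => //.
- by rewrite mem_rem_uniqF.
- apply: IHn; last exact: rem_uniq.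
  by rewrite size_rem // prednK //; case: (r) vr.
move=> h''; rewrite -!(pfun_rem _ vr); apply: IHs => [u|u ur' us]; rewrite /drop_at.
  by case: ifP.
by case: ifPn => // uv; apply: lr => //; rewrite inE negb_or uv.
Qed.

End PartitionFunction.

(** * Ising measures in a general field and the influence of a boundary field *)

Section Ising.
Variables (R : realType) (T : finType) (c : T -> T -> R).
Hypothesis c_sym : forall u v, c u v = c v u.
Hypothesis c_ge0 : forall u v, 0 <= c u v.
Hypothesis c_diag : forall u, c u u = 0.
Implicit Types (k b h : T -> R) (s : {ffun T -> bool}) (r : seq T) (u v i : T).

Definition ising_energy r k s : R :=
  2^-1 * (\sum_(u <- r) \sum_(v <- r) c u v * (spin R (s u) * spin R (s v)))
  + \sum_(u <- r) k u * spin R (s u).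

Definition ising_weight k s : R := expR (ising_energy (index_enum T) k s).

Definition flip v s : {ffun T -> bool} := [ffun u => if u == v then ~~ s u else s u].

Lemma flipK v : involutive (flip v).
Proof. by move=> s; apply/ffunP => u; rewrite !ffunE; case: eqP; rewrite ?negbK. Qed.

Lemma sum_flip v (F : {ffun T -> bool} -> R) :
  \sum_s F s = \sum_(s : {ffun T -> bool} | s v) (F s + F (flip v s)).
Proof.
rewrite big_split (bigID (fun s : {ffun T -> bool} => s v)) /=; congr (_ + _).
rewrite (reindex_inj (inv_inj (flipK v))) /=.
by apply: eq_bigl => s; rewrite ffunE eqxx negbK.
Qed.

Lemma ising_energy_cons v r k s : ising_energy (v :: r) k s =
  k v * spin R (s v) + ising_energy r (fun u => k u + spin R (s v) * c v u) s.
Proof.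
rewrite /ising_energy !big_cons c_diag mul0r add0r.
set s_ := fun u => spin R (s u).
have -> : \sum_(u <- r) \sum_(w <- v :: r) c u w * (spin R (s u) * spin R (s w)) =
    \sum_(u <- r) c v u * (s_ v * s_ u)
    + \sum_(u <- r) \sum_(w <- r) c u w * (spin R (s u) * spin R (s w)).
  rewrite -big_split; apply: eq_bigr => u _; rewrite big_cons c_sym.
  by congr (_ * _ + _); rewrite mulrC.
have -> : \sum_(u <- r) (k u + spin R (s v) * c v u) * spin R (s u) =
    \sum_(u <- r) k u * spin R (s u) + \sum_(u <- r) c v u * (s_ v * s_ u).
  by rewrite -big_split; apply: eq_bigr => u _; rewrite /s_ /=; ring.
by rewrite /s_; field.
Qed.

Lemma ising_energy_flip v r k s : v \notin r ->
  ising_energy r k (flip v s) = ising_energy r k s.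
Proof.
move=> vr; have E u : u \in r -> flip v s u = s u.
  by move=> ur; rewrite ffunE ifN //; apply: contraNneq vr => <-.
rewrite /ising_energy; congr (_ * _ + _).
  by apply: eq_big_seq => u ur; apply: eq_big_seq => w wr; rewrite !E.
by apply: eq_big_seq => u ur; rewrite !E.
Qed.

Let halfD (x : R) : 2^-1 * (x + x) = x.
Proof. by field. Qed.

Lemma sum_ising_energy_plus v r k : uniq (v :: r) ->
  \sum_(s : {ffun T -> bool} | s v) expR (ising_energy (v :: r) k s) =
  expR (k v) * (2^-1 * \sum_s expR (ising_energy r (fun u => k u + c v u) s)).
Proof.
move=> /andP[vr ur]; rewrite (sum_flip v (fun s => expR (ising_energy r _ s))).
rewrite !mulr_sumr; apply: eq_bigr => s sv.
rewrite ising_energy_cons sv mulr1 expRD ising_energy_flip //.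
congr (_ * _); rewrite halfD.
by congr (expR _); rewrite /ising_energy; congr (_ + _); apply: eq_bigr => u _; rewrite mul1r.
Qed.

Lemma sum_ising_energy_minus v r k : uniq (v :: r) ->
  \sum_(s : {ffun T -> bool} | ~~ s v) expR (ising_energy (v :: r) k s) =
  expR (- k v) * (2^-1 * \sum_s expR (ising_energy r (fun u => k u - c v u) s)).
Proof.
move=> /andP[vr ur]; rewrite (sum_flip v (fun s => expR (ising_energy r _ s))).
rewrite (reindex_inj (inv_inj (flipK v))) /=.
rewrite (eq_bigl (fun s : {ffun T -> bool} => s v)); last by move=> s; rewrite ffunE eqxx negbK.
rewrite !mulr_sumr; apply: eq_bigr => s sv.
rewrite ising_energy_cons ffunE eqxx sv /= mulrN1 expRD !ising_energy_flip //.
congr (_ * _); rewrite halfD.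
by congr (expR _); rewrite /ising_energy; congr (_ + _); apply: eq_bigr => u _; rewrite mulN1r.
Qed.

(** Spins outside [r] are free, whence the power of 2; it cancels in every ratio. *)
Lemma sum_ising_energy r k : uniq r ->
  \sum_s expR (ising_energy r k s) = 2 ^+ (#|T| - size r) * pfun c r k.
Proof.
elim: r k => [|v r IH] k ur.
  rewrite subn0 /= mulr1; under eq_bigr do rewrite /ising_energy !big_nil mulr0 addr0 expR0.
  by rewrite big_const iter_addr_0 card_ffun card_bool natrX.
rewrite (bigID (fun s : {ffun T -> bool} => s v)) /=.
rewrite sum_ising_energy_plus // sum_ising_energy_minus //.
have /andP[_ ur'] := ur; rewrite !IH //.
have sz : (size r < #|T|)%N by rewrite cardE; apply: (uniq_leq_size ur) => u _; rewrite mem_enum.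
rewrite (_ : (#|T| - size r = (#|T| - (size r).+1).+1)%N); last by rewrite -subnSK.
by rewrite exprS; field.
Qed.

Lemma perm_ising_energy r r' k s : perm_eq r r' -> ising_energy r k s = ising_energy r' k s.
Proof.
move=> rr; rewrite /ising_energy; congr (_ * _ + _); last exact: perm_big.
by rewrite (perm_big _ rr); apply: eq_bigr => u _; exact: perm_big.
Qed.

Lemma ising_weight_gt0 k s : 0 < ising_weight k s.
Proof. exact: expR_gt0. Qed.

Definition ising_Z k := \sum_s ising_weight k s.

Lemma ising_Z_gt0 k : 0 < ising_Z k.
Proof.
rewrite /ising_Z (bigD1 [ffun=> true]) //= ltr_pwDl ?ising_weight_gt0 //.
by apply: sumr_ge0 => s _; exact/ltW/ising_weight_gt0.
Qed.

Definition ising_plus k i := (\sum_(s : {ffun T -> bool} | s i) ising_weight k s) / ising_Z k.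

Lemma ising_plusE k i (W := rem i (index_enum T))
   (p := expR (k i) * pfun c W (fun u => k u + c i u))
   (m := expR (- k i) * pfun c W (fun u => k u - c i u)) :
  ising_plus k i = p / (p + m).
Proof.
have iT : i \in index_enum T by exact: mem_index_enum.
have uW : uniq (i :: W).
  by rewrite -(perm_uniq (perm_to_rem iT)) index_enum_uniq.
have E s : ising_weight k s = expR (ising_energy (i :: W) k s).
  by rewrite /ising_weight (perm_ising_energy _ _ (perm_to_rem iT)).
have /andP[_ uW'] := uW.
rewrite /ising_plus /ising_Z; under eq_bigr do rewrite E.
rewrite [X in _ / X](bigID (fun s : {ffun T -> bool} => s i)) /=.
under [X in _ / (X + _)]eq_bigr do rewrite E.
under [X in _ / (_ + X)]eq_bigr do rewrite E.
rewrite sum_ising_energy_plus // sum_ising_energy_minus // !sum_ising_energy //.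
have a0 : 0 < 2 ^+ (#|T| - size W) :> R by rewrite exprn_gt0.
have pm : 0 < p + m by rewrite addr_gt0 // mulr_gt0 ?expR_gt0 ?pfun_gt0.
move: a0 pm; rewrite {}/p {}/m; set a := 2 ^+ _ => a0 pm.
by field; rewrite !gt_eqF // addr_gt0 // !mulr_gt0 ?expR_gt0 ?pfun_gt0.
Qed.

Lemma ising_plusN k i : ising_plus (fun u => - k u) i = 1 - ising_plus k i.
Proof.
rewrite !ising_plusE; set W := rem _ _.
rewrite -(pfunN c W (fun u => - k u + c i u)) -(pfunN c W (fun u => - k u - c i u)).
rewrite (eq_pfun c W (l := fun u => k u - c i u)); last by move=> u; ring.
rewrite (eq_pfun c W (k := fun u => - (- k u - c i u)) (l := fun u => k u + c i u));
  last by move=> u; ring.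
rewrite opprK; set p := expR (k i) * _; set m := expR (- k i) * _.
have pm : 0 < p + m by rewrite addr_gt0 // mulr_gt0 ?expR_gt0 ?pfun_gt0.
by field; rewrite gt_eqF // addrC gt_eqF.
Qed.

(** [field_dominated] with [k = b] and [l = c i] bounds the odds ratio [p1 m2 / (p2 m1)] by
    [(p0 / m0)^2], where [p0 / m0] are the odds of a plus at [i] in the field [b] alone. The
    right-hand side is the mean spin at [i] in that field. *)
Lemma ising_plus_influence h b i : (forall u, 0 <= b u) ->
  ising_plus (fun u => h u + b u) i - ising_plus (fun u => h u - b u) i <=
  2 * ising_plus b i - 1.
Proof.
move=> b0; rewrite !ising_plusE; set W := rem _ _.
have uW : uniq W by rewrite rem_uniq // index_enum_uniq.
have := @field_dominatedP R T c c_sym c_ge0 W uW h b (c i) b0 (c_ge0 i).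
have le0 : pfun c W (fun u => b u - c i u) <= pfun c W (fun u => b u + c i u).
  rewrite -ler_sqr ?nnegrE ?(ltW (pfun_gt0 _ _ _)) // !expr2.
  rewrite -{2}(pfunN c W (fun u => b u - c i u)) -{2}(pfunN c W (fun u => b u + c i u)).
  have b2 u : 0 <= 2 * b u by have := b0 u; lra.
  have c2 u : 0 <= 2 * c i u by have := c_ge0 i u; lra.
  by apply: (pfun_supermodular c_ge0 _ (X := fun u => - b u - c i u) b2 c2) => u; ring.
set f1 := pfun c W (fun u => h u + b u + c i u); set g1 := pfun c W (fun u => h u + b u - c i u).
set f2 := pfun c W (fun u => h u - b u + c i u); set g2 := pfun c W (fun u => h u - b u - c i u).
move: le0; set f0 := pfun c W (fun u => b u + c i u); set g0 := pfun c W (fun u => b u - c i u).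
move=> le0 dss.
have [q1 q2 q3 [q4 q5 q6]] : [/\ 0 < f1, 0 < g1, 0 < f2 & [/\ 0 < g2, 0 < f0 & 0 < g0]].
  by split; [| | |split]; apply: pfun_gt0.
set p1 := expR _ * f1; set m1 := expR _ * g1.
set p2 := expR _ * f2; set m2 := expR _ * g2.
set p0 := expR _ * f0; set m0 := expR _ * g0.
have p1p : 0 < p1 by rewrite mulr_gt0 // expR_gt0.
have m1p : 0 < m1 by rewrite mulr_gt0 // expR_gt0.
have p2p : 0 < p2 by rewrite mulr_gt0 // expR_gt0.
have m2p : 0 < m2 by rewrite mulr_gt0 // expR_gt0.
have p0p : 0 < p0 by rewrite mulr_gt0 // expR_gt0.
have m0p : 0 < m0 by rewrite mulr_gt0 // expR_gt0.
have mp0 : m0 <= p0.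
  by apply: ler_pM; rewrite ?expR_ge0 ?(ltW q6) // ler_expR; have := b0 i; lra.
have {dss} dss : p1 * m2 * m0 ^+ 2 <= p2 * m1 * p0 ^+ 2.
  have -> : p1 * m2 * m0 ^+ 2 = f1 * g2 * g0 ^+ 2.
    rewrite /p1 /m2 /m0; transitivity ((expR (h i + b i) * expR (- (h i - b i)) * (expR (- b
      i)) ^+ 2) * (f1 * g2 * g0 ^+ 2)); first by ring.
    by rewrite expr2 -!expRD [X in expR X](_ : _ = 0) ?expR0 ?mul1r //; ring.
  have -> // : p2 * m1 * p0 ^+ 2 = g1 * f2 * f0 ^+ 2.
    rewrite /p2 /m1 /p0; transitivity ((expR (h i - b i) * expR (- (h i + b i)) * (expR (b i))
      ^+ 2) * (g1 * f2 * f0 ^+ 2)); first by ring.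
    by rewrite expr2 -!expRD [X in expR X](_ : _ = 0) ?expR0 ?mul1r //; ring.
clearbody p1 p2 m1 m2 p0 m0.
have s1 : 0 < p1 + m1 by exact: addr_gt0. have s2 : 0 < p2 + m2 by exact: addr_gt0.
have s0 : 0 < p0 + m0 by exact: addr_gt0.
rewrite (_ : _ - 1 = (p0 - m0) / (p0 + m0)); last by field; rewrite gt_eqF.
rewrite (_ : _ - _ = (p1 * m2 - p2 * m1) / ((p1 + m1) * (p2 + m2))); last by field; rewrite !gt_eqF.
rewrite ler_pdivrMr ?mulr_gt0 // mulrAC ler_pdivlMr //.
have [x xE x0] : exists2 x, p1 * m2 = x ^+ 2 & 0 < x.
  by exists (Num.sqrt (p1 * m2)); rewrite ?sqr_sqrtr ?sqrtr_gt0 ?mulr_gt0 // ltW // mulr_gt0.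
have [y yE y0] : exists2 y, p2 * m1 = y ^+ 2 & 0 < y.
  by exists (Num.sqrt (p2 * m1)); rewrite ?sqr_sqrtr ?sqrtr_gt0 ?mulr_gt0 // ltW // mulr_gt0.
have xy : x * m0 <= y * p0.
  have hx : (x * m0) ^+ 2 <= (y * p0) ^+ 2 by rewrite !exprMn -xE -yE.
  by move: hx; rewrite ler_sqr // nnegrE mulr_ge0 // ltW.
(* Arithmetic-geometric mean inequality; equality is the case of two symmetric probabilities. *)
have den : (x + y) ^+ 2 <= (p1 + m1) * (p2 + m2).
  have h4 : 2 * x * y <= p1 * p2 + m1 * m2.
    have hx : (2 * x * y) ^+ 2 <= (p1 * p2 + m1 * m2) ^+ 2.
      by rewrite !exprMn -xE -yE; have := sqr_ge0 (p1 * p2 - m1 * m2); lra.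
    by move: hx; rewrite ler_sqr // nnegrE ?addr_ge0 // !mulr_ge0 // ltW.
  by rewrite (_ : (p1 + m1) * (p2 + m2) = p1 * p2 + m1 * m2 + p1 * m2 + p2 * m1); [lra | ring].
rewrite xE yE.
apply: (@le_trans _ _ ((p0 - m0) * (x + y) ^+ 2)); last by rewrite ler_wpM2l // subr_ge0.
rewrite -subr_ge0 (_ : _ - _ = 2 * (x + y) * (y * p0 - x * m0)); last by ring.
by rewrite mulr_ge0 ?subr_ge0 // mulr_ge0 // ltW // addr_gt0.
Qed.

End Ising.

(** * Positive association and the OSSS inequality *)

Section FKG.
Variables (R : realFieldType) (E : finType).
Implicit Types (A O X Y : {set E}) (w f g : {set E} -> R) (e : E).

Definition increasing f := forall X Y, X \subset Y -> f X <= f Y.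

Lemma increasing_mem e : increasing (fun X => (e \in X)%:R).
Proof.
move=> X Y XY; rewrite ler_nat; have := subsetP XY e.
by case: (e \in X) => //= /(_ isT) ->.
Qed.

(** A configuration is the set of its open elements. The pair [A], [O] records a partial
    exploration: the states on [A] are known, and [O] is the set of those found open. *)
Definition slice_sum w A O f := \sum_(X : {set E} | X :&: A == O) w X * f X.

Definition cond_exp w A O f := slice_sum w A O f / slice_sum w A O (fun=> 1).

(** Holley's condition, with the intersection on the side of the smaller measure; for [w = w'] it is
    the FKG lattice condition. *)
Definition holley w w' := forall X Y, w X * w' Y <= w (X :&: Y) * w' (X :|: Y).

Lemma sliceU1 A O X e : e \notin A -> O \subset A ->
  (X :&: (e |: A) == O) = (X :&: A == O) && (e \notin X).
Proof.
move=> eA OA; apply/eqP/andP => [XO|[/eqP XO eX]].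
  have eX : e \notin X.
    apply/negP => eX; have : e \in O by rewrite -XO !inE eX eqxx.
    by move/(subsetP OA); rewrite (negPf eA).
  by split => //; rewrite -XO; apply/eqP/setP => x; rewrite !inE;
    case: eqVneq => [->|//]; rewrite (negPf eA) (negPf eX).
rewrite -XO; apply/setP => x; rewrite !inE.
by case: eqVneq => [->|//]; rewrite (negPf eX).
Qed.

Lemma sliceU1' A O X e : e \notin A -> O \subset A ->
  (X :&: (e |: A) == e |: O) = (X :&: A == O) && (e \in X).
Proof.
move=> eA OA; have eO : e \notin O by apply: contra eA; apply: subsetP.
apply/eqP/andP => [XO|[/eqP XO eX]].
  split.
    apply/eqP/setP => x; move/setP/(_ x): XO; rewrite !inE.
    by case: eqVneq => [->|//]; rewrite (negPf eA) (negPf eO) andbF.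
  by move/setP/(_ e): XO; rewrite !inE eqxx andbT => ->.
rewrite -XO; apply/setP => x; rewrite !inE.
by case: eqVneq => [->|//]; rewrite eX.
Qed.

Lemma slice_sumU1 w A O f e : e \notin A -> O \subset A ->
  slice_sum w A O f = slice_sum w (e |: A) (e |: O) f + slice_sum w (e |: A) O f.
Proof.
move=> eA OA; rewrite /slice_sum (bigID (fun X : {set E} => e \in X)) /=.
by congr (_ + _); apply: eq_bigl => X; [rewrite sliceU1' | rewrite sliceU1].
Qed.

Lemma slice_move A O O' X : O' \subset A -> ((X :\: A) :|: O') :&: A = O'.
Proof.
move=> OA; apply/setP => x; rewrite !inE.
have := subsetP OA x; case: (x \in O'); case: (x \in A); rewrite ?orbT ?orbF ?andbF //=.
by move/(_ isT).
Qed.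

Lemma slice_moveK A O O' X : O' \subset A -> X :&: A = O -> (((X :\: A) :|: O') :\: A) :|: O = X.
Proof.
move=> OA XO; apply/setP => x; rewrite -XO !inE.
have := subsetP OA x; case: (x \in O'); case: (x \in A); case: (x \in X) => //=.
all: by move/(_ isT).
Qed.

Lemma reindex_slice w A O O' f : O \subset A -> O' \subset A ->
  slice_sum w A O' f =
  slice_sum (fun X => w ((X :\: A) :|: O')) A O (fun X => f ((X :\: A) :|: O')).
Proof.
move=> OA OA'; rewrite /slice_sum.
rewrite (reindex_onto (fun X => (X :\: A) :|: O') (fun X => (X :\: A) :|: O)) /=; last first.
  by move=> X /eqP XO; apply: slice_moveK.
apply: eq_bigl => X; rewrite slice_move // eqxx /=.
by apply/eqP/eqP => [<-|XO]; [apply: slice_move | apply: slice_moveK].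
Qed.

Section Weight.
Variable w : {set E} -> R.
Hypothesis w_gt0 : forall X, 0 < w X.

Lemma slice_sum1_gt0 A O : O \subset A -> 0 < slice_sum w A O (fun=> 1).
Proof.
move=> OA; rewrite /slice_sum (bigD1 O) /=; last by rewrite (setIidPl OA).
by rewrite mulr1 ltr_pwDl // sumr_ge0 // => X _; rewrite mulr1 ltW.
Qed.

(** Induction on the number of unexplored elements. Revealing [e] splits the covariance into two
    conditional covariances, nonnegative by induction, and the covariance of the conditional means,
    nonnegative because both means are larger when [e] is open. *)
Lemma fkg_slice A O f g : holley w w -> O \subset A ->
  (forall X Y, X :&: A = O -> Y :&: A = O -> X \subset Y -> f X <= f Y) ->
  (forall X Y, X :&: A = O -> Y :&: A = O -> X \subset Y -> g X <= g Y) ->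
  slice_sum w A O f * slice_sum w A O g <=
  slice_sum w A O (fun X => f X * g X) * slice_sum w A O (fun=> 1).
Proof.
move=> lsm; move: {2}#|~: A| (erefl #|~: A|) => n.
elim: n A O f g => [|n IH] A O f g.
  move/eqP; rewrite cards_eq0 => /eqP An OA _ _.
  have {An} AT : A = setT by rewrite -[A]setCK An setC0.
  have S h : slice_sum w A O h = w O * h O.
    rewrite /slice_sum (big_pred1 O) // => X; by rewrite AT setIT.
  by rewrite !S mulr1 le_eqVlt; apply/orP; left; apply/eqP; ring.
move=> An OA fm gm.
have [e eA] : exists e, e \in ~: A by apply/set0Pn; rewrite -card_gt0 An.
rewrite inE in eA; have eO : e \notin O by apply: contra eA; apply: subsetP.
rewrite !(slice_sumU1 _ _ eA OA).
have OA1 : O \subset e |: A by apply: subset_trans OA (subsetUr _ _).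
have OA2 : e |: O \subset e |: A by exact: setUS.
have cA : #|~: (e |: A)| = n.
  have : (#|~: A| = #|~: (e |: A)| + 1)%N.
    rewrite (cardsD1 e (~: A)) inE eA addnC; congr (_ + _)%N; apply: eq_card => x.
    by rewrite !inE negb_or.
  by rewrite An addn1 => -[].
have sub1 X : X :&: (e |: A) = O -> X :&: A = O.
  by move/eqP; rewrite sliceU1 // => /andP[/eqP].
have sub2 X : X :&: (e |: A) = e |: O -> X :&: A = O.
  by move/eqP; rewrite sliceU1' // => /andP[/eqP].
(* Opening [e] reweights the slice where [e] is closed by the density [w (mv X) / w X]. The lattice
   condition makes it increasing, so the induction hypothesis applies to [h] and this density. *)
have mono1 h : (forall X Y, X :&: A = O -> Y :&: A = O -> X \subset Y -> h X <= h Y) ->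
    slice_sum w (e |: A) O h * slice_sum w (e |: A) (e |: O) (fun=> 1) <=
    slice_sum w (e |: A) (e |: O) h * slice_sum w (e |: A) O (fun=> 1).
  move=> hm; set B := e |: A.
  pose mv X := (X :\: B) :|: (e |: O).
  rewrite !(reindex_slice w _ OA1 OA2) -/B.
  have -> : slice_sum (fun X => w (mv X)) B O (fun=> 1) = slice_sum w B O (fun X => w (mv X) / w X).
    by apply: eq_bigr => X _; rewrite mulr1 mulrC divfK // gt_eqF.
  have mvE X : X :&: B = O -> mv X = e |: X.
    move=> XO; apply/setP => x; rewrite /mv -XO !inE.
    by case: (x == e); case: (x \in A); case: (x \in X).
  have eX X : X :&: B = O -> e \notin X by move/eqP; rewrite sliceU1 // => /andP[].
  apply: (@le_trans _ _ (slice_sum w B O (fun X => h X * (w (mv X) / w X)) * slice_sum w B O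
    (fun=> 1))).
    apply: IH => //; first by move=> X Y /sub1 XO /sub1 YO; apply: hm.
    move=> X Y XO YO XY; rewrite !mvE // ler_pdivrMr // mulrAC ler_pdivlMr //.
    rewrite mulrC; have := lsm Y (e |: X).
    rewrite (_ : Y :&: (e |: X) = X); last first.
      apply/setP => x; rewrite !inE; have := subsetP XY x; have := eX Y YO.
      by case: eqVneq => [->|_]; [case: (e \in Y) => //= _;
        case: (e \in X) => // /(_ isT) | case: (x \in X) => // _; [move=> -> | rewrite andbF]].
    rewrite (_ : Y :|: (e |: X) = e |: Y); last by rewrite setUCA (setUidPl XY).
    by rewrite mulrC [leRHS]mulrC.
  apply: ler_wpM2r; first exact/ltW/slice_sum1_gt0.
  rewrite /slice_sum; apply: ler_sum => X /eqP XO.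
  rewrite mulrCA [w X * _]mulrC divfK ?gt_eqF // mulrC ler_pM2l //.
  apply: hm; [exact: sub1 | | by rewrite -/(mv X) mvE // subsetUr].
  apply: sub2; exact: slice_move.
set f1 := slice_sum w _ (e |: O) f; set f0 := slice_sum w _ O f.
set g1 := slice_sum w _ (e |: O) g; set g0 := slice_sum w _ O g.
set z1 := slice_sum w _ (e |: O) (fun=> 1); set z0 := slice_sum w _ O (fun=> 1).
have z1p : 0 < z1 by exact: slice_sum1_gt0. have z0p : 0 < z0 by exact: slice_sum1_gt0.
have := mono1 f fm; rewrite -/f1 -/f0 -/z1 -/z0 => mf.
have := mono1 g gm; rewrite -/g1 -/g0 -/z1 -/z0 => mg.
have h1 : f1 * g1 <= slice_sum w (e |: A) (e |: O) (fun X => f X * g X) * z1.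
  by apply: IH => // X Y /sub2 XO /sub2 YO; [apply: fm | apply: gm].
have h0 : f0 * g0 <= slice_sum w (e |: A) O (fun X => f X * g X) * z0.
  by apply: IH => // X Y /sub1 XO /sub1 YO; [apply: fm | apply: gm].
move: h1 h0; set s1 := slice_sum _ _ _ _; set s0 := slice_sum _ _ _ _ => h1 h0.
clearbody f1 f0 g1 g0 z1 z0 s1 s0.
rewrite -(ler_pM2r (mulr_gt0 z1p z0p)).
have h1' : f1 * g1 * (z0 * (z1 + z0)) <= s1 * z1 * (z0 * (z1 + z0)).
  by rewrite ler_pM2r // mulr_gt0 // addr_gt0.
have h0' : f0 * g0 * (z1 * (z1 + z0)) <= s0 * z0 * (z1 * (z1 + z0)).
  by rewrite ler_pM2r // mulr_gt0 // addr_gt0.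
have : 0 <= (f1 * z0 - f0 * z1) * (g1 * z0 - g0 * z1) by rewrite mulr_ge0 // subr_ge0.
lra.
Qed.

End Weight.

Lemma fkg w f g : (forall X, 0 < w X) -> holley w w -> increasing f -> increasing g ->
  (\sum_X w X * f X) * (\sum_X w X * g X) <=
  (\sum_X w X * (f X * g X)) * (\sum_X w X).
Proof.
move=> w0 lsm fm gm.
have S h : \sum_X w X * h X = slice_sum w set0 set0 h.
  by apply: eq_bigl => X; rewrite setI0 eqxx.
have S1 : \sum_X w X = slice_sum w set0 set0 (fun=> 1).
  by rewrite -S; apply: eq_bigr => X _; rewrite mulr1.
rewrite S1 (S f) (S g) (S (fun X => f X * g X)).
by apply: fkg_slice => // X Y _ _; [apply: fm | apply: gm].
Qed.

(** Replacing [O] by [O'] and [w] by [w'] amounts to the density [w' (mv X) / w X], increasing by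
    Holley's condition. FKG accounts for the density, and [f] can only grow because [mv X] contains
    [X]. *)
Lemma cond_exp_mono w w' A O O' f :
  (forall X, 0 < w X) -> (forall X, 0 < w' X) -> holley w w -> holley w w' ->
  O \subset O' -> O' \subset A -> increasing f ->
  cond_exp w A O f <= cond_exp w' A O' f.
Proof.
move=> w0 w'0 lsm hol OO OA' fm; have OA := subset_trans OO OA'.
pose mv X := (X :\: A) :|: O'.
rewrite /cond_exp ler_pdivrMr ?slice_sum1_gt0 // mulrAC ler_pdivlMr ?slice_sum1_gt0 //.
rewrite !(reindex_slice w' _ OA OA').
have -> : slice_sum (fun X => w' (mv X)) A O (fun=> 1) = slice_sum w A O (fun X => w' (mv X) / w X).
  by apply: eq_bigr => X _; rewrite mulr1 mulrC divfK // gt_eqF.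
apply: (@le_trans _ _ (slice_sum w A O (fun X => f X * (w' (mv X) / w X)) * slice_sum w A O
  (fun=> 1))).
  apply: fkg_slice => //; first by move=> X Y _ _; apply: fm.
  move=> X Y XO YO XY; rewrite ler_pdivrMr // mulrAC ler_pdivlMr // mulrC.
  have := hol Y (mv X).
  rewrite (_ : Y :&: mv X = X); last first.
    apply/setP => x; rewrite !inE; have := subsetP XY x; have := subsetP OO x;
      have := subsetP OA' x.
    move: YO XO => /setP/(_ x) + /setP/(_ x); rewrite !inE.
    case: (x \in A); case: (x \in X); case: (x \in Y); case: (x \in O); case: (x \in O') => //= ? *;
     solve [done | by match goal with H : _ -> is_true false |- _ => move: (H isT) end].
  rewrite (_ : Y :|: mv X = mv Y); last first.
    apply/setP => x; rewrite !inE; have := subsetP XY x; have := subsetP OO x;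
      have := subsetP OA' x.
    move: YO (erefl (x \in X)) => /setP/(_ x) + _; rewrite !inE.
    case: (x \in A); case: (x \in X); case: (x \in Y); case: (x \in O); case: (x \in O') => //= ? *;
     solve [done | by match goal with H : _ -> is_true false |- _ => move: (H isT) end].
  by rewrite mulrC [leRHS]mulrC.
apply: ler_wpM2r; first exact/ltW/slice_sum1_gt0.
rewrite /slice_sum; apply: ler_sum => X /eqP XO.
rewrite mulrCA [w X * _]mulrC divfK ?gt_eqF // mulrC ler_pM2l //.
apply: fm; rewrite -{1}(setID X A) XO setUC.
exact: setUS.
Qed.

End FKG.

(** * The OSSS inequality for monotonic measures *)

Section OSSS.
Variables (R : realFieldType) (E : finType).
Implicit Types (A O X Y xi zeta : {set E}) (e : E) (h : {set E} -> R).
Variable w : {set E} -> R.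
Hypothesis w_gt0 : forall X, 0 < w X.
Hypothesis w_lsm : holley w w.

Let mass A O := slice_sum w A O (fun=> 1).

Definition cond_prob A O e := mass (e |: A) (e |: O) / mass A O.

Lemma mass_split A O e : e \notin A -> O \subset A ->
  mass A O = mass (e |: A) (e |: O) + mass (e |: A) O.
Proof. by move=> eA OA; rewrite /mass (slice_sumU1 _ _ eA OA). Qed.

Let subU1 A O e : O \subset A -> O \subset e |: A.
Proof. by move=> OA; apply: subset_trans OA (subsetUr _ _). Qed.

Lemma cond_prob_itv A O e : e \notin A -> O \subset A -> 0 <= cond_prob A O e <= 1.
Proof.
move=> eA OA; have m0 : 0 < mass A O by exact: slice_sum1_gt0.
have m1 : 0 < mass (e |: A) (e |: O) by apply: slice_sum1_gt0 => //; exact: setUS.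
have m2 : 0 < mass (e |: A) O by apply: slice_sum1_gt0 => //; exact: subU1.
rewrite /cond_prob; apply/andP; split; first by apply: divr_ge0; exact: ltW.
by rewrite ler_pdivrMr // mul1r (mass_split eA OA) lerDl ltW.
Qed.

Lemma cond_exp_split A O e h : e \notin A -> O \subset A ->
  cond_exp w A O h = cond_prob A O e * cond_exp w (e |: A) (e |: O) h
    + (1 - cond_prob A O e) * cond_exp w (e |: A) O h.
Proof.
move=> eA OA; have m0 : 0 < mass A O by exact: slice_sum1_gt0.
have m1 : 0 < mass (e |: A) (e |: O) by apply: slice_sum1_gt0 => //; exact: setUS.
have m2 : 0 < mass (e |: A) O by apply: slice_sum1_gt0 => //; exact: subU1.
rewrite /cond_exp /cond_prob -/(mass _ _) -/(mass (e |: A) _) -/(mass (e |: A) O).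
rewrite (slice_sumU1 _ _ eA OA) (mass_split eA OA) in m0 *.
by field; rewrite !gt_eqF.
Qed.

Lemma cond_probE A O e : e \notin A -> O \subset A ->
  cond_prob A O e = cond_exp w A O (fun X => (e \in X)%:R).
Proof.
move=> eA OA; rewrite /cond_prob /cond_exp (slice_sumU1 _ (fun X => (e \in X)%:R) eA OA).
rewrite [X in (_ + X) / _]big1 ?addr0; last first.
  by move=> X; rewrite sliceU1 // => /andP[_ /negPf ->]; rewrite mulr0.
congr (_ / _); apply: eq_bigr => X; rewrite sliceU1' // => /andP[_ ->].
by rewrite mulr1.
Qed.

Lemma cond_prob_mono A O O' e : e \notin A -> O \subset O' -> O' \subset A ->
  cond_prob A O e <= cond_prob A O' e.
Proof.
move=> eA OO OA'; have OA := subset_trans OO OA'.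
rewrite !cond_probE //; apply: cond_exp_mono => //; exact: increasing_mem.
Qed.

Variables (q : {set E} -> {set E} -> option E) (f g : {set E} -> R).
Hypothesis q_fresh : forall A O e, q A O = Some e -> e \notin A.
Hypothesis f_itv : forall X, 0 <= f X <= 1.
Hypothesis f_det : forall A O X, O \subset A -> q A O = None -> X :&: A = O -> f X = f O.
Hypothesis g_mono : increasing g.

Let F A O := cond_exp w A O f.
Let G A O := cond_exp w A O g.

(** Mean under the coupling of Bernoulli variables of parameters [a] and [b] by one uniform
    variable; both equal 1 with probability [min a b]. *)
Let cpl (a b x11 x10 x01 x00 : R) :=
  Num.min a b * x11 + (a - Num.min a b) * x10 + (b - Num.min a b) * x01
  + (1 - a - b + Num.min a b) * x00.

(* [f] is evaluated at a configuration explored from [xi] and [g] at one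
   explored from [zeta], both sampled along the decision tree of the first
   with the same uniform variables. *)
Fixpoint coupled_exp n A xi zeta : R := if n is n'.+1 then
    if q A xi is Some e then
      cpl (cond_prob A xi e) (cond_prob A zeta e)
        (coupled_exp n' (e |: A) (e |: xi) (e |: zeta)) (coupled_exp n' (e |: A) (e |: xi) zeta)
        (coupled_exp n' (e |: A) xi (e |: zeta)) (coupled_exp n' (e |: A) xi zeta)
    else F A xi * G A zeta
  else F A xi * G A zeta.

Let cardC1 A e n : e \notin A -> (#|~: A| <= n.+1)%N -> (#|~: (e |: A)| <= n)%N.
Proof.
move=> eA; rewrite (cardsD1 e (~: A)) inE eA add1n ltnS.
by congr (_ <= _)%N; apply: eq_card => x; rewrite !inE negb_or.
Qed.

Lemma cond_exp_const A O h (x : R) : O \subset A ->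
  (forall X, X :&: A = O -> h X = x) -> cond_exp w A O h = x.
Proof.
move=> OA hx; rewrite /cond_exp /slice_sum.
rewrite (eq_bigr (fun X => x * (w X * 1))); last by move=> X /eqP /hx ->; rewrite mulr1 mulrC.
by rewrite -mulr_sumr mulfK // gt_eqF // slice_sum1_gt0.
Qed.

Lemma eq_cond_exp A O h h' : (forall X, X :&: A = O -> h X = h' X) ->
  cond_exp w A O h = cond_exp w A O h'.
Proof.
by move=> hh; rewrite /cond_exp /slice_sum; congr (_ / _); apply: eq_bigr => X /eqP /hh ->.
Qed.

Lemma cond_expZ A O h (x : R) : cond_exp w A O (fun X => x * h X) = x * cond_exp w A O h.
Proof.
rewrite /cond_exp mulrA; congr (_ / _).
by rewrite /slice_sum mulr_sumr; apply: eq_bigr => X _; rewrite mulrCA.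
Qed.

(** Equal configurations stay equal under common uniform variables, and [f] is constant at a leaf,
    so it can be moved inside the conditional mean of [g]. The fuel [n] suffices once it covers the
    unexplored elements. *)
Lemma coupled_exp_diag n A xi : (#|~: A| <= n)%N -> xi \subset A ->
  coupled_exp n A xi xi = cond_exp w A xi (fun X => f X * g X).
Proof.
have leaf A' xi' : xi' \subset A' -> (forall X, X :&: A' = xi' -> f X = f xi') ->
    F A' xi' * G A' xi' = cond_exp w A' xi' (fun X => f X * g X).
  move=> sA fc; rewrite /F (cond_exp_const sA fc) /G -cond_expZ.
  by apply: eq_cond_exp => X XA; rewrite fc.
elim: n A xi => [|n IH] A xi nA sA /=.
  apply: leaf => // X <-; congr (f _); apply/esym/setIidPl/subsetP => x _.
  move: nA; rewrite leqn0 cards_eq0 => /eqP An.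
  by have := in_set0 x; rewrite -An inE => /negbFE.
case qE: (q A xi) => [e|]; last by apply: leaf => // X XA; apply: f_det qE XA.
have eA := q_fresh qE.
rewrite (cond_exp_split _ eA sA) !IH ?cardC1 //; [|exact: subU1|exact: setUS].
by rewrite /cpl minxx; ring.
Qed.

Let G_mono A zeta zeta' : zeta \subset zeta' -> zeta' \subset A -> G A zeta <= G A zeta'.
Proof. by move=> zz zA; apply: cond_exp_mono. Qed.

Let F_itv A xi : xi \subset A -> 0 <= F A xi <= 1.
Proof.
move=> sA; have Z := slice_sum1_gt0 w_gt0 sA; apply/andP; split.
  rewrite /F /cond_exp divr_ge0 ?(ltW Z) // sumr_ge0 // => X _.
  by rewrite mulr_ge0 ?(ltW (w_gt0 _)) //; case/andP: (f_itv X).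
rewrite /F /cond_exp ler_pdivrMr // mul1r; apply: ler_sum => X _.
by rewrite ler_pM2l //; case/andP: (f_itv X).
Qed.

(** Enlarging [zeta] raises the result, and since [f] lies in [0, 1] the gain is at most that of [g]
    alone. The cases order the thresholds [a] and [b <= b'] of the common uniform variable. *)
Lemma coupled_exp_mono n A xi zeta zeta' : xi \subset A ->
  zeta \subset zeta' -> zeta' \subset A ->
  0 <= coupled_exp n A xi zeta' - coupled_exp n A xi zeta <= G A zeta' - G A zeta.
Proof.
have leaf A' xi' (z z' : {set E}) : xi' \subset A' -> z \subset z' -> z' \subset A' ->
    0 <= F A' xi' * G A' z' - F A' xi' * G A' z <= G A' z' - G A' z.
  move=> sA zz zA; have /andP[F0 F1] := F_itv sA; have := G_mono zz zA; rewrite -subr_ge0 => G0.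
  by rewrite -mulrBr mulr_ge0 //= -[leRHS]mul1r ler_wpM2r.
elim: n A xi zeta zeta' => [|n IH] A xi z z' sA zz zA /=; first exact: leaf.
case qE: (q A xi) => [e|]; last exact: leaf.
have eA := q_fresh qE; have zA' := subset_trans zz zA.
have /andP[a0 a1] := cond_prob_itv eA sA.
have /andP[b0 _] := cond_prob_itv eA zA'.
have /andP[_ b1] := cond_prob_itv eA zA.
have bb := cond_prob_mono eA zz zA.
rewrite /G (cond_exp_split _ eA zA) (cond_exp_split _ eA zA') -/(G _ _) -/(G _ z) -/(G _ (e |:
  z)) -/(G _ z').
set a := cond_prob A xi e in a0 a1 *; set b := cond_prob A z e in b0 bb *.
set b' := cond_prob A z' e in b1 bb *.
have s1 : e |: xi \subset e |: A by exact: setUS.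
have s0 : xi \subset e |: A by exact: subU1.
have z1 : e |: z' \subset e |: A by exact: setUS.
have z0 : z' \subset e |: A by exact: subU1.
have zz1 : e |: z \subset e |: z' by exact: setUS.
have zz01 : z \subset e |: z' by exact: subset_trans zz (subsetUr _ _).
have /andP[p1 r1] := IH _ _ _ _ s1 zz1 z1.
have /andP[p2 r2] := IH _ _ _ _ s0 zz1 z1.
have /andP[p3 r3] := IH _ _ _ _ s1 zz z0.
have /andP[p4 r4] := IH _ _ _ _ s0 zz z0.
have /andP[p5 r5] := IH _ _ _ _ s1 zz01 z1.
have /andP[p6 r6] := IH _ _ _ _ s0 zz01 z1.
move: p1 r1 p2 r2 p3 r3 p4 r4 p5 r5 p6 r6.
set y11 := coupled_exp n _ (e |: xi) (e |: z'); set x11 := coupled_exp n _ (e |: xi) (e |: z).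
set y01 := coupled_exp n _ xi (e |: z'); set x01 := coupled_exp n _ xi (e |: z).
set y10 := coupled_exp n _ (e |: xi) z'; set x10 := coupled_exp n _ (e |: xi) z.
set y00 := coupled_exp n _ xi z'; set x00 := coupled_exp n _ xi z.
set g1' := G _ (e |: z'); set g1 := G _ (e |: z); set g0' := G _ z'; set g0 := G _ z.
clearbody a b b' y11 x11 y01 x01 y10 x10 y00 x00 g1' g1 g0' g0.
move=> p1 r1 p2 r2 p3 r3 p4 r4 p5 r5 p6 r6.
have pr (x y t : R) : 0 <= x -> 0 <= y -> y <= t -> 0 <= x * y <= x * t.
  by move=> x0 y0 yt; rewrite mulr_ge0 //= ler_wpM2l.
rewrite /cpl; have [ab|ab] := leP a b.
  have -> : Num.min a b' = a by apply/min_idPl/(le_trans ab).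
  have /andP[m1 n1] := pr a _ _ a0 p1 r1.
  have /andP[m2 n2] := pr (b - a) _ _ (ltac:(by rewrite subr_ge0)) p2 r2.
  have /andP[m3 n3] := pr (b' - b) _ _ (ltac:(by rewrite subr_ge0)) p6 r6.
  have /andP[m4 n4] := pr (1 - b') _ _ (ltac:(by rewrite subr_ge0)) p4 r4.
  by apply/andP; split; lra.
have [ab'|ab'] := leP a b'.
  have /andP[m1 n1] := pr b _ _ b0 p1 r1.
  have /andP[m2 n2] := pr (a - b) _ _ (ltac:(by rewrite subr_ge0 ltW)) p5 r5.
  have /andP[m3 n3] := pr (b' - a) _ _ (ltac:(by rewrite subr_ge0)) p6 r6.
  have /andP[m4 n4] := pr (1 - b') _ _ (ltac:(by rewrite subr_ge0)) p4 r4.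
  by apply/andP; split; lra.
have /andP[m1 n1] := pr b _ _ b0 p1 r1.
have /andP[m2 n2] := pr (b' - b) _ _ (ltac:(by rewrite subr_ge0)) p5 r5.
have /andP[m3 n3] := pr (a - b') _ _ (ltac:(by rewrite subr_ge0 ltW)) p3 r3.
have /andP[m4 n4] := pr (1 - a) _ _ (ltac:(by rewrite subr_ge0)) p4 r4.
by apply/andP; split; lra.
Qed.

(* The conditional covariance of [g] and the indicator of [e]. *)
Let ccov A O e := cond_prob A O e * (1 - cond_prob A O e) * (G (e |: A) (e |: O) - G (e |: A) O).

(** Here [xi] and [zeta] evolve independently; the queries follow [xi] alone, and each of them
    contributes the conditional covariance at [zeta]. *)
Fixpoint excess n A xi zeta : R := if n is n'.+1 then
    if q A xi is Some e then
      ccov A zeta e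
      + cond_prob A xi e * (cond_prob A zeta e * excess n' (e |: A) (e |: xi) (e |: zeta)
                            + (1 - cond_prob A zeta e) * excess n' (e |: A) (e |: xi) zeta)
      + (1 - cond_prob A xi e) * (cond_prob A zeta e * excess n' (e |: A) xi (e |: zeta)
                            + (1 - cond_prob A zeta e) * excess n' (e |: A) xi zeta)
    else 0
  else 0.

(** Replacing the common uniform variable of a query by independent ones costs
    [(min a b - a b) (x11 - x10 - x01 + x00)]. By [coupled_exp_mono] this is at most
    [b (1 - b) (g1 - g0)], the conditional covariance. *)
Lemma coupled_exp_le n A xi zeta : xi \subset A -> zeta \subset A ->
  coupled_exp n A xi zeta <= F A xi * G A zeta + excess n A xi zeta.
Proof.
elim: n A xi zeta => [|n IH] A xi z sA zA /=; first by rewrite addr0.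
case qE: (q A xi) => [e|]; last by rewrite addr0.
have eA := q_fresh qE.
have /andP[a0 a1] := cond_prob_itv eA sA.
have /andP[b0 b1] := cond_prob_itv eA zA.
rewrite /F /G (cond_exp_split f eA sA) (cond_exp_split g eA zA) /ccov.
rewrite -!/(F _ _) -!/(G _ _).
have s1 : e |: xi \subset e |: A by exact: setUS.
have s0 : xi \subset e |: A by exact: subU1.
have z1 : e |: z \subset e |: A by exact: setUS.
have z0 : z \subset e |: A by exact: subU1.
have zz : z \subset e |: z by exact: subsetUr.
have /andP[_ r1] := coupled_exp_mono n s1 zz z1.
have /andP[p0 _] := coupled_exp_mono n s0 zz z1.
have i11 := IH _ _ _ s1 z1. have i10 := IH _ _ _ s1 z0.
have i01 := IH _ _ _ s0 z1. have i00 := IH _ _ _ s0 z0.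
have gg := G_mono zz z1.
move: r1 p0 i11 i10 i01 i00 gg.
set a := cond_prob A xi e in a0 a1 *; set b := cond_prob A z e in b0 b1 *.
set x11 := coupled_exp n _ (e |: xi) (e |: z); set x10 := coupled_exp n _ (e |: xi) z.
set x01 := coupled_exp n _ xi (e |: z); set x00 := coupled_exp n _ xi z.
set y11 := excess n _ (e |: xi) (e |: z); set y10 := excess n _ (e |: xi) z.
set y01 := excess n _ xi (e |: z); set y00 := excess n _ xi z.
set g1 := G _ (e |: z); set g0 := G _ z; set f1 := F _ (e |: xi); set f0 := F _ xi.
clearbody a b x11 x10 x01 x00 y11 y10 y01 y00 g1 g0 f1 f0.
move=> r1 p0 i11 i10 i01 i00 gg.
have [k0 k1] : 0 <= Num.min a b - a * b /\ Num.min a b - a * b <= b * (1 - b).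
  have [ab|ab] := leP a b.
    have : a * b <= a * 1 by rewrite ler_wpM2l.
    have : 0 <= (b - a) * (1 - b) by rewrite mulr_ge0 ?subr_ge0.
    by split; lra.
  have : a * b <= 1 * b by rewrite ler_wpM2r.
  have : 0 <= b * (a - b) by rewrite mulr_ge0 // subr_ge0 ltW.
  by split; lra.
rewrite /cpl; set m := Num.min a b in k0 k1 *; clearbody m.
have h1 : (m - a * b) * (x11 - x10) <= (m - a * b) * (g1 - g0) by rewrite ler_wpM2l.
have h2 : (m - a * b) * (g1 - g0) <= b * (1 - b) * (g1 - g0).
  by rewrite ler_wpM2r // subr_ge0.
have h3 : 0 <= (m - a * b) * (x01 - x00) by rewrite mulr_ge0.
have j11 : a * b * x11 <= a * b * (f1 * g1 + y11) by rewrite ler_wpM2l // mulr_ge0.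
have j10 : a * (1 - b) * x10 <= a * (1 - b) * (f1 * g0 + y10) by rewrite ler_wpM2l // mulr_ge0
  // subr_ge0.
have j01 : (1 - a) * b * x01 <= (1 - a) * b * (f0 * g1 + y01) by rewrite ler_wpM2l // mulr_ge0
  // subr_ge0.
have j00 : (1 - a) * (1 - b) * x00 <= (1 - a) * (1 - b) * (f0 * g0 + y00) by rewrite ler_wpM2l
  // mulr_ge0 // subr_ge0.
lra.
Qed.

Definition mean h := (\sum_X w X * h X) / \sum_X w X.

Let Z_gt0 : 0 < \sum_X w X.
Proof.
rewrite (bigD1 set0) //= ltr_pwDl // sumr_ge0 // => X _; exact: ltW.
Qed.

Lemma cond_exp0 h : cond_exp w set0 set0 h = mean h.
Proof.
rewrite /cond_exp /slice_sum /mean; congr (_ / _); last first.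
  by apply: eq_big => [X|X _]; rewrite ?setI0 ?eqxx ?mulr1.
by apply: eq_bigl => X; rewrite setI0 eqxx.
Qed.

Lemma sum_cond_exp A h :
  \sum_X w X * cond_exp w A (X :&: A) h = \sum_X w X * h X.
Proof.
rewrite (partition_big (fun X => X :&: A) predT) //=.
rewrite [RHS](partition_big (fun X => X :&: A) predT) //=.
apply: eq_bigr => O _.
have [OA|OA] := boolP (O \subset A); last first.
  by rewrite !big_pred0 // => X; apply: contraNF OA => /eqP <-; exact: subsetIr.
rewrite (eq_bigr (fun X => w X * 1 * cond_exp w A O h)); last by move=> X /eqP ->; rewrite mulr1.
rewrite -mulr_suml -/(slice_sum w A O (fun=> 1)) -/(slice_sum w A O h) mulrC divfK //.
by rewrite gt_eqF // slice_sum1_gt0.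
Qed.

Definition cov e := mean (fun X => (e \in X)%:R * g X) - mean (fun X => (e \in X)%:R) * mean g.

Let ind e := fun X : {set E} => (e \in X)%:R : R.

Let cond_exp_ind A O e h : e \notin A -> O \subset A ->
  cond_exp w A O (fun X => ind e X * h X) = cond_prob A O e * cond_exp w (e |: A) (e |: O) h.
Proof.
move=> eA OA; rewrite (cond_exp_split _ eA OA).
rewrite [X in _ + _ * X](cond_exp_const (x := 0)) ?subU1 //; last first.
  by move=> X /eqP; rewrite sliceU1 // => /andP[_ /negPf eX]; rewrite /ind eX mul0r.
rewrite mulr0 addr0; congr (_ * _); apply: eq_cond_exp => X /eqP.
by rewrite sliceU1' // => /andP[_ eX]; rewrite /ind eX mul1r.
Qed.

(** Law of total covariance: the term left out is the covariance of the two conditional means,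
    nonnegative by FKG since both are increasing in the explored part. *)
Lemma sum_ccov_le A e : e \notin A ->
  \sum_X w X * ccov A (X :&: A) e <= (\sum_X w X) * cov e.
Proof.
move=> eA; have XA X : X :&: A \subset A by exact: subsetIr.
have ccE X : ccov A (X :&: A) e =
    cond_exp w A (X :&: A) (fun X => ind e X * g X) - cond_prob A (X :&: A) e * G A (X :&: A).
  by rewrite (cond_exp_ind g) // /ccov /G (cond_exp_split g eA (XA X)); ring.
under eq_bigr do rewrite ccE mulrBr.
rewrite big_split /= sumrN sum_cond_exp.
have := @fkg R E w (fun X => cond_prob A (X :&: A) e) (fun X => G A (X :&: A)) w_gt0 w_lsm.
have m1 : increasing (fun X => cond_prob A (X :&: A) e).
  by move=> X Y XY; apply: cond_prob_mono => //; exact: setSI.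
have m2 : increasing (fun X => G A (X :&: A)).
  by move=> X Y XY; apply: G_mono => //; exact: setSI.
move=> /(_ m1 m2).
rewrite (eq_bigr (fun X => w X * cond_exp w A (X :&: A) (ind e))); last first.
  by move=> X _; rewrite cond_probE.
rewrite (sum_cond_exp A (ind e)) (sum_cond_exp A g) => h.
rewrite /cov /mean -/(ind e); set Z := \sum_X w X in h *.
rewrite mulrBr mulrCA divff ?gt_eqF // mulr1 lerD2l lerN2.
rewrite (_ : Z * _ = (\sum_X w X * ind e X) * (\sum_X w X * g X) / Z); last first.
  by field; rewrite gt_eqF.
by rewrite ler_pdivrMr.
Qed.

Fixpoint revealed n A X : seq E := if n is n'.+1 then
    if q A (X :&: A) is Some e then e :: revealed n' (e |: A) X else [::]
  else [::].

Lemma cond_expD A O h (x : R) : O \subset A ->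
  cond_exp w A O (fun X => x + h X) = x + cond_exp w A O h.
Proof.
move=> OA; have Z0 := slice_sum1_gt0 w_gt0 OA.
rewrite /cond_exp (_ : slice_sum w A O (fun X => x + h X) =
  x * slice_sum w A O (fun=> 1) + slice_sum w A O h); last first.
  by rewrite /slice_sum mulr_sumr -big_split; apply: eq_bigr => X _ /=; ring.
by field; rewrite gt_eqF.
Qed.

(** The second configuration is independent of [xi], hence it remains a sample of [w] on the
    explored set although [xi] chooses that set. By [sum_ccov_le] a query of [e] then costs at most
    [cov e], while [xi] follows its own conditional law. *)
Lemma sum_excess_le n A xi : xi \subset A ->
  \sum_X w X * excess n A xi (X :&: A) <=
  (\sum_X w X) * cond_exp w A xi (fun X => \sum_(e <- revealed n A X) cov e).
Proof.
set Z := \sum_X w X.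
elim: n A xi => [|n IH] A xi sA /=.
  rewrite big1 => [|X _]; last by rewrite mulr0.
  by rewrite (cond_exp_const (x := 0)) ?mulr0 // => X _; rewrite big_nil.
case qE: (q A xi) => [e|]; last first.
  rewrite big1 => [|X _]; last by rewrite mulr0.
  by rewrite (cond_exp_const (x := 0)) ?mulr0 // => X ->; rewrite qE big_nil.
have eA := q_fresh qE.
have /andP[a0 a1] := cond_prob_itv eA sA.
set a := cond_prob A xi e in a0 a1 *.
have XA X : X :&: A \subset A by exact: subsetIr.
have step (h : {set E} -> R) : \sum_X w X * (cond_prob A (X :&: A) e * h (e |: (X :&: A)) +
    (1 - cond_prob A (X :&: A) e) * h (X :&: A)) = \sum_X w X * h (X :&: (e |: A)).
  rewrite -(sum_cond_exp A (fun X => h (X :&: (e |: A)))); apply: eq_bigr => X _.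
  rewrite (cond_exp_split _ eA (XA X)); congr (_ * (_ * _ + _ * _)).
    by rewrite (cond_exp_const (x := h (e |: (X :&: A)))) ?setUS // => Y ->.
  by rewrite (cond_exp_const (x := h (X :&: A))) ?subU1 // => Y ->.
have -> : \sum_X w X * (ccov A (X :&: A) e
      + a * (cond_prob A (X :&: A) e * excess n (e |: A) (e |: xi) (e |: (X :&: A))
             + (1 - cond_prob A (X :&: A) e) * excess n (e |: A) (e |: xi) (X :&: A))
      + (1 - a) * (cond_prob A (X :&: A) e * excess n (e |: A) xi (e |: (X :&: A))
             + (1 - cond_prob A (X :&: A) e) * excess n (e |: A) xi (X :&: A))) =
    \sum_X w X * ccov A (X :&: A) e
    + a * (\sum_X w X * excess n (e |: A) (e |: xi) (X :&: (e |: A)))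
    + (1 - a) * (\sum_X w X * excess n (e |: A) xi (X :&: (e |: A))).
  rewrite -!step !mulr_sumr -!big_split; apply: eq_bigr => X _ /=; ring.
rewrite (eq_cond_exp (h' := fun X => cov e + \sum_(e <- revealed n (e |: A) X) cov e)); last first.
  by move=> X ->; rewrite qE big_cons.
rewrite cond_expD // (cond_exp_split _ eA sA) -/a.
have s1 : e |: xi \subset e |: A by exact: setUS.
have s0 : xi \subset e |: A by exact: subU1.
have i1 := IH _ _ s1; have i0 := IH _ _ s0; have c0 := sum_ccov_le eA.
have j1 := ler_wpM2l a0 i1.
have a1' : 0 <= 1 - a by rewrite subr_ge0.
have j0 := ler_wpM2l a1' i0.
rewrite -/Z in c0; lra.
Qed.

(** Started from an empty exploration, the coupled evolution gives the mean of [f g] and the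
    independent one the product of the means. *)
Theorem osss : mean (fun X => f X * g X) - mean f * mean g <=
  mean (fun X => \sum_(e <- revealed #|E| set0 X) cov e).
Proof.
have s00 : set0 \subset (set0 : {set E}) by exact: subxx.
have := coupled_exp_le #|E| s00 s00.
rewrite coupled_exp_diag ?setC0 ?cardsT // /F /G !cond_exp0 => h1.
have := sum_excess_le #|E| s00; rewrite cond_exp0.
under eq_bigr do rewrite setI0; rewrite -mulr_suml ler_pM2l // => h2.
lra.
Qed.

End OSSS.

(** * Random-cluster representation *)

Section RandomCluster.
Variables (R : realType) (T E : finType) (src dst : E -> T) (lam : R).
Hypothesis lam_gt0 : 0 < lam.
Implicit Types (S U : {set T}) (X Y : {set E}) (s t : {ffun T -> bool}) (x y : T).

Definition compatible S X s :=
  [forall x in S, s x] && [forall e in X, s (src e) == s (dst e)].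

Definition spins S X : {set {ffun T -> bool}} := [set s | compatible S X s].

(** The product of spins in the group {-1, 1}; it preserves compatibility. *)
Definition agreement s t : {ffun T -> bool} := [ffun x => s x == t x].

Lemma spinsP S X s : reflect ((forall x, x \in S -> s x) /\ forall e, e \in X -> s (src e) = s
  (dst e))
  (s \in spins S X).
Proof.
rewrite inE /compatible; apply: (iffP andP) => -[h1 h2].
  by split; [exact/forall_inP | move=> e /(forall_inP h2) /eqP].
by split; apply/forall_inP => // e /h2 ->.
Qed.

Lemma agreement_spins S S' X X' s t : s \in spins S X -> t \in spins S' X' ->
  agreement s t \in spins (S :&: S') (X :&: X').
Proof.
move=> /spinsP[s1 s2] /spinsP[t1 t2]; apply/spinsP; split => [x|e]; rewrite inE => /andP[h h'].
  by rewrite ffunE s1 ?t1.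
by rewrite !ffunE s2 ?t2.
Qed.

Lemma agreementK s t : agreement s (agreement s t) = t.
Proof. by apply/ffunP => x; rewrite !ffunE; case: (s x); case: (t x). Qed.

(* Each fibre of [agreement] on [A * B] injects into the intersection [A :&: B]. *)
Lemma card_spins S S' X Y : S \subset S' ->
  (#|spins S X| * #|spins S' Y| <= #|spins S (X :&: Y)| * #|spins S' (X :|: Y)|)%N.
Proof.
move=> SS; rewrite -cardsX; set P := setX _ _.
rewrite -sum1_card (partition_big (fun p : {ffun T -> bool} * {ffun T -> bool} => agreement p.1 p.2)
   (mem (spins S (X :&: Y)))) /=; last first.
  by move=> [s t]; rewrite in_setX => /andP[/= sX tY]; rewrite -(setIidPl SS) agreement_spins.
rewrite -sum_nat_const; apply: leq_sum => r _.
pose Q := [pred p : {ffun T -> bool} * {ffun T -> bool} | (p \in P) && (agreement p.1 p.2 == r)].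
rewrite sum1_card -/Q.
have [[s0 t0] st0|Q0] := pickP Q; last by rewrite eq_card0.
have /andP[] := st0; rewrite in_setX /= => /andP[s0X t0Y] /eqP r0.
have inj : {in Q &, injective (fun p : {ffun T -> bool} * {ffun T -> bool} => agreement s0 p.1)}.
  move=> [s t] [s' t'] /andP[_ /eqP /= r1] /andP[_ /eqP /= r2] /= ss.
  have es : s = s' by rewrite -(agreementK s0 s) ss agreementK.
  by congr (_, _) => //; rewrite -(agreementK s t) r1 es -r2 agreementK.
rewrite -(card_in_image inj); apply: subset_leq_card; apply/subsetP => u /imageP[[s t]].
move=> /andP[]; rewrite in_setX /= => /andP[sX tY] /eqP r1 ->.
have uX : agreement s0 s \in spins S X by rewrite -[S]setIid -[X]setIid agreement_spins.
have uY : agreement s0 s \in spins S' Y.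
  have -> : agreement s0 s = agreement t0 t.
    apply/ffunP => x; move: r0; rewrite -r1 => /ffunP/(_ x); rewrite !ffunE.
    by case: (s0 x); case: (t0 x); case: (s x); case: (t x).
  by rewrite -[S']setIid -[Y]setIid agreement_spins.
case/spinsP: uX => a1 a2; case/spinsP: uY => b1 b2; apply/spinsP; split => // e.
by rewrite inE => /orP[/a2|/b2].
Qed.

(** The random-cluster weight with two colours, wired on [S]: the number of compatible spin
    configurations is 2 to the number of clusters avoiding [S], so no clusters need to be
    counted. *)
Definition fkw S X : R := lam ^+ #|X| * #|spins S X|%:R.

Lemma spins_gt0 S X : (0 < #|spins S X|)%N.
Proof. by apply/card_gt0P; exists [ffun=> true]; apply/spinsP; split => *; rewrite !ffunE. Qed.

Lemma fkw_gt0 S X : 0 < fkw S X.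
Proof. by rewrite mulr_gt0 ?exprn_gt0 // ltr0n spins_gt0. Qed.

Lemma fkw_holley S S' : S \subset S' -> holley (fkw S) (fkw S').
Proof.
move=> SS X Y; rewrite /fkw mulrACA [leRHS]mulrACA -!exprD -!natrM [(#|X :&: Y| + _)%N]addnC
  cardsUI.
by rewrite ler_pM2l ?exprn_gt0 // ler_nat card_spins.
Qed.

Definition opn X : rel T := fun x y =>
  [exists e in X, ((src e == x) && (dst e == y)) || ((src e == y) && (dst e == x))].

Definition conn X x U := [exists y in U, connect (opn X) x y].

Lemma opn_sym X : symmetric (opn X).
Proof. by move=> x y; apply: eq_existsb => e; rewrite orbC. Qed.

Lemma opn_connect_sym X : connect_sym (opn X).
Proof. by apply: sym_connect_sym; exact: opn_sym. Qed.

Lemma opn_sub X Y : X \subset Y -> subrel (opn X) (opn Y).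
Proof.
move=> XY x y /exists_inP[e eX h]; apply/exists_inP; exists e => //.
exact: (subsetP XY).
Qed.

Lemma connect_opn_sub X Y : X \subset Y -> subrel (connect (opn X)) (connect (opn Y)).
Proof. by move=> XY; apply: connect_sub => x y /(opn_sub XY); exact: connect1. Qed.

Lemma conn_sub X Y x U : X \subset Y -> conn X x U -> conn Y x U.
Proof.
move=> XY /exists_inP[y yU xy]; apply/exists_inP; exists y => //.
exact: connect_opn_sub xy.
Qed.

Lemma spins_connect S X s x y : s \in spins S X -> connect (opn X) x y -> s x = s y.
Proof.
move=> /spinsP[_ sX] /connectP[p]; elim: p x => [|z p IH] x /=; first by move=> _ ->.
move=> /andP[/exists_inP[e eX h] pz] /(IH _ pz) <-.
by case/orP: h => /andP[/eqP <- /eqP <-]; rewrite sX.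
Qed.

(** If [x] is connected to [S], its spin is plus. Otherwise flipping the cluster of [x], which is
    multiplication by [t], preserves compatibility and changes the sign of the sum. *)
Lemma sum_spins_conn S X x :
  \sum_(s in spins S X) spin R (s x) = #|spins S X|%:R * (conn X x S)%:R.
Proof.
have [/exists_inP[y yS xy]|nc] := boolP (conn X x S).
  rewrite mulr1 -sum1_card natr_sum; apply: eq_bigr => s sX.
  have /spinsP[sS _] := sX.
  by rewrite (spins_connect sX xy) sS.
rewrite mulr0; pose t : {ffun T -> bool} := [ffun y => ~~ connect (opn X) x y].
have tX : t \in spins S X.
  apply/spinsP; split => [y yS|e eX].
    by rewrite ffunE; apply: contra nc => xy; apply/exists_inP; exists y.
  rewrite !ffunE; congr (~~ _).
  have de : connect (opn X) (src e) (dst e).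
    by apply/connect1/exists_inP; exists e; rewrite // !eqxx.
  apply/idP/idP => h; apply: (connect_trans h) => //.
  by rewrite opn_connect_sym.
have tK : involutive (agreement t) by exact: agreementK.
set A := \sum_(s in _) _.
have : A = - A.
  rewrite {1}/A (reindex_inj (inv_inj tK)) /= -sumrN; apply: eq_big => [s|s _].
    apply/idP/idP => h; last by rewrite -[S]setIid -[X]setIid agreement_spins.
    by rewrite -(agreementK t s) -[S]setIid -[X]setIid agreement_spins.
  by rewrite !ffunE connect0 /=; case: (s x) => /=; rewrite ?opprK.
lra.
Qed.

Definition edge_weight s : R := \prod_e (1 + lam * (s (src e) == s (dst e))%:R).

(** Edwards-Sokal expansion: once the product over edges is expanded, the term of [X] survives only
    if [s] is constant along every edge of [X]. *)
Lemma sum_edge_weight S (F : {ffun T -> bool} -> R) :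
  \sum_(s : {ffun T -> bool} | [forall x in S, s x]) F s * edge_weight s =
  \sum_(X : {set E}) lam ^+ #|X| * \sum_(s in spins S X) F s.
Proof.
under [RHS]eq_bigr do rewrite mulr_sumr.
rewrite (exchange_big_dep (fun s : {ffun T -> bool} => [forall x in S, s x])) /=; last first.
  by move=> X s _; rewrite [s \in _]inE => /andP[].
apply: eq_bigr => s sS; rewrite /edge_weight.
under eq_bigr do rewrite addrC.
rewrite bigA_distr mulr_sumr [RHS]big_mkcond /=; apply: eq_bigr => X _.
have -> : \prod_e (if e \in X then lam * (s (src e) == s (dst e))%:R else 1) =
    \prod_(e in X) (lam * (s (src e) == s (dst e))%:R) by rewrite -big_mkcond.
rewrite big_split /= prodr_const.
case: ifPn => [/spinsP[_ sX]|sX].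
  rewrite [X in _ * (_ * X)]big1 ?mulr1 1?mulrC // => e eX.
  by rewrite sX ?eqxx.
have [e eX ne] : exists2 e, e \in X & s (src e) != s (dst e).
  move: sX; rewrite inE /compatible sS /= negb_forall_in => /exists_inP[e eX h].
  by exists e.
by rewrite (bigD1 e) //= (negPf ne) mul0r mulr0 mulr0.
Qed.

Lemma fk_magnetization S x :
  mean (fkw S) (fun X => (conn X x S)%:R) =
  (\sum_(s : {ffun T -> bool} | [forall x in S, s x]) spin R (s x) * edge_weight s)
  / \sum_(s : {ffun T -> bool} | [forall x in S, s x]) edge_weight s.
Proof.
rewrite /mean sum_edge_weight; congr (_ / _).
  by apply: eq_bigr => X _; rewrite sum_spins_conn mulrA.
under [RHS]eq_bigr do rewrite -[edge_weight _]mul1r.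
rewrite (sum_edge_weight S (fun=> 1)); apply: eq_bigr => X _.
by rewrite sumr_const.
Qed.

End RandomCluster.

(** * OSSS for the exploration of the clusters of a set *)

Section Exploration.
Variables (R : realType) (T E : finType) (src dst : E -> T) (w : {set E} -> R).
Hypothesis w_gt0 : forall X, 0 < w X.
Hypothesis w_lsm : holley w w.
Implicit Types (A O X : {set E}) (e : E).
Let conn := conn src dst.
Let opn := opn src dst.

Lemma cov_ge0 (g : {set E} -> R) e : increasing g -> 0 <= cov w g e.
Proof.
move=> gm; have im := @increasing_mem R E e.
have := fkg w_gt0 w_lsm im gm.
have Z0 : 0 < \sum_X w X.
  by rewrite (bigD1 set0) //= ltr_pwDl // sumr_ge0 // => X _; exact: ltW.
rewrite /cov /mean subr_ge0 => h.
rewrite mulrACA -invfM -subr_ge0.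
rewrite (_ : _ - _ = ((\sum_X w X * ((e \in X)%:R * g X)) * (\sum_X w X)
   - (\sum_X w X * (e \in X)%:R) * (\sum_X w X * g X)) / ((\sum_X w X) * (\sum_X w X))).
  by rewrite divr_ge0 ?subr_ge0 // mulr_ge0 // ltW.
by field; rewrite gt_eqF.
Qed.

Lemma mean_le (f g : {set E} -> R) : (forall X, f X <= g X) -> mean w f <= mean w g.
Proof.
move=> fg; have Z0 : 0 < \sum_X w X.
  by rewrite (bigD1 set0) //= ltr_pwDl // sumr_ge0 // => X _; exact: ltW.
by rewrite /mean ler_pM2r ?invr_gt0 //; apply: ler_sum => X _; rewrite ler_pM2l.
Qed.

Lemma mean_sum (I : finType) (P : pred I) (f : I -> {set E} -> R) (a : I -> R) :
  mean w (fun X => \sum_(i | P i) f i X * a i) = \sum_(i | P i) mean w (f i) * a i.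
Proof.
rewrite /mean; under eq_bigr do rewrite mulr_sumr.
rewrite exchange_big /= mulr_suml; apply: eq_bigr => i _.
by rewrite [RHS]mulrAC [in RHS]mulr_suml; congr (_ * _); apply: eq_bigr => X _; rewrite mulrA.
Qed.

Variables (F : {set E}) (o : T) (U V : {set T}).
Hypothesis crossing : forall X v, v \in V -> connect (opn (X :&: F)) o v ->
  exists2 u, u \in U & connect (opn (X :&: F)) o u.

Let touches O e := conn (O :&: F) (src e) U || conn (O :&: F) (dst e) U.
Let q A O := [pick e | [&& e \in F, e \notin A & touches O e]].
Let f X : R := (conn (X :&: F) o V)%:R.

Let q_fresh A O e : q A O = Some e -> e \notin A.
Proof. by rewrite /q; case: pickP => // e' /and3P[_ h _] [<-]. Qed.

Let f_incr : increasing f.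
Proof.
move=> X Y XY; rewrite /f ler_nat; have [h|//] := boolP (conn (X :&: F) o V).
by rewrite lt0b; exact: conn_sub (setSI F XY) h.
Qed.

(** When no query remains, every edge of [F] touching an explored cluster of [U] is known. By
    [crossing], a path from [o] to [V] lies in such a cluster. *)
Let f_det A O X : O \subset A -> q A O = None -> X :&: A = O -> f X = f O.
Proof.
move=> OA qN XA; congr (_%:R); congr (nat_of_bool _).
have OX : O \subset X by rewrite -XA subsetIl.
apply/idP/idP; last by apply: conn_sub; exact: setSI.
move=> /exists_inP[v vV ov]; apply/exists_inP; exists v => //.
have [u uU ou] := crossing vV ov.
have stay x : connect (opn (X :&: F)) u x -> connect (opn (O :&: F)) u x.
  move=> /connectP[p]; elim/last_ind: p x => [|p z IH] x /=; first by move=> _ ->; exact: connect0.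
  rewrite rcons_path last_rcons => /andP[pp yz] ->.
  have uy := IH _ pp erefl; apply: (connect_trans uy); apply: connect1.
  case/exists_inP: yz => e; rewrite inE => /andP[eX eF] he.
  apply/exists_inP; exists e => //; rewrite inE eF andbT -XA inE eX /=.
  have yU : conn (O :&: F) (last u p) U.
    by apply/exists_inP; exists u => //; rewrite opn_connect_sym.
  move: qN; rewrite /q; case: pickP => // /(_ e); rewrite eF /= => /negbT.
  rewrite negb_and negbK => /orP[//|/negP[]]; rewrite /touches.
  by case/orP: he => /andP[/eqP h1 /eqP h2]; rewrite ?h1 ?h2 yU ?orbT.
have uo : connect (opn (X :&: F)) u o by rewrite opn_connect_sym.
have h1 := stay _ uo; have h2 := stay _ (connect_trans uo ov).
by apply: connect_trans h2; rewrite opn_connect_sym.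
Qed.

Let revealed := revealed q.

Let revealedP n A X e : e \in revealed n A X ->
  [/\ e \notin A, e \in F & conn X (src e) U || conn X (dst e) U].
Proof.
elim: n A => // n IH A; rewrite /revealed /=.
case qE: (q A (X :&: A)) => [e'|//]; rewrite inE => /orP[/eqP ->|/IH[]]; last first.
  by rewrite !inE negb_or => /andP[_ ->].
move: qE; rewrite /q; case: pickP => // e'' /and3P[eF eA te] [<-]; split => //.
have sX : X :&: A :&: F \subset X by rewrite -setIA subsetIl.
by case/orP: te => /(conn_sub sX); rewrite /conn => ->; rewrite ?orbT.
Qed.

Let revealed_uniq n A X : uniq (revealed n A X).
Proof.
elim: n A => // n IH A; rewrite /revealed /=.
case qE: (q A (X :&: A)) => [e'|//] /=; rewrite -/(revealed _ _ _) IH andbT.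
by apply/negP => /revealedP[]; rewrite !inE eqxx.
Qed.

(** The left-hand side is the variance of the indicator [f]. An edge is queried only if one of its
    ends is connected to [U], which bounds the probability of the query. *)
Lemma exploration_bound :
  mean w f * (1 - mean w f) <=
  \sum_(e in F) (mean w (fun X => (conn X (src e) U)%:R)
                 + mean w (fun X => (conn X (dst e) U)%:R)) * cov w f e.
Proof.
have f01 X : 0 <= f X <= 1 by rewrite ler0n lern1 leq_b1.
have := osss w_gt0 w_lsm q_fresh f01 f_det f_incr.
rewrite (_ : mean w (fun X => f X * f X) = mean w f); last first.
  by congr (_ / _); apply: eq_bigr => X _; congr (_ * _); rewrite /f; case: conn;
    rewrite ?mulr1 ?mulr0.
move=> h; rewrite mulrBr mulr1; apply: (le_trans h).
have addm h1 h2 : mean w h1 + mean w h2 = mean w (fun X => h1 X + h2 X).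
  by rewrite /mean -mulrDl -big_split; congr (_ / _); apply: eq_bigr => X _ /=; rewrite mulrDr.
under [leRHS]eq_bigr do rewrite addm.
rewrite -mean_sum; apply: mean_le => X.
rewrite -/(revealed _ _ _) big_uniq ?revealed_uniq //=.
rewrite [leRHS]big_mkcond [leLHS]big_mkcond /=; apply: ler_sum => e _.
have c0 := cov_ge0 e f_incr.
case: ifPn => [/revealedP[_ eF te]|_]; last first.
  by case: ifP => // _; rewrite mulr_ge0 // addr_ge0.
rewrite eF ler_peMl //; case/orP: te => ->; rewrite ?lerDl ?lerDr ?ler0n //.
Qed.

End Exploration.

(** * A differential inequality forcing exponential decay *)

Section Growth.
Local Open Scope classical_set_scope.
Local Open Scope ring_scope.
Variable R : realType.
Implicit Types (f df : R -> R) (a b c m x y : R).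

Lemma derive_lower_bound f df a b m : (forall x, is_derive x (1 : R) f (df x)) ->
  a <= b -> (forall x, a <= x -> x <= b -> m <= df x) -> f a + m * (b - a) <= f b.
Proof.
move=> fd; rewrite le_eqVlt => /orP[/eqP <- _|ab mdf]; first by rewrite subrr mulr0 addr0.
have cf : {within `[a, b]%classic, continuous f}.
  by apply: derivable_within_continuous => x _; exact: ex_derive.
have [z zab fE] := MVT ab (fun x _ => fd x) cf.
move: zab; rewrite in_itv /= => /andP[/ltW az /ltW zb].
have := mdf _ az zb; rewrite -(ler_pM2r (_ : 0 < b - a)) ?subr_gt0 // -fE.
lra.
Qed.

Lemma exp_growth f df a b c : (forall x, is_derive x (1 : R) f (df x)) ->
  a <= b -> (forall x, a <= x -> x <= b -> c * f x <= df x) ->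
  f a <= f b * expR (- (c * (b - a))).
Proof.
move=> fd ab h.
pose g x := f x * expR (- c * x).
pose dg x := (df x - c * f x) * expR (- c * x).
have gd x : is_derive x (1 : R) g (dg x).
  have E : is_derive x (1 : R) (fun x => expR (- c * x)) (- c * expR (- c * x)).
    have L : is_derive x (1 : R) (fun x => - c * x) (- c).
      by apply: is_derive_eq; rewrite /GRing.scale /= mulr1.
    have := @is_derive1_comp R expR (fun x => - c * x) x _ _ (is_derive_expR _) L.
    by move=> D; apply: is_derive_eq D _; rewrite mulrC.
  apply: is_derive_eq; rewrite /GRing.scale /= /dg; ring.
have gab : g a <= g b.
  have := derive_lower_bound gd ab (m := 0); rewrite mul0r addr0; apply=> x ax xb.
  by rewrite mulr_ge0 ?expR_ge0 // subr_ge0 h.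
rewrite /g in gab.
have := ler_wpM2r (expR_ge0 (c * a)) gab.
rewrite -!mulrA -!expRD mulNr addNr expR0 mulr1.
by rewrite (_ : - c * b + c * a = - (c * (b - a))) //; ring.
Qed.

Lemma ln_sub_le x y : 0 < x -> 0 < y -> ln y - ln x <= (y - x) / x.
Proof.
move=> x0 y0; rewrite -ln_div ?posrE //.
have -> : y / x = 1 + (y - x) / x by field; rewrite gt_eqF.
apply: le_ln1Dx; rewrite mulrBl divff ?gt_eqF //.
by have : 0 < y / x by [rewrite divr_gt0]; lra.
Qed.

Lemma sum_ltn_le (m n : nat) : (\sum_(1 <= i < n) (i < m) <= m)%N.
Proof.
apply: (@leq_trans (minn n m)); last exact: geq_minr.
elim: n => [|[|n] IH]; [by rewrite big_geq | by rewrite big_geq |].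
rewrite big_nat_recr //=; apply: (leq_trans (leq_add IH (leqnn _))).
by rewrite /minn; case: (ltnP n.+1 m); case: (ltnP n.+2 m); lia.
Qed.

Lemma harmonic_le n : (0 < n)%N -> \sum_(1 <= i < n) (i%:R : R)^-1 <= 2 * ln (n%:R : R).
Proof.
elim: n => // -[|n] IH _; first by rewrite big_nil ln1 mulr0.
rewrite big_nat_recr //=.
have := @ln_sub_le n.+2%:R n.+1%:R (ltr0Sn _ _) (ltr0Sn _ _).
have n1 : 0 < n.+1%:R :> R by exact: ltr0Sn.
have : n.+1%:R^-1 <= 2 * (n.+2%:R^-1 : R).
  rewrite -(natr1 n.+1).
  rewrite -[leLHS]mul1r ler_pdivrMr // mulrAC ler_pdivlMr ?mul1r ?addr_gt0 //.
  by have : 1 <= n.+1%:R :> R by [rewrite ler1n]; lra.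
have -> : (n.+1%:R - n.+2%:R) / n.+2%:R = - (n.+2%:R^-1) :> R.
  have E : n.+1%:R - n.+2%:R = -1 :> R by rewrite -(natr1 n.+1); ring.
  by rewrite E mulN1r.
have := IH isT.
set a := \sum_(_ <= _ < _) _; set l1 := ln _; set l2 := ln _; move: n.+1%:R^-1 n.+2%:R^-1 => u v.
lra.
Qed.

Lemma inv_sqr_sum_le n : \sum_(1 <= i < n) ((i%:R : R) ^+ 2)^-1 <= 2.
Proof.
suff : \sum_(1 <= i < n.+1) ((i%:R : R) ^+ 2)^-1 <= 2 - 2 * n.+1%:R^-1.
  case: n => [|n]; first by rewrite big_geq.
  rewrite big_nat_recr //=.
  have : 0 <= (n.+1%:R ^+ 2)^-1 :> R by rewrite invr_ge0 sqr_ge0.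
  have : 0 <= n.+2%:R^-1 :> R by rewrite invr_ge0.
  set a := \sum_(_ <= _ < _) _; set u := (n.+1%:R ^+ 2)^-1; set v := n.+2%:R^-1.
  lra.
elim: n => [|n IH]; first by rewrite big_nil invr1 mulr1 subrr.
rewrite big_nat_recr //=; apply: (le_trans (lerD IH (lexx _))).
have n1 : 0 < n.+1%:R :> R by exact: ltr0Sn.
have n2 : 0 < n.+2%:R :> R by exact: ltr0Sn.
rewrite -subr_ge0.
rewrite (_ : _ - _ = (2 * n.+1%:R ^+ 2 / (n.+1%:R * n.+2%:R) - 1) / n.+1%:R ^+ 2); last first.
  by rewrite -(natr1 n.+1) in n2 *; field; rewrite !gt_eqF.
rewrite divr_ge0 ?sqr_ge0 // subr_ge0 ler_pdivlMr ?mulr_gt0 // mul1r -(natr1 n.+1).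
have : 1 <= n.+1%:R :> R by rewrite ler1n.
move: n.+1%:R n1 => t t0 t1.
have tt : t <= t * t by rewrite ler_peMr // ltW.
by rewrite expr2 mulrDr mulr1; lra.
Qed.

Lemma expR_ge_pow4 x : 0 <= x -> (x / 4) ^+ 4 <= expR x.
Proof.
move=> x0; have -> : expR x = expR (x / 4) ^+ 4.
  by rewrite -expRM_natl; congr expR; field.
rewrite lerXn2r ?nnegrE ?expR_ge0 ?divr_ge0 //.
by have := expR_ge1Dx (x / 4); lra.
Qed.

Section SharpThreshold.
Variables (theta dtheta : nat -> R -> R) (n0 : nat) (K s0 s1 : R).
Let S n x := \sum_(0 <= i < n) theta i x.
Hypothesis theta_derive : forall n x, is_derive x (1 : R) (theta n) (dtheta n x).
Hypothesis theta0 : forall x, theta 0 x = 1.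
Hypothesis theta_ge0 : forall n x, 0 <= theta n x.
Hypothesis theta_le1 : forall n x, theta n x <= 1.
Hypothesis dtheta_ge0 : forall n x, 0 <= dtheta n x.
Hypothesis n0_gt0 : (0 < n0)%N.
Hypothesis K_gt0 : 0 < K.
Hypothesis diff_ineq : forall n x, (n0 <= n)%N -> s0 <= x -> x <= s1 ->
  n%:R * theta n x <= K * S n x * dtheta n x.
Hypothesis s01 : s0 < s1.
Hypothesis theta_cvg : forall eps : R, 0 < eps -> exists N, forall n, (N <= n)%N -> theta n s1
  <= eps.

Let theta_mono n x y : x <= y -> theta n x <= theta n y.
Proof.
move=> xy; have := derive_lower_bound (theta_derive n) xy (m := 0).
by rewrite mul0r addr0; apply=> z _ _.
Qed.

Let S_mono n x y : x <= y -> S n x <= S n y.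
Proof. by move=> xy; apply: ler_sum => i _; exact: theta_mono. Qed.

Let S_ge1 n x : (0 < n)%N -> 1 <= S n x.
Proof.
case: n => // n _; rewrite /S big_nat_recl // theta0 lerDl.
by apply: sumr_ge0 => i _.
Qed.

Let S_le n x : S n x <= n%:R.
Proof.
apply: (le_trans (ler_sum _ (fun i _ => theta_le1 i x))).
by rewrite big_const_nat subn0 iter_addr_0.
Qed.

(** Since [theta i] is the increment of [S] at [i], the sum dominates the telescoping sum of the
    increments of [ln S]. *)
Let log_sum n x : (n0 <= n)%N -> ln (S n x) - ln (n0%:R) <= \sum_(n0 <= i < n) theta i x / S i x.
Proof.
elim: n => [|n IH]; first by rewrite leqn0 => /eqP n00; move: n0_gt0; rewrite n00.
rewrite leq_eqVlt => /orP[/eqP <-|]; last rewrite ltnS => nn.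
  rewrite big_geq // subr_le0 ler_ln ?posrE ?ltr0n //.
  exact: (lt_le_trans ltr01 (S_ge1 _ _)).
rewrite big_nat_recr //=; have n00 := leq_trans n0_gt0 nn.
have p1 : 0 < S n x by exact: (lt_le_trans ltr01 (S_ge1 _ _)).
have p2 : 0 < S n.+1 x by exact: (lt_le_trans ltr01 (S_ge1 _ _)).
have E : S n.+1 x - S n x = theta n x by rewrite /S big_nat_recr //=; ring.
have := ln_sub_le p1 p2; have := IH nn; rewrite E.
by set a := \sum_(_ <= _ < _) _; set b := ln _; set u := ln _; set v := ln _; lra.
Qed.

Let diff_ratio n x : (n0 <= n)%N -> s0 <= x -> x <= s1 ->
  K^-1 * (theta n x / S n x) <= dtheta n x / n%:R.
Proof.
move=> nn x0 x1; have n00 := leq_trans n0_gt0 nn.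
have p1 : 0 < S n x by exact: (lt_le_trans ltr01 (S_ge1 _ _)).
have p2 : 0 < n%:R :> R by rewrite ltr0n.
rewrite ler_pdivlMr // [leLHS](_ : _ = n%:R * theta n x / (K * S n x)); last first.
  by field; rewrite !gt_eqF.
by rewrite ler_pdivrMr ?mulr_gt0 // [leRHS]mulrC diff_ineq.
Qed.

Let theta_avg n x : is_derive x (1 : R) (fun y => \sum_(n0 <= i < n) theta i y / i%:R)
   (\sum_(n0 <= i < n) dtheta i x / i%:R).
Proof.
elim: n => [|n IH].
  by rewrite big_geq //; under eq_fun do rewrite big_geq //; exact: is_derive_cst.
have [nn|nn] := leqP n0 n; last first.
  by rewrite big_geq //; under eq_fun do rewrite big_geq //; exact: is_derive_cst.
rewrite big_nat_recr //=; under eq_fun do rewrite big_nat_recr //=.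
have D : is_derive x (1 : R) (fun y => theta n y / n%:R) (dtheta n x / n%:R).
  have D := theta_derive n x; apply: is_derive_eq.
  by rewrite /GRing.scale /= mulr0 add0r mulrC.
exact: is_deriveD.
Qed.

Let S_gt0 n x : (0 < n)%N -> 0 < S n x.
Proof. by move=> /S_ge1 h; exact: (lt_le_trans ltr01 (h x)). Qed.

(** If [S n] exceeded the square root of [n] at [c], it would do so on all of [c, s1], and [log_sum]
    would force the sum of [theta i / i] to grow there by about [(del / 2) ln n]. At [s1] this sum
    is at most a small multiple of [ln n] plus a constant, because [theta] tends to 0. *)
Let sqrt_bound c : s0 <= c -> c < s1 ->
  exists N, forall n, (N <= n)%N -> (S n c) ^+ 2 <= n%:R.
Proof.
move=> c0 c1; set del := (s1 - c) / K.
have d0 : 0 < del by rewrite divr_gt0 // subr_gt0.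
have [N1 N1P] := theta_cvg (divr_gt0 d0 (ltr0Sn R 7)).
(* The bound [del / 8] on [theta] and the factor 2 of [harmonic_le] use up [del / 4] of the gain
   [del / 2]; [B] is the value of [ln n] from which the rest gives a contradiction. *)
pose B := 4 / del * (N1%:R + del * ln n0%:R).
have [N2 N2P] : exists N2, forall n, (N2 <= n)%N -> expR B < n%:R.
  exists (Num.truncn (expR B)).+1 => n nn.
  by apply: (lt_le_trans (truncnS_gt _)); rewrite ler_nat.
exists (maxn n0 N2) => n; rewrite geq_max => /andP[nn0 nn2].
have n00 := leq_trans n0_gt0 nn0.
have np : 0 < n%:R :> R by rewrite ltr0n.
rewrite leNgt; apply/negP => large.
have lnB : B < ln n%:R by rewrite -[B]expRK ltr_ln ?posrE ?expR_gt0 // N2P.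
have lnS x : c <= x -> ln n%:R <= 2 * ln (S n x).
  move=> cx; have p := S_gt0 x n00; have pc := S_gt0 c n00.
  rewrite mulr_natl -lnXn // ler_ln ?posrE ?exprn_gt0 //.
  apply: (le_trans (ltW large)).
  by rewrite ler_sqr ?nnegrE ?(ltW p) ?(ltW pc) // S_mono.
have low x : c <= x -> x <= s1 ->
    K^-1 * (2^-1 * ln n%:R - ln n0%:R) <= \sum_(n0 <= i < n) dtheta i x / i%:R.
  move=> cx x1; apply: (@le_trans _ _ (\sum_(n0 <= i < n) K^-1 * (theta i x / S i x))).
    rewrite -mulr_sumr ler_pM2l ?invr_gt0 //; apply: le_trans (log_sum x nn0).
    by have := lnS x cx; lra.
  rewrite big_nat_cond [leRHS]big_nat_cond; apply: ler_sum => i /andP[/andP[ni _] _].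
  by apply: diff_ratio => //; exact: le_trans cx.
have := derive_lower_bound (theta_avg n) (ltW c1) low.
rewrite [X in _ + X](_ : _ = del * (2^-1 * ln n%:R - ln n0%:R)); last by rewrite /del; ring.
have a0 : 0 <= \sum_(n0 <= i < n) theta i c / i%:R.
  by apply: sumr_ge0 => i _; rewrite divr_ge0.
have ub : \sum_(n0 <= i < n) theta i s1 / i%:R <= N1%:R + del / 8 * (2 * ln n%:R).
  apply: (@le_trans _ _ (\sum_(1 <= i < n) ((i < N1)%N%:R + del / 8 * i%:R^-1))).
    rewrite [leRHS](big_cat_nat _ nn0) //=.
    apply: (@le_trans _ _ (\sum_(n0 <= i < n) ((i < N1)%N%:R + del / 8 * i%:R^-1))); last first.
      rewrite lerDr; apply: sumr_ge0 => i _.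
      by rewrite addr_ge0 // mulr_ge0 ?invr_ge0 // divr_ge0 // ltW.
    rewrite big_nat_cond [leRHS]big_nat_cond; apply: ler_sum => i /andP[/andP[ni _] _].
    have ip : 1 <= i%:R :> R by rewrite ler1n (leq_trans n0_gt0).
    have ii : 0 <= i%:R^-1 :> R by rewrite invr_ge0.
    case: ltnP => [iN|iN].
      have d8 : 0 <= del / 8 / i%:R by rewrite mulr_ge0 // ltW // divr_gt0.
      apply: (@le_trans _ _ 1); last by rewrite lerDl.
      by rewrite ler_pdivrMr ?(lt_le_trans ltr01) // mul1r (le_trans (theta_le1 _ _)).
    by rewrite add0r ler_wpM2r // N1P.
  rewrite big_split /= -mulr_sumr; apply: lerD; last first.
    by apply: ler_wpM2l; [apply: divr_ge0; rewrite ?(ltW d0) | exact: harmonic_le].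
  by rewrite -natr_sum ler_nat sum_ltn_le.
move=> key.
have : ln n%:R <= B.
  rewrite /B mulrAC ler_pdivlMr //.
  move: key ub a0; set u := \sum_(_ <= _ < _) _; set v := \sum_(_ <= _ < _) _.
  set l := ln n%:R; set l0 := ln n0%:R; rewrite mulrBr; lra.
by rewrite leNgt lnB.
Qed.

(** Between [b] and [c] the sum [S i] is at most the square root of [i], so the differential
    inequality bounds [theta i] at [b] by [exp (- a sqrt i)], which is compared with [A / i^2]. *)
Let sum_bounded b : s0 <= b -> b < s1 -> exists2 M : R, 0 < M & forall n, S n b <= M.
Proof.
move=> b0 b1; pose c := (b + s1) / 2.
have bc : b < c by rewrite /c; lra.
have c1 : c < s1 by rewrite /c; lra.
have [N NP] := sqrt_bound (le_trans b0 (ltW bc)) c1.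
pose N' := maxn N n0; pose a := (c - b) / K.
have a0 : 0 < a by rewrite divr_gt0 // subr_gt0.
pose A := 256 / a ^+ 4; have A0 : 0 < A by rewrite divr_gt0 // exprn_gt0.
exists (1 + (N'%:R + A * 2)); first by rewrite ltr_pwDl // addr_ge0 // mulr_ge0 // ltW.
case=> [|n]; first by rewrite /S big_geq // addr_ge0 // addr_ge0 // mulr_ge0 // ltW.
rewrite /S big_ltn // theta0 lerD2l.
apply: (@le_trans _ _ (\sum_(1 <= i < n.+1) ((i < N')%N%:R + A * (i%:R ^+ 2)^-1))); last first.
  rewrite big_split /= -mulr_sumr; apply: lerD; first by rewrite -natr_sum ler_nat sum_ltn_le.
  by apply: ler_wpM2l; [exact: ltW | exact: inv_sqr_sum_le].
rewrite big_nat_cond [leRHS]big_nat_cond; apply: ler_sum => i /andP[/andP[i1 _] _].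
have Ai : 0 <= A * (i%:R ^+ 2)^-1 by rewrite mulr_ge0 ?invr_ge0 ?sqr_ge0 // ltW.
have ip : 0 < i%:R :> R by rewrite ltr0n.
case: ltnP => [iN|]; first by apply: (le_trans (theta_le1 _ _)); rewrite lerDl.
rewrite geq_max add0r => /andP[iN in0].
pose r := Num.sqrt (i%:R : R); have r0 : 0 < r by rewrite sqrtr_gt0.
have r2 : r ^+ 2 = i%:R by rewrite sqr_sqrtr // ltW.
have Sr x : x <= c -> S i x <= r.
  move=> xc; apply: (le_trans (S_mono i xc)).
  rewrite -ler_sqr ?nnegrE ?(ltW r0) ?(ltW (S_gt0 _ i1)) // r2.
  exact: NP.
have grow x : b <= x -> x <= c -> r / K * theta i x <= dtheta i x.
  move=> bx xc; have := diff_ineq in0 (le_trans b0 bx) (le_trans xc (ltW c1)).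
  rewrite -r2 => h; have h2 : r ^+ 2 * theta i x <= K * r * dtheta i x.
    by apply: (le_trans h); rewrite ler_wpM2r // ler_wpM2l ?Sr // ltW.
  by rewrite mulrAC ler_pdivrMr // -(ler_pM2l r0) mulrA -expr2
    [leRHS](_ : _ = K * r * dtheta i x) //; ring.
have := exp_growth (theta_derive i) (ltW bc) grow.
have -> : r / K * (c - b) = r * a by rewrite /a; ring.
move=> h; apply: (le_trans h); apply: (@le_trans _ _ (expR (- (r * a)))).
  by rewrite ler_piMl ?expR_ge0.
rewrite expRN; have ra : 0 < r * a by rewrite mulr_gt0.
have -> : A * (i%:R ^+ 2)^-1 = ((r * a / 4) ^+ 4)^-1.
  by rewrite -r2 /A; field; rewrite !gt_eqF.
by rewrite lef_pV2 ?posrE ?expR_gt0 ?exprn_gt0 ?divr_gt0 // expR_ge_pow4 // ltW.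
Qed.

(** With [S] bounded by [M] up to [b], the logarithmic derivative of [theta n] is at least
    [n / (K M)] on [s0, b]. The prefactor takes care of [n < n0]. *)
Lemma sharp_threshold_decay :
  exists2 Cc : R * R, 0 < Cc.1 /\ 0 < Cc.2 & forall n, theta n s0 <= Cc.1 * expR (- (Cc.2 * n%:R)).
Proof.
pose b := (s0 + s1) / 2.
have b0 : s0 < b by rewrite /b; move: s01; lra.
have b1 : b < s1 by rewrite /b; move: s01; lra.
have [M M0 SM] := sum_bounded (ltW b0) b1.
pose c := (b - s0) / (K * M).
have c0 : 0 < c by rewrite divr_gt0 ?mulr_gt0 // subr_gt0.
exists (expR (c * n0%:R), c) => [|n] /=; first by rewrite expR_gt0.
rewrite -expRD -mulrBr; have [nn|nn] := ltnP n n0.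
  apply: (le_trans (theta_le1 _ _)); rewrite -[leLHS]expR0 ler_expR mulr_ge0 ?(ltW c0) //.
  by rewrite subr_ge0 ler_nat ltnW.
apply: (@le_trans _ _ (expR (- (c * n%:R)))); last first.
  by rewrite ler_expR mulrBr lerDr mulr_ge0 // ltW.
have grow x : s0 <= x -> x <= b -> n%:R / (K * M) * theta n x <= dtheta n x.
  move=> x0 xb; rewrite mulrAC ler_pdivrMr ?mulr_gt0 // mulrC [leRHS]mulrC mulrC.
  apply: (le_trans (diff_ineq nn x0 (le_trans xb (ltW b1)))).
  rewrite ler_wpM2r // ler_wpM2l ?(ltW K_gt0) //; exact: le_trans (S_mono _ xb) (SM n).
have := exp_growth (theta_derive n) (ltW b0) grow.
have -> : n%:R / (K * M) * (b - s0) = c * n%:R by rewrite /c; ring.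
by move=> h; apply: (le_trans h); rewrite ler_piMl ?expR_ge0.
Qed.

End SharpThreshold.

End Growth.

(** * Influence of the boundary condition *)

Lemma sum_config_set (R : realType) (T : finType) (F : {ffun T -> bool} -> R) :
  \sum_s F s = \sum_(X : {set T}) F [ffun x => x \in X].
Proof.
rewrite (reindex (fun X : {set T} => [ffun x => x \in X])) //.
exists (fun s : {ffun T -> bool} => [set x | s x]) => [X _|s _].
  by apply/setP => x; rewrite inE ffunE.
by apply/ffunP => x; rewrite ffunE inE.
Qed.

Section SetIsing.
Variables (R : realType) (T : finType) (c : T -> T -> R).
Hypothesis c_ge0 : forall u v, 0 <= c u v.
Implicit Types (k l : T -> R) (A B D O X Y : {set T}) (x y : T).

Definition set_weight k X : R := ising_weight c k [ffun x => x \in X].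

Lemma set_weight_gt0 k X : 0 < set_weight k X.
Proof. exact: ising_weight_gt0. Qed.

Lemma set_weight_holley k l : (forall u, k u <= l u) -> holley (set_weight k) (set_weight l).
Proof.
move=> kl X Y; rewrite /set_weight /ising_weight -!expRD ler_expR /ising_energy.
rewrite addrACA [leRHS]addrACA -!mulrDr -!big_split /=; apply: lerD.
  rewrite ler_pM2l ?invr_gt0 //; apply: ler_sum => u _; rewrite -!big_split /=.
  apply: ler_sum => v _; rewrite -!mulrDr ler_wpM2l // !ffunE !inE.
  by case: (u \in X); case: (u \in Y); case: (v \in X); case: (v \in Y) => /=; lra.
apply: ler_sum => u _; rewrite !ffunE !inE; have := kl u.
by case: (u \in X); case: (u \in Y) => /=; lra.
Qed.

(* Swapping the restrictions to [D] of two independent configurations that agree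
   on [B] preserves the product of their weights. *)
Lemma cond_exp_markov k l B D O (f : {set T} -> R) : O \subset B ->
  (forall u, u \in D -> k u = l u) ->
  (forall u v, u \in D -> v \notin D -> v \notin B -> c u v = 0) ->
  (forall u v, c u v = c v u) ->
  (forall X Y, X :&: D = Y :&: D -> f X = f Y) ->
  cond_exp (set_weight k) B O f = cond_exp (set_weight l) B O f.
Proof.
move=> OB kl cD c_sym fD; rewrite /cond_exp.
have Z m : slice_sum (set_weight m) B O (fun=> 1) != 0.
  by rewrite gt_eqF // slice_sum1_gt0 // => X; exact: set_weight_gt0.
apply/eqP; rewrite eqr_div //.
rewrite /slice_sum !big_distrlr /= !pair_big /=.
pose sw (p : {set T} * {set T}) := ((p.2 :\: D) :|: (p.1 :&: D), (p.1 :\: D) :|: (p.2 :&: D)).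
have swK : involutive sw.
  move=> [X Y]; congr (_, _); apply/setP => x; rewrite !inE /=;
  by case: (x \in D); case: (x \in X); case: (x \in Y).
rewrite (reindex_inj (inv_inj swK)) /=; apply/eqP/eq_big => [[X Y]|[X Y]] /=.
  apply/andP/andP => -[/eqP XO /eqP YO]; split; apply/eqP/setP => x;
  move/setP/(_ x): XO; move/setP/(_ x): YO; rewrite !inE;
  by case: (x \in D); case: (x \in X); case: (x \in Y); case: (x \in B); case: (x \in O).
move=> /andP[/eqP XO' /eqP YO'].
have XY x : x \in B -> (x \in X) = (x \in Y).
  move=> xB; move: XO' YO' => /setP/(_ x) + /setP/(_ x); rewrite !inE xB !andbT.
  by case: (x \in D); case: (x \in X); case: (x \in Y); case: (x \in O).
rewrite !mulr1 mulrAC [RHS]mulrAC; congr (_ * _); last first.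
  by apply: fD; apply/setP => x; rewrite !inE; case: (x \in D); rewrite ?andbT ?andbF ?orbF.
rewrite /set_weight /ising_weight -!expRD; congr expR; rewrite /ising_energy.
rewrite addrACA [RHS]addrACA -!mulrDr -!big_split /=; congr (_ * _ + _).
  apply: eq_bigr => u _; rewrite -!big_split /=.
  apply: eq_bigr => v _; rewrite -!mulrDr !ffunE !inE.
  have [uD|uD] := boolP (u \in D); have [vD|vD] := boolP (v \in D);
    rewrite /= ?andbT ?andbF ?orbF ?orFb; try (congr (_ * _); ring).
  - have [vB|vB] := boolP (v \in B); last by rewrite cD // !mul0r.
    by rewrite (XY v vB); congr (_ * _); ring.
  - have [uB|uB] := boolP (u \in B); last by rewrite c_sym cD // !mul0r.
    by rewrite (XY u uB); congr (_ * _); ring.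
apply: eq_bigr => u _; rewrite !ffunE !inE.
have [uD|uD] := boolP (u \in D); rewrite /= ?andbT ?andbF ?orbF ?orFb; last exact: addrC.
by rewrite (kl u uD).
Qed.

Let prob k A O x := cond_exp (set_weight k) A O (fun X => (x \in X)%:R).

Let prob_mono k l A O O' x : (forall u, k u <= l u) -> O \subset O' -> O' \subset A ->
  prob k A O x <= prob l A O' x.
Proof.
move=> kl OO OA; apply: cond_exp_mono => //; try exact: set_weight_gt0.
- exact: set_weight_holley.
- exact: set_weight_holley.
- exact: increasing_mem.
Qed.

Let prob_split k A O x y : y \notin A -> O \subset A ->
  prob k A O x = prob k A O y * prob k (y |: A) (y |: O) x
    + (1 - prob k A O y) * prob k (y |: A) O x.
Proof.
move=> yA OA; rewrite {1}/prob (cond_exp_split _ _ yA OA) ?cond_probE //.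
exact: set_weight_gt0.
Qed.

Let prob_itv k A O x : O \subset A -> 0 <= prob k A O x <= 1.
Proof.
move=> OA; have Z : 0 < slice_sum (set_weight k) A O (fun=> 1).
  by apply: slice_sum1_gt0 => // X; exact: set_weight_gt0.
rewrite /prob /cond_exp; apply/andP; split.
  apply: divr_ge0; last exact: ltW.
  by apply: sumr_ge0 => X _; rewrite mulr_ge0 // ltW // set_weight_gt0.
rewrite ler_pdivrMr // mul1r; apply: ler_sum => X _.
by rewrite ler_pM2l ?set_weight_gt0 // lern1 leq_b1.
Qed.

Variables (km kp : T -> R) (f : {set T} -> R).
Hypothesis f01 : forall X, 0 <= f X <= 1.

Let ex k A O := cond_exp (set_weight k) A O f.

Let ex_itv k A O : O \subset A -> 0 <= ex k A O <= 1.
Proof.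
move=> OA; have Z : 0 < slice_sum (set_weight k) A O (fun=> 1).
  by apply: slice_sum1_gt0 => // X; exact: set_weight_gt0.
rewrite /ex /cond_exp; apply/andP; split.
  apply: divr_ge0; last exact: ltW.
  apply: sumr_ge0 => X _; rewrite mulr_ge0 ?(ltW (set_weight_gt0 _ _)) //.
  by case/andP: (f01 X).
rewrite ler_pdivrMr // mul1r; apply: ler_sum => X _.
by rewrite ler_pM2l ?set_weight_gt0 //; case/andP: (f01 X).
Qed.

(** Reveals [y] in both models with a common uniform variable. The outcomes differ with probability
    [a - a'], which is at most the difference of the extreme models at [y], and then the error is at
    most 1. Otherwise the induction continues from a common state. *)
Lemma ex_diff_le (r : seq T) k l A O : uniq r -> (forall x, x \in r -> x \notin A) ->
  O \subset A ->
  (forall u, km u <= k u) -> (forall u, k u <= kp u) ->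
  (forall u, km u <= l u) -> (forall u, l u <= kp u) ->
  (forall O', O' \subset A :|: [set x in r] -> ex k (A :|: [set x in r]) O' = ex l (A :|: [set
    x in r]) O') ->
  `|ex k A O - ex l A O| <= \sum_(x <- r) (prob kp A O x - prob km A O x).
Proof.
elim: r A O k l => [|y r IH] A O k l.
  move=> _ _ OA _ _ _ _; rewrite big_nil set_nil setU0 => /(_ O OA) ->.
  by rewrite subrr normr0.
move=> /= /andP[yr ur] rA OA mk kp' ml lp base.
have yA : y \notin A by apply: rA; rewrite mem_head.
wlog: k l mk kp' ml lp base / prob l A O y <= prob k A O y.
  move=> W; have [/W|/ltW/W] := leP (prob l A O y) (prob k A O y); first exact.
  by rewrite distrC; apply => // O' /base ->.
move=> lk.
have OA1 : O \subset y |: A by apply: subset_trans OA (subsetUr _ _).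
have OA2 : y |: O \subset y |: A by exact: setUS.
have rA' x : x \in r -> x \notin y |: A.
  move=> xr; rewrite !inE negb_or; apply/andP; split; last by apply: rA; rewrite inE xr orbT.
  by apply: contraNneq yr => <-.
have AE : A :|: [set x in y :: r] = (y |: A) :|: [set x in r].
  by apply/setP => x; rewrite !inE orbCA orbA.
rewrite AE in base.
have IH1 := IH _ _ k l ur rA' OA2 mk kp' ml lp base.
have IH0 := IH _ _ k l ur rA' OA1 mk kp' ml lp base.
have exE m : ex m A O = prob m A O y * ex m (y |: A) (y |: O) + (1 - prob m A O y) * ex m (y |:
  A) O.
  rewrite /ex (cond_exp_split _ _ yA OA) ?cond_probE //; exact: set_weight_gt0.
rewrite (exE k) (exE l).
have := ex_itv k OA1; have := ex_itv k OA2; have := ex_itv l OA1; have := ex_itv l OA2.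
move: IH1 IH0; set a := prob k A O y; set a' := prob l A O y.
set F1 := ex k _ (y |: O); set F0 := ex k _ O; set G1 := ex l _ (y |: O); set G0 := ex l _ O.
move=> IH1 IH0 G1i G0i F1i F0i.
have ai := prob_itv k y OA; have ai' := prob_itv l y OA.
rewrite -/a -/a' in ai ai' lk.
have absM (u v : R) : 0 <= u -> `|u * v| = u * `|v| by move=> u0; rewrite normrM ger0_norm.
have -> : a * F1 + (1 - a) * F0 - (a' * G1 + (1 - a') * G0) =
  a' * (F1 - G1) + (1 - a) * (F0 - G0) + (a - a') * (F1 - G0) by ring.
apply: (@le_trans _ _ (a' * `|F1 - G1| + (1 - a) * `|F0 - G0| + (a - a'))).
  apply: (le_trans (ler_normD _ _)); apply: lerD.
    have a'0 : 0 <= a' by lra.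
    have a0 : 0 <= 1 - a by lra.
    by apply: (le_trans (ler_normD _ _)); rewrite (absM _ _ a'0) (absM _ _ a0).
  rewrite absM ?subr_ge0 // ler_piMr ?subr_ge0 // ler_norml; lra.
rewrite big_cons.
have am : prob km A O y <= a' by exact: prob_mono.
have ap : a <= prob kp A O y by exact: prob_mono.
apply: (@le_trans _ _ ((a - a') +
   \sum_(x <- r) (a' * (prob kp (y |: A) (y |: O) x - prob km (y |: A) (y |: O) x)
     + (1 - a) * (prob kp (y |: A) O x - prob km (y |: A) O x)))).
  rewrite addrC lerD2l big_split /= -!mulr_sumr; apply: lerD; apply: ler_wpM2l => //; lra.
apply: lerD; first lra.
apply: ler_sum => x _; rewrite (prob_split kp x yA OA) (prob_split km x yA OA).
have p1 : prob kp (y |: A) O x <= prob kp (y |: A) (y |: O) x.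
  by apply: prob_mono => //; exact: subsetUr.
have m1 : prob km (y |: A) O x <= prob km (y |: A) (y |: O) x.
  by apply: prob_mono => //; exact: subsetUr.
have mp u : km u <= kp u by exact: le_trans (mk u) (kp' u).
have m2 : prob km (y |: A) O x <= prob kp (y |: A) (y |: O) x.
  by apply: prob_mono => //; exact: subsetUr.
move: ap am p1 m1 m2; set P := prob kp A O y; set M := prob km A O y.
set p1 := prob kp _ (y |: O) x; set p0 := prob kp _ O x.
set m1 := prob km _ (y |: O) x; set m0 := prob km _ O x.
move=> aP Ma h1 h2 h3.
(* These three products are the slack when [prob kp] and [prob km] are split on the spin at [y]. *)
have e1 : 0 <= (P - a) * (p1 - p0) by rewrite mulr_ge0 // subr_ge0.
have e2 : 0 <= (a' - M) * (m1 - m0) by rewrite mulr_ge0 // subr_ge0.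
have e3 : 0 <= (a - a') * (p1 - m0) by rewrite mulr_ge0 // subr_ge0.
lra.
Qed.

End SetIsing.

Section IsingBounds.
Variables (R : realType) (T : finType) (c : T -> T -> R).
Hypothesis c_ge0 : forall u v, 0 <= c u v.
Hypothesis c_sym : forall u v, c u v = c v u.
Implicit Types (k l : T -> R) (S B D X Y : {set T}) (x : T).

Definition ising_mean k (f : {ffun T -> bool} -> R) : R :=
  (\sum_s ising_weight c k s * f s) / ising_Z c k.

Let cond_exp0E k (f : {ffun T -> bool} -> R) :
  cond_exp (set_weight c k) set0 set0 (fun X => f [ffun x => x \in X]) = ising_mean k f.
Proof.
rewrite /ising_mean /ising_Z !sum_config_set /cond_exp /slice_sum.
congr (_ / _); first by apply: eq_bigl => X; rewrite setI0 eqxx.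
by apply: eq_big => X; rewrite ?setI0 ?eqxx // mulr1.
Qed.

Lemma ising_plus_mean k x : ising_plus c k x = ising_mean k (fun s => (s x)%:R).
Proof.
rewrite /ising_plus /ising_mean big_mkcond /=; congr (_ / _); apply: eq_bigr => s _.
by case: (s x); rewrite ?mulr1 ?mulr0.
Qed.

Let prob0E k x : cond_exp (set_weight c k) set0 set0 (fun X => (x \in X)%:R) = ising_plus c k x.
Proof.
rewrite ising_plus_mean -cond_exp0E; congr cond_exp.
by apply/funext => X; rewrite ffunE.
Qed.

Lemma ising_boundary_influence B D k l km kp (f : {ffun T -> bool} -> R) :
  (forall u, km u <= k u) -> (forall u, k u <= kp u) ->
  (forall u, km u <= l u) -> (forall u, l u <= kp u) ->
  (forall u, u \in D -> k u = l u) ->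
  (forall u v, u \in D -> v \notin D -> v \notin B -> c u v = 0) ->
  (forall s : {ffun T -> bool}, 0 <= f s <= 1) ->
  (forall s t : {ffun T -> bool}, (forall x, x \in D -> s x = t x) -> f s = f t) ->
  `|ising_mean k f - ising_mean l f| <=
  \sum_(x in B) (ising_plus c kp x - ising_plus c km x).
Proof.
move=> mk kp' ml lp kl cD f01 fD.
pose g X := f [ffun x => x \in X].
have g01 X : 0 <= g X <= 1 by exact: f01.
have E : set0 :|: [set x in enum B] = B.
  by apply/setP => x; rewrite !inE mem_enum.
have := @ex_diff_le R T c c_ge0 km kp g g01 (enum B) k l set0 set0 (enum_uniq _).
rewrite E !cond_exp0E big_enum /=.
under eq_bigr do rewrite !prob0E; apply=> // [x _|O' OB]; first by rewrite inE.
apply: (cond_exp_markov (D := D)) => // X Y XY; apply: fD => x xD; rewrite !ffunE.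
by move/setP/(_ x): XY; rewrite !inE xD !andbT.
Qed.

(** FKG for two increasing events: a plus at [x] and pluses on all of [S]. *)
Lemma ising_plus_cond k S x :
  ising_plus c k x <=
  (\sum_(s : {ffun T -> bool} | [forall y in S, s y]) ising_weight c k s * (s x)%:R)
  / \sum_(s : {ffun T -> bool} | [forall y in S, s y]) ising_weight c k s.
Proof.
have Z0 := ising_Z_gt0 c k.
have Z1 : 0 < \sum_(s : {ffun T -> bool} | [forall y in S, s y]) ising_weight c k s.
  rewrite (bigD1 [ffun=> true]) /=; last by apply/forall_inP => y _; rewrite ffunE.
  rewrite ltr_pwDl ?ising_weight_gt0 // sumr_ge0 // => s _; exact/ltW/ising_weight_gt0.
rewrite ising_plus_mean /ising_mean ler_pdivrMr // mulrAC ler_pdivlMr //.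
rewrite /ising_Z [X in _ * X <= _]big_mkcond [X in _ <= X * _]big_mkcond /= !sum_config_set.
have inc S' : increasing (fun X : {set T} => (S' \subset X)%:R : R).
  move=> X Y XY; rewrite ler_nat; case: (boolP (_ \subset X)) => // h.
  by rewrite (subset_trans h XY).
have := fkg (set_weight_gt0 c k) (set_weight_holley c_ge0 (fun u => lexx (k u))) (inc [set x])
  (inc S).
have F X : [forall y in S, [ffun z => z \in X] y] = (S \subset X).
  apply/forall_inP/subsetP => h y /h; by rewrite ffunE.
have E1 : \sum_X set_weight c k X * ([set x] \subset X)%:R =
    \sum_(X : {set T}) ising_weight c k [ffun z => z \in X] * ([ffun z => z \in X] x)%:R.
  by apply: eq_bigr => X _; rewrite ffunE sub1set.
have E2 : \sum_X set_weight c k X * (S \subset X)%:R =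
    \sum_(X : {set T}) (if [forall y in S, [ffun z => z \in X] y] then ising_weight c k [ffun z
      => z \in X] else 0).
  by apply: eq_bigr => X _; rewrite F; case: ifP; rewrite ?mulr1 ?mulr0.
have E3 : \sum_X set_weight c k X * (([set x] \subset X)%:R * (S \subset X)%:R) =
    \sum_(X : {set T}) (if [forall y in S, [ffun z => z \in X] y]
      then ising_weight c k [ffun z => z \in X] * ([ffun z => z \in X] x)%:R else 0).
  by apply: eq_bigr => X _; rewrite F ffunE sub1set; case: ifP; rewrite ?mulr1 ?mulr0.
by rewrite E1 E2 E3.
Qed.

End IsingBounds.

(** * Plus spins outside a subset, turned into a field *)

Section Restriction.
Variables (R : realType) (T T' : finType) (c : T -> T -> R) (k : T -> R) (iota : T' -> T).
Hypothesis c_sym : forall u v, c u v = c v u.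
Hypothesis iota_inj : injective iota.
Let S := [set v | v \notin codom iota].

Definition restricted_coupling (u v : T') := c (iota u) (iota v).
Definition restricted_field (u : T') := k (iota u) + \sum_(v in S) c (iota u) v.

Let sum_split (g : T -> R) : \sum_v g v = \sum_u g (iota u) + \sum_(v in S) g v.
Proof.
rewrite (bigID (mem (codom iota))) /=; congr (_ + _); last by apply: eq_bigl => v; rewrite inE.
rewrite -big_uniq /=; last by rewrite map_inj_uniq ?enum_uniq.
by rewrite codomE big_map big_enum.
Qed.

Let pull (s : {ffun T -> bool}) : {ffun T' -> bool} := [ffun u => s (iota u)].

Lemma ising_weight_restrict (s : {ffun T -> bool}) : (forall v, v \in S -> s v) ->
  ising_weight c k s =
  expR (2^-1 * (\sum_(u in S) \sum_(v in S) c u v) + \sum_(v in S) k v) *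
  ising_weight restricted_coupling restricted_field (pull s).
Proof.
move=> sS; rewrite /ising_weight -expRD; congr expR; rewrite /ising_energy.
rewrite !sum_split.
under eq_bigr do rewrite sum_split.
under [X in _ * (_ + X)]eq_bigr do rewrite sum_split.
rewrite !big_split /=.
set A := \sum_i \sum_i0 _; set B := \sum_i \sum_(i0 in S) _.
set C := \sum_(i in S) \sum_i0 _; set D := \sum_(i in S) \sum_(i0 in S) _.
set F := \sum_i _; set G := \sum_(i in S) _; set A' := \sum_i \sum_i0 _; set F' := \sum_i _.
have EA : A' = A.
  by apply: eq_bigr => u _; apply: eq_bigr => v _; rewrite !ffunE.
have EC : C = B.
  rewrite /C exchange_big; apply: eq_bigr => u _; apply: eq_bigr => v _ /=.
  by rewrite c_sym [spin R _ * _]mulrC.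
have ED : D = \sum_(u in S) \sum_(v in S) c u v.
  by apply: eq_bigr => u uS; apply: eq_bigr => v vS; rewrite !sS // !mulr1.
have EG : G = \sum_(v in S) k v by apply: eq_bigr => v vS; rewrite sS // mulr1.
have EF : F' = F + B.
  rewrite /F' /F /B -big_split /=; apply: eq_bigr => u _.
  rewrite /restricted_field mulrDl !ffunE mulr_suml; congr (_ + _); apply: eq_bigr => v vS.
  by rewrite (sS v) //= mulr1.
by rewrite EA EC EF -ED -EG; field.
Qed.

Lemma sum_ising_restrict (f : {ffun T' -> bool} -> R) :
  \sum_(s : {ffun T -> bool} | [forall v in S, s v]) ising_weight c k s * f (pull s) =
  expR (2^-1 * (\sum_(u in S) \sum_(v in S) c u v) + \sum_(v in S) k v) *
  \sum_t ising_weight restricted_coupling restricted_field t * f t.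
Proof.
pose ext (t : {ffun T' -> bool}) : {ffun T -> bool} :=
  [ffun v => if [pick u | iota u == v] is Some u then t u else true].
have extK t : pull (ext t) = t.
  apply/ffunP => u; rewrite !ffunE; case: pickP => [u' /eqP/iota_inj -> //|/(_ u)].
  by rewrite eqxx.
have extS t v : v \in S -> ext t v.
  rewrite inE ffunE => vS; case: pickP => // u /eqP uv.
  by rewrite -uv codom_f in vS.
rewrite (reindex_onto ext pull) /=; last first.
  move=> s /forall_inP sS; apply/ffunP => v; rewrite !ffunE; case: pickP => [u /eqP <-|h].
    by rewrite ffunE.
  symmetry; apply: sS; rewrite inE; apply/negP => /codomP[u vE].
  by have := h u; rewrite vE eqxx.
rewrite mulr_sumr; apply: eq_big => [t|t _].
  by rewrite extK eqxx andbT; apply/forall_inP => v; exact: extS.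
rewrite ising_weight_restrict; last exact: extS.
by rewrite extK mulrA.
Qed.

Lemma ising_mean_restrict (f : {ffun T' -> bool} -> R) :
  (\sum_(s : {ffun T -> bool} | [forall v in S, s v]) ising_weight c k s * f (pull s))
  / (\sum_(s : {ffun T -> bool} | [forall v in S, s v]) ising_weight c k s)
  = ising_mean restricted_coupling restricted_field f.
Proof.
under [X in _ / X]eq_bigr do rewrite -[ising_weight _ _ _]mulr1.
rewrite (sum_ising_restrict f) (sum_ising_restrict (fun=> 1)) /ising_mean /ising_Z.
under [X in _ / (_ * X)]eq_bigr do rewrite mulr1.
rewrite -mulf_div divff ?mul1r // gt_eqF //; exact: expR_gt0.
Qed.

End Restriction.

(** * The lattice *)

Section Lattice.
Local Open Scope fset_scope.
Local Open Scope ring_scope.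
Variables (R : realType) (d : nat).
Implicit Types (x y z u v : lattice d) (L : {fset lattice d}).

Lemma adj_sym u v : adj u v = adj v u.
Proof. by rewrite /adj; congr (_ == _); apply: eq_bigr => i _; rewrite distrC. Qed.

Lemma adjxx u : adj u u = false.
Proof. by rewrite /adj big1 // => i _; rewrite subrr normr0. Qed.

Lemma adj_addl x u v : adj (x + u) (x + v) = adj u v.
Proof.
rewrite /adj; congr (_ == _); apply: eq_bigr => i _; rewrite !mxE.
by rewrite opprD addrACA subrr add0r.
Qed.

Lemma adj_box u v : adj u v -> v - u \in box d 1.
Proof.
move=> /eqP uv; rewrite in_boxE; apply/forallP => i; rewrite !mxE distrC.
rewrite -[leRHS]uv (bigD1 i) //= lerDl; apply: sumr_ge0 => j _; exact: normr_ge0.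
Qed.

(** Indexing neighbours by their displacement lets sums over different finite sets be compared term
    by term. *)
Lemma sum_adj L u (F : lattice d -> R) :
  \sum_(v : L | adj u (val v)) F (val v) =
  \sum_(z <- box d 1 | adj 0 z && (u + z \in L)) F (u + z).
Proof.
rewrite -(big_seq_fsetE _ L (adj u) F) /=.
rewrite -big_filter -[RHS]big_filter -(big_map (fun z => u + z) xpredT F) /=.
apply: perm_big; apply: uniq_perm.
- by rewrite filter_uniq // fset_uniq.
- by rewrite map_inj_uniq ?filter_uniq ?fset_uniq // => y z; exact: addrI.
move=> v; rewrite mem_filter; apply/andP/mapP => [[uv vL]|[z]].
  have vE : u + (v - u) = v by rewrite addrC subrK.
  exists (v - u); last by rewrite vE.
  by rewrite mem_filter vE vL andbT adj_box // andbT -(adj_addl u) addr0 vE.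
by rewrite mem_filter => /andP[/andP[uz zL] _] ->; rewrite -{1}[u]addr0 adj_addl.
Qed.

Definition deg_out L u : R := \sum_(z <- box d 1 | adj 0 z && (u + z \notin L)) 1.

Lemma deg_out_ge0 L u : 0 <= deg_out L u.
Proof. exact: sumr_ge0. Qed.

Lemma sum_ex_boundary L u : u \in L ->
  \sum_(v : ex_boundary L | adj u (val v)) 1 = deg_out L u.
Proof.
move=> uL; rewrite (sum_adj _ _ (fun=> 1)) /deg_out; apply: eq_bigl => z.
case az: (adj 0 z) => //=; rewrite in_ex_boundary.
rewrite (_ : [exists _, _] = true) ?andbT //.
by apply/existsP; exists [` uL]; rewrite /= -{1}[u]addr0 adj_addl.
Qed.

Definition coupling (beta : R) L (u v : L) : R := beta * (adj (val u) (val v))%:R.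

Definition plus_field (beta : R) L (u : L) : R := beta * deg_out L (val u).

Definition gibbs_field L (h : L -> R) (eta : config (ex_boundary L)) (beta H : R) (u : L) : R :=
  H * h u + beta * \sum_(v : ex_boundary L | adj (val u) (val v)) spin R (eta v).

Lemma gibbs_weightE L (h : L -> R) (eta : config (ex_boundary L)) (beta H : R) (s : config L) :
  gibbs_weight h eta beta H s = ising_weight (coupling beta (L := L)) (gibbs_field h eta beta H) s.
Proof.
rewrite /gibbs_weight /ising_weight /ising_energy.
congr expR.
rewrite -addrA.
set A1 := beta * _; set A2 := beta * _; set A3 := H * _; set B1 := _ * _; set B2 := \sum_(u <- _) _.
suff [-> ->] : A1 = B1 /\ A2 + A3 = B2 by [].
split; rewrite {}/A1 {}/A2 {}/A3 {}/B1 {}/B2.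
  rewrite mulrCA; congr (_ * _); rewrite mulr_sumr; apply: eq_bigr => u _.
  rewrite mulr_sumr big_mkcond; apply: eq_bigr => v _; rewrite /coupling.
  by case: adj; rewrite ?mulr1 // mulr0 mul0r.
rewrite [X in X + _]mulr_sumr [X in _ + X]mulr_sumr -big_split; apply: eq_bigr => u _ /=.
rewrite /gibbs_field mulrDl addrC mulrA; congr (_ + _).
by rewrite -mulrA; congr (_ * _); rewrite mulr_suml; apply: eq_bigr => v _; rewrite mulrC.
Qed.

Lemma gibbs_field_bounds L (h : L -> R) (eta : config (ex_boundary L)) (beta H : R) (u : L) :
  0 <= beta ->
  H * h u - plus_field beta u <= gibbs_field h eta beta H u <= H * h u + plus_field beta u.
Proof.
move=> b0; rewrite /gibbs_field /plus_field -mulrN !lerD2l.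
have : `|\sum_(v : ex_boundary L | adj (val u) (val v)) spin R (eta v)| <= deg_out L (val u).
  apply: (le_trans (ler_norm_sum _ _ _)); rewrite -sum_ex_boundary ?fsvalP //.
  by apply: ler_sum => v _; case: (eta v); rewrite /= ?normrN normr1.
by rewrite ler_norml => /andP[h1 h2]; rewrite !ler_wpM2l.
Qed.

Lemma coupling_sym (beta : R) L (u v : L) : coupling beta u v = coupling beta v u.
Proof. by rewrite /coupling adj_sym. Qed.

Lemma coupling_ge0 (beta : R) L (u v : L) : 0 <= beta -> 0 <= coupling beta u v.
Proof. by move=> b0; rewrite mulr_ge0. Qed.

Lemma coupling_diag (beta : R) L (u : L) : coupling beta u u = 0.
Proof. by rewrite /coupling adjxx mulr0. Qed.

Lemma ising_mean_spin (T : finType) (c : T -> T -> R) k (x : T) :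
  ising_mean c k (fun s => spin R (s x)) = 2 * ising_plus c k x - 1.
Proof.
have Z0 := lt0r_neq0 (ising_Z_gt0 c k).
rewrite ising_plus_mean /ising_mean; apply: (mulIf Z0);
  rewrite divfK // mulrBl mul1r -mulrA divfK //.
rewrite mulr_sumr /ising_Z -sumrB.
by apply: eq_bigr => s _; case: (s x) => /=; ring.
Qed.

Lemma plus_magnetizationE (beta : R) n : plus_magnetization d beta n =
  2 * ising_plus (coupling beta (L := box d n)) (@plus_field beta (box d n)) [` box_origin d n] - 1.
Proof.
rewrite -ising_mean_spin /plus_magnetization /gibbs /ising_mean /ising_Z mulr_suml.
have E s : gibbs_weight (fun=> 0) [ffun=> true] beta 0 s =
    ising_weight (coupling beta (L := box d n)) (@plus_field beta (box d n)) s.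
  rewrite gibbs_weightE /ising_weight /ising_energy; congr (expR (_ + _)).
  apply: eq_bigr => u _; congr (_ * _); rewrite /gibbs_field mul0r add0r /plus_field.
  congr (_ * _); rewrite -sum_ex_boundary ?fsvalP //; apply: eq_bigr => v _.
  by rewrite ffunE.
under eq_bigr do under eq_bigr do rewrite E.
by apply: eq_bigr => s _; rewrite E mulrAC.
Qed.

Section Boxes.
Variables (L : {fset lattice d}) (n : nat) (x : lattice d).
Hypothesis xL : forall u, u \in box d n -> x + u \in L.

Definition box_embed (u : box d n) : L := [` xL (fsvalP u)].

Lemma box_embed_inj : injective box_embed.
Proof. by move=> u v /(congr1 val) /= /addrI /val_inj. Qed.

Lemma codom_box_embed (v : L) : (v \in codom box_embed) = (val v - x \in box d n).
Proof.
apply/codomP/idP => [[u ->]|vb]; first by rewrite /= addrC addKr fsvalP.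
by exists [` vb]; apply: val_inj; rewrite /= addrC subrK.
Qed.

(** A neighbour outside the translated box is either outside [L] or one of the sites of [L] that
    will be set to plus. *)
Lemma deg_out_box u : u \in box d n ->
  deg_out (box d n) u = deg_out L (x + u)
    + \sum_(v in [set v | v \notin codom box_embed]) (adj (x + u) (val v))%:R.
Proof.
move=> ub.
have -> : \sum_(v in [set v | v \notin codom box_embed]) (adj (x + u) (val v))%:R =
    \sum_(v : L | adj (x + u) (val v)) (val v - x \notin box d n)%:R :> R.
  rewrite big_mkcond [RHS]big_mkcond; apply: eq_bigr => v _.
  by rewrite inE codom_box_embed; case: adj; case: (_ \notin _).
rewrite (sum_adj _ _ (fun v => (v - x \notin box d n)%:R)).
rewrite /deg_out big_mkcond [X in _ = X + _]big_mkcond [X in _ = _ + X]big_mkcond -big_split.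
apply: eq_bigr => z _ /=; case: (adj 0 z) => /=; last by rewrite addr0.
rewrite -addrA [x + (u + z)]addrC addrK [u + z + x]addrC.
have [uz|uz] := boolP (u + z \in box d n); first by rewrite xL //= addr0.
by case: (_ \in L); rewrite /= ?add0r ?addr0.
Qed.

Lemma restricted_couplingE beta :
  restricted_coupling (coupling beta (L := L)) box_embed = coupling beta (L := box d n).
Proof. by apply/funext => u; apply/funext => v; rewrite /restricted_coupling /coupling /=
  adj_addl. Qed.

Lemma restricted_fieldE beta (k : L -> R) :
  (forall u : box d n, k (box_embed u) = beta * deg_out L (x + val u)) ->
  restricted_field (coupling beta (L := L)) k box_embed = @plus_field beta (box d n).
Proof.
move=> kE; apply/funext => u; rewrite /restricted_field kE /plus_field deg_out_box ?fsvalP //.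
by rewrite mulrDr [X in _ = _ + X]mulr_sumr.
Qed.

(** Setting the spins of [L] outside the cube to plus raises the magnetization at [x] and leaves the
    box with plus boundary condition. *)
Lemma ising_plus_box beta (u : L) : val u = x -> 0 <= beta ->
  2 * ising_plus (coupling beta (L := L)) (plus_field beta (L := L)) u - 1
  <= plus_magnetization d beta n.
Proof.
move=> ux b0; rewrite plus_magnetizationE lerD2r ler_pM2l //.
have uE : box_embed [` box_origin d n] = u by apply: val_inj; rewrite /= addr0.
have := ising_plus_cond (fun u v : L => coupling_ge0 u v b0) (plus_field beta (L := L))
  [set v | v \notin codom box_embed] u.
move=> h; apply: (le_trans h).
have := @ising_mean_restrict R L (box d n) (coupling beta (L := L)) (plus_field beta (L := L))
  box_embed (coupling_sym beta (L := L)) box_embed_inj (fun s => (s [` box_origin d n])%:R).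
rewrite restricted_couplingE restricted_fieldE // -ising_plus_mean => <-.
rewrite le_eqVlt; apply/orP; left; apply/eqP; congr (_ / _).
by apply: eq_bigr => s _; rewrite ffunE uE.
Qed.

End Boxes.

Section LatticeClusters.
Variables (L : {fset lattice d}) (lam beta : R).
Hypotheses (lam_gt0 : 0 < lam) (lamE : 1 + lam = expR beta).

(* Every bond is represented by both of its orientations; each of them carries
   half of the coupling of the bond. *)
Definition adjacent : {pred L * L} := fun p => adj (val p.1) (val p.2).
Definition lattice_edge := {p : L * L | p \in adjacent}.
Definition edge_src (e : lattice_edge) : L := (val e).1.
Definition edge_dst (e : lattice_edge) : L := (val e).2.

Lemma sum_lattice_edge (F : L -> L -> R) :
  \sum_(e : lattice_edge) F (edge_src e) (edge_dst e) =
  \sum_u \sum_(v | adj (val u) (val v)) F u v.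
Proof.
rewrite pair_big_dep /= -(big_sub adjacent (fun p => F p.1 p.2)).
by apply: eq_bigl => -[u v].
Qed.

(** An aligned pair has weight [1 + lam] in each of its two orientations, hence [exp (2 beta)] per
    bond against 1 for opposite spins; this is why [1 + lam] is [exp beta]. *)
Lemma edge_weightE (s : {ffun L -> bool}) :
  edge_weight edge_src edge_dst lam s =
  expR (\sum_(e : lattice_edge) beta / 2) * ising_weight (coupling beta (L := L)) (fun=> 0) s.
Proof.
have E (e : lattice_edge) : 1 + lam * (s (edge_src e) == s (edge_dst e))%:R =
    expR (beta / 2 + beta / 2 * (spin R (s (edge_src e)) * spin R (s (edge_dst e)))).
  case: (s (edge_src e)); case: (s (edge_dst e));
    rewrite /= ?mulr1 ?mulr0 ?addr0 ?mulrNN ?mulr1 ?mulrN1 ?lamE ?mul1r ?mulN1r ?subrr ?expR0 //;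
    by congr expR; field.
rewrite /edge_weight; under eq_bigr do rewrite E.
rewrite -expR_sum big_split /= expRD; congr (_ * expR _).
rewrite (sum_lattice_edge (fun u v : L => beta / 2 * (spin R (s u) * spin R (s v)))).
rewrite /ising_energy [X in _ = _ + X]big1 ?addr0; last by move=> u _; rewrite mul0r.
rewrite mulr_sumr; apply: eq_bigr => u _; rewrite mulr_sumr big_mkcond; apply: eq_bigr => v _.
by rewrite /coupling; case: adj; rewrite /= ?mulr1 ?mulr0 ?mul0r ?mulr0 // !mulrA [2^-1 *
  beta]mulrC.
Qed.

(** The wiring on [S] plays the part of the plus boundary condition. Vanishing of [deg_out] on the
    cube means that all its exterior neighbours belong to [S]. *)
Lemma fk_plus_magnetization n x (xL : forall u, u \in box d n -> x + u \in L)
    (S := [set v : L | v \notin codom (box_embed xL)]) (o : L) : val o = x ->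
  (forall u, u \in box d n -> deg_out L (x + u) = 0) ->
  mean (fkw edge_src edge_dst lam S) (fun X => (conn edge_src edge_dst X o S)%:R) =
  plus_magnetization d beta n.
Proof.
move=> ox nb; rewrite fk_magnetization //.
have uE : box_embed xL [` box_origin d n] = o by apply: val_inj; rewrite /= addr0.
have := @ising_mean_restrict R L (box d n) (coupling beta (L := L)) (fun=> 0)
  (box_embed xL) (coupling_sym beta (L := L)) (@box_embed_inj _ _ _ xL)
  (fun s => spin R (s [` box_origin d n])).
rewrite restricted_couplingE restricted_fieldE; last by move=> u; rewrite nb ?fsvalP // mulr0.
rewrite ising_mean_spin -plus_magnetizationE => <-.
set C := expR (\sum_(e : lattice_edge) beta / 2).
transitivity ((C * \sum_(s : {ffun L -> bool} | [forall v in S, s v])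
    ising_weight (coupling beta (L := L)) (fun=> 0) s * spin R (s o)) /
   (C * \sum_(s : {ffun L -> bool} | [forall v in S, s v])
    ising_weight (coupling beta (L := L)) (fun=> 0) s)); last first.
  rewrite -mulf_div divff ?mul1r ?lt0r_neq0 ?expR_gt0 //.
  by congr (_ / _); apply: eq_bigr => s _; rewrite ffunE uE.
rewrite !mulr_sumr; congr (_ / _); apply: eq_bigr => s _; rewrite edge_weightE //.
by rewrite mulrCA; congr (_ * _); rewrite mulrC.
Qed.

End LatticeClusters.

End Lattice.

(** * Sharpness of the phase transition *)

Lemma is_derive_big (R : realType) (I : Type) (r : seq I) (h dh : I -> R -> R) (x : R) :
  (forall i, is_derive x (1 : R) (h i) (dh i x)) ->
  is_derive x (1 : R) (fun t => \sum_(i <- r) h i t) (\sum_(i <- r) dh i x).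
Proof.
move=> hD; elim: r => [|i r IH].
  by rewrite big_nil; under eq_fun do rewrite big_nil; exact: is_derive_cst.
rewrite big_cons; under eq_fun do rewrite big_cons.
exact: is_deriveD.
Qed.

(** * Derivative of a mean in the logarithm of the edge weight *)

Section RussoFormula.
Variables (R : realType) (E : finType) (N : {set E} -> R) (f : {set E} -> R).
Hypothesis N_gt0 : forall X, 0 < N X.

Let w (s : R) (X : {set E}) : R := expR s ^+ #|X| * N X.

Let sumD (s : R) (g : {set E} -> R) :
  is_derive s (1 : R) (fun t => \sum_X w t X * g X) (\sum_X w s X * (#|X|%:R * g X)).
Proof.
apply: (is_derive_big _ (h := fun X t => w t X * g X) (dh := fun X t => w t X * (#|X|%:R * g X))).
move=> X; have L : is_derive s (1 : R) (fun t => #|X|%:R * t) #|X|%:R.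
  by apply: is_derive_eq; rewrite /GRing.scale /= mulr1.
have D0 := @is_derive1_comp R expR (fun t => #|X|%:R * t) s _ _ (is_derive_expR _) L.
rewrite (_ : (fun t => w t X * g X) = fun t => (expR \o (fun t => #|X|%:R * t)) t * (N X * g X));
  last first.
  by apply/funext => t; rewrite /w /= expRM_natl mulrA.
apply: is_derive_eq; rewrite /GRing.scale /= /w expRM_natl; ring.
Qed.

(** In the parameter [s] the weight of [X] has logarithmic derivative [#|X|], so the derivative is
    the covariance of [f] with the number of open edges. *)
Lemma mean_derive (s : R) :
  is_derive s (1 : R) (fun t => mean (w t) f) (\sum_e cov (w s) f e).
Proof.
have w0 t X : 0 < w t X by rewrite mulr_gt0 // exprn_gt0 // expR_gt0.
have Z0 t : \sum_X w t X != 0.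
  rewrite gt_eqF // (bigD1 set0) //= ltr_pwDl // sumr_ge0 // => X _; exact: ltW.
have D1 := sumD s f.
have D2 : is_derive s (1 : R) (fun t => \sum_X w t X) (\sum_X w s X * #|X|%:R).
  have := sumD s (fun=> 1).
  under eq_fun do under eq_bigr do rewrite mulr1.
  by under eq_bigr do rewrite mulr1.
have D3 := is_deriveV (Z0 s) D2.
have -> : (fun t => mean (w t) f) = (fun t => \sum_X w t X * f X) * (fun t => (\sum_X w t
  X)^-1) by [].
apply: is_derive_eq; rewrite /GRing.scale /= /cov sumrB -[X in _ = _ - X]mulr_suml.
have card_mean (g : {set E} -> R) : \sum_e mean (w s) (fun X => (e \in X)%:R * g X) =
    (\sum_X w s X * (#|X|%:R * g X)) / \sum_X w s X.
  rewrite /mean -mulr_suml; congr (_ / _); rewrite exchange_big; apply: eq_bigr => X _ /=.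
  rewrite -mulr_sumr -mulr_suml; congr (_ * (_ * _)).
  by rewrite -sum1_card natr_sum [RHS]big_mkcond; apply: eq_bigr => e _; case: (e \in X).
rewrite (card_mean f) (_ : \sum_e mean (w s) (fun X => (e \in X)%:R) = (\sum_X w s X * #|X|%:R)
  / \sum_X w s X); last first.
  have := card_mean (fun=> 1); under eq_bigr do under [X in mean _ X]eq_fun do rewrite mulr1.
  by move=> ->; under eq_bigr do rewrite mulr1.
rewrite /mean; have := Z0 s; set Z := \sum_X w s X; set A := \sum_X _; set B := \sum_X _;
  set C := \sum_X _.
by move=> Zn; field.
Qed.

End RussoFormula.

Lemma mean_holley (R : realType) (E : finType) (w w' g : {set E} -> R) :
  (forall X, 0 < w X) -> (forall X, 0 < w' X) -> holley w w -> holley w w' ->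
  increasing g -> mean w g <= mean w' g.
Proof. by move=> w0 w0' h h' gi; rewrite -!cond_exp0; apply: cond_exp_mono. Qed.

Section SupNorm.
Variable d : nat.
Implicit Types (x y u v : lattice d).

Definition supn x : nat := \max_(i < d) `|x 0%R i|%N.

Lemma in_box_supn n x : (x \in box d n) = (supn x <= n)%N.
Proof.
rewrite in_boxE; apply/forallP/bigmax_leqP => h i; first by move=> _; have := h i; lia.
by have := h i isT; lia.
Qed.

Lemma supn0 : supn 0 = 0%N.
Proof. by apply/eqP; rewrite -leqn0 -in_box_supn box_origin. Qed.

Lemma supnN x : supn (- x) = supn x.
Proof. by apply: eq_bigr => i _; rewrite mxE abszN. Qed.

Lemma supnD x y : (supn (x + y) <= supn x + supn y)%N.
Proof.
apply/bigmax_leqP => i _; rewrite mxE.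
have h1 : (`|x 0%R i| <= supn x)%N by rewrite /supn (leq_bigmax i).
have h2 : (`|y 0%R i| <= supn y)%N by rewrite /supn (leq_bigmax i).
move: h1 h2; move: (x _ i) (y _ i) (supn x) (supn y) => a b p q; lia.
Qed.

Lemma supnB x y : (supn x <= supn (x - y) + supn y)%N.
Proof. by rewrite -{1}[x](subrK y); exact: supnD. Qed.

Lemma supn_distC x y : supn (x - y) = supn (y - x).
Proof. by rewrite -supnN opprB. Qed.

Lemma supn_adj x y : adj x y -> (supn y <= (supn x).+1)%N.
Proof.
move=> /adj_box; rewrite in_box_supn => h; have := supnB y x; lia.
Qed.

End SupNorm.

Section Sharpness.
Local Open Scope fset_scope.
Local Open Scope ring_scope.
Variables (R : realType) (d : nat).
Implicit Types (lam beta s : R) (i j k n : nat).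

(** Indexed by the distance [j] at which the plus spins begin: they surround the box of radius
    [j - 1]. For [j = 0] the origin itself is plus, whence the value 1. *)
Definition radius_mag beta j : R := if j is i.+1 then plus_magnetization d beta i else 1.

Lemma plus_magnetization_le1 beta n : plus_magnetization d beta n <= 1.
Proof.
rewrite plus_magnetizationE; suff : ising_plus (coupling beta (L := box d n)) (@plus_field R d
  beta (box d n)) [` box_origin d n] <= 1 by lra.
rewrite /ising_plus ler_pdivrMr ?ising_Z_gt0 // mul1r /ising_Z [leRHS](bigID (fun t : config
  (box d n) => t [` box_origin d n])) /=.
by rewrite lerDl sumr_ge0 // => t _; exact/ltW/ising_weight_gt0.
Qed.

Lemma radius_mag_decr beta i j : 0 <= beta -> (i <= j)%N -> radius_mag beta j <= radius_mag beta i.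
Proof.
move=> b0; elim: j => [|j IH]; first by rewrite leqn0 => /eqP ->.
rewrite leq_eqVlt => /orP[/eqP -> //|/IH]; apply: le_trans.
case: j {IH} => [|j] /=; first exact: plus_magnetization_le1.
rewrite [leLHS]plus_magnetizationE.
have sub u : u \in box d j -> 0 + u \in box d j.+1 by rewrite add0r !in_box_supn; lia.
exact: (ising_plus_box sub).
Qed.

Section Clusters.
Variables (N : nat) (lam beta : R).
Hypotheses (lam_gt0 : 0 < lam) (lamE : 1 + lam = expR beta).
Local Notation L := (box d N).
Local Notation src := (@edge_src d L).
Local Notation dst := (@edge_dst d L).
Local Notation fk S := (fkw src dst lam S).

Lemma conn_increasing x (U : {set L}) : increasing (fun X => (conn src dst X x U)%:R : R).
Proof.
move=> X Y XY; rewrite ler_nat; have := @conn_sub _ _ src dst X Y x U XY.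
by case: (conn _ _ X x U) => //= /(_ isT) ->.
Qed.

Lemma mean_itv (w f : {set lattice_edge L} -> R) : (forall X, 0 < w X) ->
  (forall X, 0 <= f X <= 1) -> 0 <= mean w f <= 1.
Proof.
move=> w0 f01; have Z0 : 0 < \sum_X w X.
  by rewrite (bigD1 set0) //= ltr_pwDl // sumr_ge0 // => X _; exact: ltW.
rewrite /mean; apply/andP; split.
  apply: divr_ge0; last exact: ltW.
  by apply: sumr_ge0 => X _; case/andP: (f01 X) => h _; rewrite mulr_ge0 // ltW.
rewrite ler_pdivrMr // mul1r; apply: ler_sum => X _.
by case/andP: (f01 X) => _ h; rewrite ler_piMr // ltW.
Qed.

(** Wiring all of [U] increases the probability. Then [x] is surrounded by wired sites from distance
    [j] on, and the room left in the box makes the result the magnetization of a full cube. *)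
Lemma fk_conn_radius (S U : {set L}) (x : L) j : (supn (val x) + j <= N)%N ->
  S \subset U -> U = [set v : L | (j <= supn (val v - val x))%N] ->
  mean (fk S) (fun X => (conn src dst X x U)%:R) <= radius_mag beta j.
Proof.
move=> xj SU UE.
have w0 S' X : 0 < fk S' X by exact: fkw_gt0.
apply: (@le_trans _ _ (mean (fk U) (fun X => (conn src dst X x U)%:R))).
  by apply: mean_holley => //; [exact: fkw_holley | exact: fkw_holley | exact: conn_increasing].
case: j xj UE => [|j] xj UE.
  by have /andP[] := @mean_itv (fk U) (fun X => (conn src dst X x U)%:R) (w0 U) (fun X =>
    ltac:(by rewrite ler0n lern1 leq_b1)).
have sub u : u \in box d j -> val x + u \in L.
  by rewrite !in_box_supn => uj; have := supnD (val x) u; lia.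
have UE' : U = [set v : L | v \notin codom (box_embed sub)].
  by rewrite UE; apply/setP => v; rewrite !inE codom_box_embed in_box_supn -ltnNge.
rewrite UE' /=; have := @fk_plus_magnetization R d L lam beta lamE j (val x) sub x erefl.
move=> -> // u; rewrite in_box_supn => uj; rewrite /deg_out big1_seq // => z.
move=> /andP[/andP[az] zL _]; case/negP: zL; rewrite in_box_supn.
have a : adj (val x + u) (val x + u + z) by rewrite -{1}[val x + u]addr0 adj_addl.
by have := supn_adj a; have := supnD (val x) u; lia.
Qed.

End Clusters.

Lemma radius_mag_ge0 lam beta j : 0 < lam -> 1 + lam = expR beta -> 0 <= radius_mag beta j.
Proof.
move=> l0 lE; set x : box d j := [` box_origin d j].
pose U := [set v : box d j | (j <= supn (val v - val x))%N].
have h : (supn (val x) + j <= j)%N by rewrite /= supn0.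
apply: (le_trans _ (fk_conn_radius l0 lE h (subxx U) erefl)).
suff : 0 <= mean (fkw (@edge_src d _) (@edge_dst d _) lam U)
    (fun X => (conn (@edge_src d _) (@edge_dst d _) X x U)%:R : R) <= 1 by case/andP.
by apply: mean_itv => X; [exact: fkw_gt0 | rewrite ler0n lern1 leq_b1].
Qed.

(** The truncated differences add up to the distance from [a] to [k], and every distance occurs at
    most twice. *)
Lemma sum_dist_le (A : nat -> R) (a n : nat) : (forall j, 0 <= A j) -> (a <= n)%N ->
  \sum_(1 <= k < n.+1) A ((a - k) + (k - a))%N <= 2 * \sum_(0 <= j < n.+1) A j.
Proof.
move=> A0 an; rewrite (@big_cat_nat _ _ _ a.+1) //= mulr_natl mulr2n; apply: lerD.
  rewrite big_nat_rev /= big_add1 /= (@big_cat_nat _ _ _ a 0 n.+1) //=; last lia.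
  rewrite -[leLHS]addr0; apply: lerD; last exact: sumr_ge0.
  rewrite big_nat_cond [leRHS]big_nat_cond; apply: ler_sum => i /andP[/andP[_ ia] _].
  by rewrite le_eqVlt; apply/orP; left; apply/eqP; congr A; lia.
rewrite -[a.+1]add0n big_addn.
rewrite (@big_cat_nat _ _ _ (n - a).+1 0 n.+1) //=; last lia.
rewrite -[leLHS]addr0; apply: lerD; last exact: sumr_ge0.
rewrite big_nat_recl //= subSS -[leLHS]add0r; apply: lerD => //.
rewrite big_nat_cond [leRHS]big_nat_cond; apply: ler_sum => i _.
by rewrite le_eqVlt; apply/orP; left; apply/eqP; congr A; lia.
Qed.

(** * Crossing events and their differential inequality *)

Section Crossing.
Variable n : nat.
Local Notation L := (box d n.*2).
Local Notation src := (@edge_src d L).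
Local Notation dst := (@edge_dst d L).
Let o : L := [` box_origin d n.*2].
Definition far_sites m : {set L} := [set v : L | (m <= supn (val v))%N].
(** A path from the origin stopped on reaching distance [n] uses only these edges. Their ends are
    within distance [n], so cubes of radius at most [n] around them stay in the box of radius
    [2n]. *)
Definition near_edges : {set lattice_edge L} :=
  [set e | (supn (val (src e)) < n)%N || (supn (val (dst e)) < n)%N].
Definition crosses (X : {set lattice_edge L}) : R :=
  (conn src dst (X :&: near_edges) o (far_sites n))%:R.

Definition crossing_prob lam : R := mean (fkw src dst lam (far_sites n.*2)) crosses.

Let opn_adj X x y : opn src dst X x y -> adj (val x) (val y).
Proof.
case/exists_inP => e _; have := valP e; rewrite /in_mem /= /adjacent -/(src e) -/(dst e) => h.
by case/orP => /andP[/eqP <- /eqP <-] //; rewrite adj_sym.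
Qed.

Let exit_far X x y : connect (opn src dst X) x y -> (n <= supn (val y))%N ->
  exists2 v, (n <= supn (val v))%N & connect (opn src dst (X :&: near_edges)) x v.
Proof.
case/connectP => p; elim: p x => [|z p IH] x /=.
  by move=> _ -> ny; exists x => //; exact: connect0.
move=> /andP[xz zp] yE ny; have [xn|xn] := leqP n (supn (val x)).
  by exists x => //; exact: connect0.
have [v vn zv] := IH z zp yE ny; exists v => //; apply: connect_trans zv; apply: connect1.
case/exists_inP: xz => e eX h; apply/exists_inP; exists e => //; rewrite !inE eX /=.
by case/orP: h => /andP[/eqP -> /eqP ->]; rewrite xn ?orbT.
Qed.

Let crosses_level k X x y : connect (opn src dst X) x y ->
  (supn (val x) <= k)%N -> (k <= supn (val y))%N ->
  exists2 u, supn (val u) = k & connect (opn src dst X) x u.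
Proof.
case/connectP => p; elim: p x => [|z p IH] x /=.
  by move=> _ -> h1 h2; exists x; [lia | exact: connect0].
move=> /andP[xz zp] yE; rewrite leq_eqVlt => /orP[/eqP xk _|xk ky].
  by exists x => //; exact: connect0.
have zk : (supn (val z) <= k)%N := leq_trans (supn_adj (opn_adj xz)) xk.
have [u uk zu] := IH z zp yE zk ky; exists u => //.
by apply: connect_trans zu; exact: connect1.
Qed.

Lemma crosses01 X : 0 <= crosses X <= 1.
Proof. by rewrite ler0n lern1 leq_b1. Qed.

Lemma crosses_increasing : increasing crosses.
Proof. by move=> X Y XY; apply: conn_increasing; exact: setSI. Qed.

Lemma crossing_prob_itv lam : 0 < lam -> 0 <= crossing_prob lam <= 1.
Proof. by move=> l0; apply: mean_itv; [move=> X; exact: fkw_gt0 | exact: crosses01]. Qed.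

Section Bounds.
Variables (lam beta : R).
Hypotheses (lam_gt0 : 0 < lam) (lamE : 1 + lam = expR beta).
Let w := fkw src dst lam (far_sites n.*2).
Let w_gt0 X : 0 < w X. Proof. exact: fkw_gt0. Qed.

Lemma crossing_prob_le : crossing_prob lam <= radius_mag beta n.
Proof.
apply: (@le_trans _ _ (mean w (fun X => (conn src dst X o (far_sites n))%:R))).
  apply: mean_le => // X; rewrite ler_nat.
  have := @conn_sub _ _ src dst (X :&: near_edges) X o (far_sites n) (subsetIl _ _).
  by case: (conn _ _ _ _ _) => //= /(_ isT) ->.
apply: (fk_conn_radius lam_gt0 lamE); first by rewrite /= supn0; lia.
- by apply/subsetP => v; rewrite !inE; lia.
- by apply/setP => v; rewrite !inE subr0.
Qed.

(** A path to the wired layer at distance [2n] first reaches distance [n], and does so along near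
    edges. *)
Lemma crossing_prob_ge : radius_mag beta n.*2 <= crossing_prob lam.
Proof.
have [n0|n0] := posnP n.
  rewrite [leLHS](_ : _ = 1); last by rewrite n0.
  rewrite /crossing_prob (_ : crosses = fun=> 1); last first.
    apply/funext => X; rewrite /crosses /conn (_ : [exists _ in _, _] = true) //.
    by apply/exists_inP; exists o; rewrite ?connect0 // inE; lia.
  rewrite /mean; under [X in _ <= X / _]eq_bigr do rewrite mulr1.
  rewrite divff // gt_eqF // (bigD1 set0) //= ltr_pwDl ?fkw_gt0 // sumr_ge0 // => X _.
  exact/ltW/fkw_gt0.
have [m E] : exists m, n.*2 = m.+1 by exists n.*2.-1; lia.
rewrite [leLHS](_ : _ = plus_magnetization d beta m); last by rewrite E.
have sub u : u \in box d m -> 0 + u \in L by rewrite add0r !in_box_supn; lia.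
have SE : far_sites n.*2 = [set v : L | v \notin codom (box_embed sub)].
  by apply/setP => v; rewrite !inE codom_box_embed subr0 in_box_supn -ltnNge;
    move: (supn _) => q; lia.
rewrite -(@fk_plus_magnetization R d L lam beta lamE m 0 sub o erefl); last first.
  move=> u; rewrite in_box_supn => um; rewrite /deg_out big1_seq // => z.
  move=> /andP[/andP[az] zL _]; case/negP: zL; rewrite in_box_supn.
  have a : adj (0 + u) (0 + u + z) by rewrite -{1}[0 + u]addr0 adj_addl.
  by have := supn_adj a; rewrite add0r; move: um; move: (supn u) (supn (u + z)) => p q; lia.
rewrite -SE; apply: mean_le => [X|X]; first exact: fkw_gt0.
rewrite ler_nat; case: (boolP (conn _ _ X o _)) => // /exists_inP[y]; rewrite inE => yS oy.
have [|v vn ov] := exit_far oy; first by apply: leq_trans yS; rewrite -addnn leq_addr.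
by rewrite lt0b; apply/exists_inP; exists v; rewrite ?inE.
Qed.

(** Sums the exploration bound over the spheres of radius [k] from 1 to [n], all of which a crossing
    must meet. A site at distance [a] reaches the sphere with probability at most [radius_mag] at
    [|a - k|]. The factor 4 stands for the two ends of an edge and the two sides of a sphere. *)
Lemma crossing_prob_diff_ineq :
  n%:R * (crossing_prob lam * (1 - crossing_prob lam)) <=
  4 * (\sum_(0 <= j < n.+1) radius_mag beta j) * \sum_e cov w crosses e.
Proof.
have lsm : holley w w by exact: fkw_holley.
have A0 j : 0 <= radius_mag beta j by exact: radius_mag_ge0 lamE.
pose U k := [set u : L | supn (val u) == k].
pose m k x := mean w (fun X => (conn src dst X x (U k))%:R).
have mk k x : (0 < k)%N -> (k <= n)%N -> (supn (val x) <= n)%N ->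
    m k x <= radius_mag beta ((supn (val x) - k) + (k - supn (val x)))%N.
  move=> k0 kn xn; set j := (_ + _)%N.
  have jn : (j <= n)%N by rewrite /j; move: (supn _) xn => q; lia.
  pose W := [set v : L | (j <= supn (val v - val x))%N].
  have UW : U k \subset W.
    apply/subsetP => v; rewrite !inE => /eqP vk.
    have h1 := supnB (val v) (val x); have h2 := supnB (val x) (val v).
    rewrite supn_distC in h2; rewrite /j -vk; move: (supn _) (supn _) (supn _) h1 h2 => p q r; lia.
  apply: (@le_trans _ _ (mean w (fun X => (conn src dst X x W)%:R))).
    apply: mean_le => // X; rewrite ler_nat.
    case: (boolP (conn _ _ X x (U k))) => // /exists_inP[y yU xy].
    by rewrite lt0b; apply/exists_inP; exists y => //; exact: (subsetP UW).
  apply: (fk_conn_radius lam_gt0 lamE) => //; first by apply: (leq_trans (leq_add xn jn));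
    rewrite addnn.
  apply/subsetP => v; rewrite !inE => vn; have := supnB (val v) (val x).
  by move: (supn _) (supn _) (supn _) vn xn => p q r; lia.
have near e : e \in near_edges -> (supn (val (src e)) <= n)%N && (supn (val (dst e)) <= n)%N.
  have a : adj (val (src e)) (val (dst e)) by have := valP e.
  have := supn_adj a; rewrite adj_sym in a; have := supn_adj a; rewrite inE.
  by move: (supn _) (supn _) => p q; lia.
have step k : (0 < k)%N -> (k <= n)%N ->
    crossing_prob lam * (1 - crossing_prob lam) <=
    \sum_(e in near_edges) (m k (src e) + m k (dst e)) * cov w crosses e.
  move=> k0 kn; apply: (exploration_bound w_gt0 lsm) => X v; rewrite inE => vn ov.
  have [||u uk ou] := crosses_level (k := k) ov; first by rewrite /= supn0.
    exact: leq_trans vn.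
  by exists u => //; rewrite inE uk.
apply: (@le_trans _ _ (\sum_(1 <= k < n.+1) \sum_(e in near_edges) (m k (src e) + m k (dst e))
  * cov w crosses e)).
  rewrite [leLHS](_ : _ = \sum_(1 <= k < n.+1) crossing_prob lam * (1 - crossing_prob lam));
    last first.
    by rewrite big_const_nat subn1 iter_addr_0 mulr_natl.
  rewrite big_nat_cond [leRHS]big_nat_cond; apply: ler_sum => k /andP[/andP[k0 kn] _].
  exact: step.
rewrite exchange_big /=.
apply: (@le_trans _ _ (\sum_(e in near_edges) 4 * (\sum_(0 <= j < n.+1) radius_mag beta j) *
  cov w crosses e)).
  apply: ler_sum => e eF; rewrite -mulr_suml; apply: ler_wpM2r.
    by apply: cov_ge0 => //; exact: crosses_increasing.
  have /andP[sn dn] := near _ eF.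
  have half x : (supn (val x) <= n)%N -> \sum_(1 <= k < n.+1) m k x <= 2 * \sum_(0 <= j < n.+1)
    radius_mag beta j.
    move=> xn; apply: le_trans (sum_dist_le A0 xn).
    rewrite big_nat_cond [leRHS]big_nat_cond; apply: ler_sum => k /andP[/andP[k0 kn] _].
    exact: mk.
  rewrite big_split /=; apply: (le_trans (lerD (half _ sn) (half _ dn))).
  by set a := \sum_(_ <= _ < _) _; lra.
rewrite -mulr_sumr; apply: ler_wpM2l; first by rewrite mulr_ge0 // sumr_ge0.
rewrite [leRHS](bigID (mem near_edges)) /= lerDl sumr_ge0 // => e _.
by apply: cov_ge0 => //; exact: crosses_increasing.
Qed.

End Bounds.
End Crossing.
End Sharpness.

Section Decay.
Local Open Scope classical_set_scope.
Local Open Scope ring_scope.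
Variables (R : realType) (d : nat).

Let half_le (t : R) : 0 <= t -> t <= 2^-1 -> t <= 2 * (t * (1 - t)).
Proof.
move=> t0 t2; have : 0 <= t * (1 - 2 * t) by rewrite mulr_ge0 // subr_ge0; lra.
lra.
Qed.

Let exponent_half (c x y : R) : 0 <= c -> x <= 2 * y + 1 -> - (c * y) <= c - c / 2 * x.
Proof. by move=> c0 xy; have := ler_wpM2l c0 xy; lra. Qed.

Let theta (n : nat) (s : R) : R := crossing_prob d n (expR s).
Let dtheta (n : nat) (s : R) : R :=
  \sum_e cov (fkw (@edge_src d (box d n.*2)) (@edge_dst d (box d n.*2)) (expR s) (far_sites d n
    n.*2))
    (@crosses R d n) e.

Let theta_derive n s : is_derive s (1 : R) (theta n) (dtheta n s).
Proof.
apply: (mean_derive (N := fun X => #|spins (@edge_src d _) (@edge_dst d _) (far_sites d n n.*2)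
  X|%:R)).
by move=> X; rewrite ltr0n spins_gt0.
Qed.

Let theta_itv n s : 0 <= theta n s <= 1.
Proof. exact/crossing_prob_itv/expR_gt0. Qed.

Let dtheta_ge0 n s : 0 <= dtheta n s.
Proof.
apply: sumr_ge0 => e _; apply: cov_ge0.
- by move=> X; exact/fkw_gt0/expR_gt0.
- exact/fkw_holley/subxx/expR_gt0.
- exact: crosses_increasing.
Qed.

Let inverse_temp s : 1 + expR s = expR (ln (1 + expR s)) :> R.
Proof. by rewrite lnK // posrE addr_gt0 // expR_gt0. Qed.

Let inverse_temp_ge0 s : 0 <= ln (1 + expR s) :> R.
Proof. by apply: ln_ge0; rewrite lerDl expR_ge0. Qed.

Let theta0 s : theta 0 s = 1.
Proof.
apply/eqP; rewrite eq_le; have /andP[_ -> /=] := theta_itv 0 s.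
exact: (crossing_prob_ge d 0 (expR_gt0 s) (inverse_temp s)).
Qed.

Let sum_pairs (A : nat -> R) n :
  \sum_(0 <= j < n.*2) A j = \sum_(0 <= i < n) (A i.*2 + A i.*2.+1).
Proof.
elim: n => [|n IH]; first by rewrite !big_geq.
by rewrite doubleS !big_nat_recr //= IH addrA.
Qed.

(** The radii [2i] and [2i + 1] are both controlled by [theta i], through the lower half of the
    sandwich. This turns the differential inequality into one for [theta] alone. *)
Let sum_radius_mag n s : (0 < n)%N ->
  \sum_(0 <= j < n.+1) radius_mag d (ln (1 + expR s)) j <= 2 * \sum_(0 <= i < n) theta i s.
Proof.
move=> n0; set A := radius_mag _ _.
have A0 j : 0 <= A j := radius_mag_ge0 d j (expR_gt0 s) (inverse_temp s).
apply: (@le_trans _ _ (\sum_(0 <= j < n.*2) A j)).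
  rewrite [leRHS](@big_cat_nat _ _ _ n.+1) //=; last lia.
  by rewrite lerDl sumr_ge0.
rewrite sum_pairs mulr_sumr; apply: ler_sum => i _; rewrite mulr_natl mulr2n.
have h : A i.*2 <= theta i s := crossing_prob_ge d i (expR_gt0 s) (inverse_temp s).
apply: lerD => //; apply: le_trans h.
exact/radius_mag_decr/leqnSn/inverse_temp_ge0.
Qed.

Lemma radius_mag_decay (beta beta1 : R) : 0 < beta -> beta < beta1 ->
  plus_magnetization d beta1 @ \oo --> (0 : R) ->
  exists2 Cc : R * R, 0 < Cc.1 /\ 0 < Cc.2 &
    forall r, radius_mag d beta r <= Cc.1 * expR (- (Cc.2 * r%:R)).
Proof.
move=> b0 bb1 cvg.
have lam0 (b : R) : 0 < b -> 0 < expR b - 1 by move=> h; rewrite subr_gt0 expR_gt1.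
pose s0 := ln (expR beta - 1); pose s1 := ln (expR beta1 - 1).
have b10 : 0 < beta1 by exact: lt_trans bb1.
have e0 : expR s0 = expR beta - 1 by rewrite lnK // posrE lam0.
have e1 : expR s1 = expR beta1 - 1 by rewrite lnK // posrE lam0.
have s01 : s0 < s1 by rewrite -ltr_expR e0 e1 ltrD2r ltr_expR.
have theta_cvg (eps : R) : 0 < eps -> exists N, forall n, (N <= n)%N -> theta n s1 <= eps.
  move=> eps0; have [N _ NP] : \forall n \near \oo, `|0 - plus_magnetization d beta1 n| <= eps.
    by move/cvgrPdist_le: cvg; apply.
  exists N.+1 => -[//|n] nN; have := NP n nN; rewrite /= sub0r normrN => h.
  apply: (le_trans _ (le_trans (ler_norm _) h)).
  by apply: (@crossing_prob_le R d n.+1 _ beta1); rewrite ?expR_gt0 // e1 addrC subrK.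
have theta_mono n x : x <= s1 -> theta n x <= theta n s1.
  move=> xs; have := derive_lower_bound (theta_derive n) xs (m := 0).
  by rewrite mul0r addr0; apply=> z _ _.
have [N NP] := theta_cvg 2^-1 ltac:(by rewrite invr_gt0).
(* Beyond [N], [theta] is at most 1/2 and dropping [1 - theta] costs a factor 2. With the 4 of the
   crossing inequality and the 2 of [sum_radius_mag] this makes 16. *)
have diff n x : (N.+1 <= n)%N -> s0 <= x -> x <= s1 ->
    n%:R * theta n x <= 16 * (\sum_(0 <= i < n) theta i x) * dtheta n x.
  move=> nN _ xs; have n0 : (0 < n)%N by lia.
  have half : theta n x <= 2^-1 by apply: le_trans (theta_mono n x xs) _; apply: NP; lia.
  have := crossing_prob_diff_ineq d n (expR_gt0 x) (inverse_temp x).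
  rewrite -/(theta n x) -/(dtheta n x) => h.
  have /andP[t0 _] := theta_itv n x.
  have h1 : n%:R * theta n x <= 2 * (n%:R * (theta n x * (1 - theta n x))).
    rewrite [leRHS]mulrCA ler_pM2l ?ltr0n //.
    exact: half_le.
  have h2 := ler_wpM2r (dtheta_ge0 n x) (sum_radius_mag x n0).
  apply: (le_trans h1); apply: (le_trans (ler_wpM2l (ler0n R 2) h)).
  rewrite -mulrA; apply: (@le_trans _ _ (2 * (4 * (2 * (\sum_(0 <= i < n) theta i x) * dtheta n
    x)))).
    by rewrite !ler_pM2l.
  by rewrite !mulrA -!natrM.
have := sharp_threshold_decay theta_derive theta0
  (fun n x => ltac:(by case/andP: (theta_itv n x)))
  (fun n x => ltac:(by case/andP: (theta_itv n x)))
  dtheta_ge0 (ltn0Sn N) (ltr0n R 16) diff s01 theta_cvg.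
case=> -[C c] /= [C0 c0] decay.
(* The magnetization at radius [r] is bounded by [theta] at [r / 2], which halves the rate; [exp c]
   pays for the rounding. *)
exists (C * expR c, c / 2) => /=; first by rewrite mulr_gt0 ?expR_gt0 // divr_gt0.
move=> r; have rr : (r./2.*2 <= r)%N by lia.
apply: (le_trans (radius_mag_decr d (ltW b0) rr)).
have h := crossing_prob_ge d r./2 (expR_gt0 s0) (beta := beta) ltac:(by rewrite e0 addrC subrK).
apply: (le_trans h); apply: (le_trans (decay _)); rewrite -mulrA ler_pM2l // -expRD ler_expR.
apply: exponent_half => //; first exact: ltW.
by rewrite -natrM natr1 ler_nat; lia.
Qed.

End Decay.

(** * Decay of the influence *)

Lemma ising_plus_lt1 (R : realType) (T : finType) (c : T -> T -> R) k x : ising_plus c k x < 1.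
Proof.
rewrite /ising_plus ltr_pdivrMr ?ising_Z_gt0 // mul1r /ising_Z.
rewrite [ltRHS](bigID (fun s : {ffun T -> bool} => s x)) /= ltrDl.
rewrite (bigD1 [ffun=> false]) /= ?ffunE // ltr_pwDl ?ising_weight_gt0 // sumr_ge0 // => s _.
exact/ltW/ising_weight_gt0.
Qed.

Section Rate.
Variables (R : realType) (d : nat).

Lemma plus_magnetization_lt1 (beta : R) n : plus_magnetization d beta n < 1.
Proof.
rewrite plus_magnetizationE; set p := ising_plus _ _ _.
have : p < 1 by exact: ising_plus_lt1.
by move: p => p; lra.
Qed.

Lemma plus_magnetization0 n : plus_magnetization d (0 : R) n = 0.
Proof.
rewrite plus_magnetizationE; set p := ising_plus _ _ _.
have E : p = 1 - p.
  rewrite {2}/p -ising_plusN; [|exact: coupling_sym|exact: coupling_diag].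
  by congr ising_plus; apply/funext => u; rewrite /plus_field mul0r oppr0.
by move: (p) E => q; lra.
Qed.

(** From [r0] on, half of the rate absorbs [C]; the smaller radii use the uniform bound [t]. The
    rate is written [2 a] because passing from the supremum norm to the Euclidean one will cost a
    factor 2. *)
Lemma exp_decay_absorb (A : nat -> R) (C c t : R) : 0 < C -> 0 < c -> t < 1 ->
  (forall r, (0 < r)%N -> A r <= t) -> (forall r, A r <= C * expR (- (c * r%:R))) ->
  exists2 a, 0 < a & forall r, (0 < r)%N -> A r <= expR (- (2 * a * r%:R)).
Proof.
move=> C0 c0 t1 At AC.
(* The maximum keeps the logarithm meaningful when [t] is not positive. *)
pose t' := Num.max t 2^-1; have t'0 : 0 < t' by rewrite lt_max invr_gt0 ltr0n orbT.
have t'1 : t' < 1 by rewrite gt_max t1 /=; lra.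
have l0 : 0 < - ln t' by rewrite oppr_gt0 ln_lt0 // t'0.
pose r0 : nat := (Num.truncn (2 * ln C / c)).+1.
have r00 : 0 < r0%:R :> R by rewrite ltr0n.
have r0P : 2 * ln C / c <= r0%:R by exact/ltW/truncnS_gt.
pose a := Num.min (c / 2) (- ln t' / r0%:R).
have a0 : 0 < a by rewrite lt_min !divr_gt0.
have ac : a <= c / 2 by rewrite ge_min lexx.
have at' : a * r0%:R <= - ln t' by rewrite -ler_pdivlMr // ge_min lexx orbT.
exists (a / 2) => [|r rp]; first by rewrite divr_gt0.
have -> : 2 * (a / 2) * r%:R = a * r%:R by field.
have [rr|rr] := leqP r0 r.
  apply: (le_trans (AC r)); rewrite -{1}(lnK (x := C)) ?posrE // -expRD ler_expR.
  have h : 2 * ln C / c <= r%:R by apply: (le_trans r0P); rewrite ler_nat.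
  have := ler_wpM2r (ler0n R r) ac; have := ler_wpM2l (ltW c0) h.
  have -> : c * (2 * ln C / c) = 2 * ln C by field; rewrite gt_eqF.
  lra.
apply: (le_trans (At r rp)); apply: (@le_trans _ _ t'); first by rewrite le_max lexx.
rewrite -[leLHS]lnK ?posrE // ler_expR.
have : a * r%:R <= a * r0%:R by rewrite ler_pM2l // ler_nat ltnW.
lra.
Qed.

(** [beta_c] is a supremum, so the magnetization vanishes at some [beta1] above [beta]. The case
    [beta = 0] is separate: the edge weight is 0 and has no logarithm, but the magnetization is 0
    too. *)
Lemma subcritical_decay (beta : R) : 0 <= beta -> (beta%:E < beta_c R d)%E ->
  exists2 a, 0 < a & forall r, (0 < r)%N -> radius_mag d beta r <= expR (- (2 * a * r%:R)).
Proof.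
rewrite le_eqVlt => /orP[/eqP <- _|b0 bc].
  exists 1 => // -[//|r] _ /=; rewrite plus_magnetization0; exact: expR_ge0.
have [_ [beta1 [b10 cvg] <-] bb1] := ereal_sup_gt bc.
rewrite lte_fin in bb1.
have [[C c] /= [C0 c0] decay] := radius_mag_decay b0 bb1 cvg.
apply: exp_decay_absorb C0 c0 (plus_magnetization_lt1 beta 0) _ decay => r r0.
exact: (@radius_mag_decr R d beta 1 r (ltW b0) r0).
Qed.

End Rate.

(** * Geometry of the exterior boundary *)

Section Boundary.
Variable d : nat.
Implicit Types (L : {fset lattice d}) (x y z : lattice d).

(** Walk from [z] towards [x], one unit in one coordinate at a time. The supremum distance to [x]
    never increases, and the vertex just before the first entry into [L] is on the exterior
    boundary. *)
Lemma ex_boundary_between L x z : x \in L -> z \notin L ->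
  exists2 y, y \in ex_boundary L & (supn (y - x) <= supn (z - x))%N.
Proof.
move=> xL; move: {2}(\sum_(i < d) `|(z - x)%R 0%R i|)%N (leqnn (\sum_(i < d) `|(z - x)%R 0%R
  i|)%N) => m.
elim: m z => [|m IH] z.
  rewrite leqn0 sum_nat_eq0 => /forallP h /negP[].
  suff -> : z = x by [].
  apply/eqP; rewrite -subr_eq0; apply/eqP/rowP => i; have := h i.
  by rewrite !mxE implyTb absz_eq0 => /eqP.
move=> zm zL.
have [i zi] : exists i, z 0 i - x 0 i != 0.
  apply/existsP; apply: contraR zL; rewrite negb_exists => /forallP h.
  suff -> : z = x by [].
  by apply/rowP => i; apply/eqP; rewrite -subr_eq0 -[_ == _]negbK h.
pose z' := z - Num.sg (z 0 i - x 0 i) *: delta_mx 0 i.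
have z'E j : z' 0 j - x 0 j = (if j == i then z 0 j - x 0 j - Num.sg (z 0 i - x 0 i) else z 0 j
  - x 0 j).
  by rewrite !mxE eqxx /=; case: eqP => _ /=; rewrite ?mulr1 ?mulr0 ?subr0 //; ring.
have sgE : (absz (z 0 i - x 0 i - Num.sg (z 0 i - x 0 i))%R).+1 = absz (z 0 i - x 0 i)%R.
  by move: zi; case: sgrP => h; lia.
have le_sup : (supn (z' - x) <= supn (z - x))%N.
  apply/bigmax_leqP => j _; have : (`|(z - x)%R 0%R j| <= supn (z - x))%N by rewrite /supn
    (leq_bigmax j).
  apply: leq_trans; have := z'E j; rewrite !mxE => ->.
  by case: eqP => [->|//]; rewrite -sgE leqnSn.
have azz' : adj z' z.
  rewrite /adj (bigD1 i) //= big1 ?addr0 => [|j ji].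
    have := z'E i; rewrite eqxx; move: (z' 0 i) (z 0 i) (x 0 i) zi => p q t.
    by case: sgrP => h; lia.
  have := z'E j; rewrite (negPf ji) => /addIr ->; by rewrite subrr normr0.
have [z'L|z'L] := boolP (z' \in L).
  exists z => //; rewrite in_ex_boundary zL; apply/existsP.
  by exists [` z'L]%fset.
have [|y yL yz] := IH z' _ z'L; last by exists y => //; exact: leq_trans le_sup.
rewrite -ltnS; apply: leq_trans zm.
rewrite (bigD1 i) //= [X in (_ < X)%N](bigD1 i) //= -addSn; apply: leq_add.
  by have := z'E i; rewrite eqxx !mxE => ->; rewrite sgE.
by apply: leq_sum => j ji; have := z'E j; rewrite (negPf ji) !mxE => ->.
Qed.

End Boundary.

Section Influence.
Variables (R : realType) (d : nat).
Implicit Types (L D : {fset lattice d}).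

Lemma exists_notin L : (0 < d)%N -> exists z, z \notin L.
Proof.
move=> d0; pose m := (\max_(u : L) supn (val u)).+1.
exists (\row_(i < d) m%:Z); apply/negP => zL.
have h1 : (supn (\row_(i < d) m%:Z) < m)%N.
  by rewrite ltnS; exact: (@leq_bigmax _ (fun u : L => supn (val u)) [` zL]%fset).
have h2 : (`|(\row_(i < d) m%:Z)%R 0%R (Ordinal d0)| <= supn (\row_(i < d) m%:Z))%N.
  exact: (@leq_bigmax _ (fun i => absz ((\row_(i < d) m%:Z)%R 0%R i)) (Ordinal d0)).
by move: h2; rewrite mxE absz_nat leqNgt h1.
Qed.

(** [y] is an exterior boundary site nearest to [x]. The cube around [x] of radius one less lies in
    [L], since a missing site would yield a nearer boundary site. *)
Lemma plus_field_magnetization_le (beta a : R) L (x : L) : (0 < d)%N -> 0 <= beta ->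
  (forall r, (0 < r)%N -> radius_mag d beta r <= expR (- (2 * a * r%:R))) ->
  exists2 y, y \in ex_boundary L &
    2 * ising_plus (coupling beta (L := L)) (plus_field beta (L := L)) x - 1
    <= expR (- (2 * a * (supn (y - val x))%:R)).
Proof.
move=> d0 b0 decay.
have [z zL] := exists_notin L d0.
have [y0 y0L _] := ex_boundary_between (fsvalP x) zL.
pose y := [arg min_(y < [` y0L]%fset) supn (val y - val x)].
have ymin (v : ex_boundary L) : (supn (val y - val x) <= supn (val v - val x))%N.
  by rewrite /y; case: arg_minnP => // w _; apply.
have r0 : (0 < supn (val y - val x))%N.
  rewrite lt0n; apply: contraL (fsvalP y) => /eqP h.
  have : val y - val x \in box d 0 by rewrite in_box_supn h.
  rewrite in_boxE => /forallP h0.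
  rewrite in_ex_boundary negb_and negbK; apply/orP; left.
  suff -> : val y = val x by exact: fsvalP.
  apply/eqP; rewrite -subr_eq0; apply/eqP/rowP => i; have := h0 i.
  by rewrite [RHS]mxE normr_le0 => /eqP.
exists (val y); first exact: fsvalP.
apply: le_trans (decay _ r0).
case E : (supn (val y - val x)) r0 => [//|i] _ /=.
have sub u : u \in box d i -> val x + u \in L.
  rewrite in_box_supn => ui; rewrite -[_ \in _]negbK;
    apply/negP => /(ex_boundary_between (fsvalP x)) [v vL].
  by rewrite [val x + u]addrC addrK; have := ymin [` vL]%fset; rewrite E /=; lia.
exact: (ising_plus_box sub).
Qed.

(** The factor 2 is the square root of the largest dimension allowed. *)
Lemma eucl_dist_supn (x y : lattice d) : (d <= 4)%N -> eucl_dist R x y <= 2 * (supn (x - y))%:R.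
Proof.
move=> d4; rewrite /eucl_dist -[leRHS]ger0_norm ?mulr_ge0 // -sqrtr_sqr.
rewrite ler_sqrt ?sqr_ge0 // exprMn.
apply: (@le_trans _ _ (\sum_(i < d) (supn (x - y))%:R ^+ 2)); last first.
  rewrite sumr_const card_ord -[leLHS]mulr_natl ler_wpM2r ?sqr_ge0 //.
  by rewrite -natrX ler_nat.
apply: ler_sum => i _.
have h : (`|(x - y)%R 0%R i| <= supn (x - y))%N by rewrite /supn (leq_bigmax i).
rewrite -[leLHS]real_normK ?num_real //; rewrite lerXn2r ?nnegrE ?ler0n //.
by rewrite -intr_norm -natr_absz ler_nat; move: h; rewrite !mxE.
Qed.

Lemma gibbs_marginalE L D (DL : (D `<=` L)%fset) (h : L -> R) eta beta H (A : {set config D}) :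
  \sum_(t in A) gibbs_marginal h eta beta H DL t =
  ising_mean (coupling beta (L := L)) (gibbs_field h eta beta H) (fun s => (restrict_config DL
    s \in A)%:R).
Proof.
rewrite /gibbs_marginal (exchange_big_dep xpredT) //=.
rewrite /ising_mean mulr_suml; apply: eq_bigr => s _.
rewrite /gibbs gibbs_weightE.
rewrite (_ : \sum_t gibbs_weight _ _ _ _ t = ising_Z (coupling beta (L := L)) (gibbs_field h
  eta beta H)); last first.
  by apply: eq_bigr => t _; rewrite gibbs_weightE.
have [sA|sA] := boolP (restrict_config DL s \in A).
  rewrite (big_pred1 (restrict_config DL s)) ?mulr1 // => t /=.
  by rewrite andbC eq_sym; case: eqP => // ->.
rewrite big_pred0 ?mulr0 ?mul0r // => t; apply/negP => /andP[tA /eqP E].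
by rewrite E tA in sA.
Qed.

Lemma ising_mean_itv (T : finType) (c : T -> T -> R) k (f : {ffun T -> bool} -> R) :
  (forall s, 0 <= f s <= 1) -> 0 <= ising_mean c k f <= 1.
Proof.
move=> f01; have Z0 := ising_Z_gt0 c k; rewrite /ising_mean; apply/andP; split.
  apply: divr_ge0; last exact: ltW.
  apply: sumr_ge0 => s _; rewrite mulr_ge0 ?(ltW (ising_weight_gt0 _ _ _)) //.
  by case/andP: (f01 s).
rewrite ler_pdivrMr // mul1r; apply: ler_sum => s _.
by case/andP: (f01 s) => _ h; rewrite ler_piMr // ltW // ising_weight_gt0.
Qed.

Lemma marginal_influence (beta a H : R) L D (DL : (D `<=` L)%fset) (h : L -> R)
    (eta eta' : config (ex_boundary L)) (A : {set config D}) :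
  (0 < d <= 4)%N -> 0 <= beta -> 0 < a ->
  (forall r, (0 < r)%N -> radius_mag d beta r <= expR (- (2 * a * r%:R))) ->
  `|\sum_(t in A) gibbs_marginal h eta beta H DL t - \sum_(t in A) gibbs_marginal h eta' beta H
    DL t|
  <= \sum_(x : ex_boundary D) \sum_(y : ex_boundary L) expR (- a * eucl_dist R (val x) (val y)).
Proof.
move=> /andP[d0 d4] b0 a0 decay; rewrite !gibbs_marginalE.
set f := fun s => _.
have f01 s : 0 <= f s <= 1 by rewrite ler0n lern1 leq_b1.
(* If the two boundaries meet, the double sum has a term equal to 1, which already bounds a
   difference of two probabilities. *)
have [/existsP[x xL]|disj] := boolP [exists x : ex_boundary D, val x \in ex_boundary L].
  apply: (@le_trans _ _ 1).
    have /andP[] := ising_mean_itv (coupling beta (L := L)) (gibbs_field h eta beta H) f01.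
    have /andP[] := ising_mean_itv (coupling beta (L := L)) (gibbs_field h eta' beta H) f01.
    move: (ising_mean _ _ _) (ising_mean _ _ _) => p q *; rewrite ler_norml; lra.
  rewrite (bigD1 x) //= (bigD1 [` xL]%fset) //= /eucl_dist.
  rewrite [X in Num.sqrt X]big1 ?sqrtr0 ?mulr0 ?expR0 => [|i _]; last by rewrite subrr expr0n.
  rewrite -addrA lerDl addr_ge0 //; first by apply: sumr_ge0 => y _; exact: expR_ge0.
  by apply: sumr_ge0 => y _; apply: sumr_ge0 => z _; exact: expR_ge0.
have sep v : v \in ex_boundary D -> v \in ex_boundary L -> False.
  by move=> vD vL; move: disj; rewrite negb_exists => /forallP/(_ [` vD]%fset); rewrite /= vL.
pose Ds : {set L} := [set v | val v \in D].
pose B : {set L} := [set v | val v \in ex_boundary D].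
have bd (u : L) v : u \in Ds -> adj (val u) v -> v \notin D -> v \in ex_boundary D.
  rewrite inE => uD uv vD; rewrite in_ex_boundary vD; apply/existsP.
  by exists [` uD]%fset.
(* A neighbour of [D] on the exterior boundary of [L] would lie on both boundaries, so the boundary
   condition exerts no field on [D]. *)
have same u : u \in Ds -> gibbs_field h eta beta H u = gibbs_field h eta' beta H u.
  move=> uD; rewrite /gibbs_field; congr (_ + _ * _); rewrite !big1 // => v uv; exfalso;
  apply: (@sep (val v)) => //; try exact: fsvalP;
  apply: (bd u) => //; have := fsvalP v; rewrite in_ex_boundary => /andP[vL _];
  by apply: contra vL; exact: fsubsetP.
have sub (v : lattice d) : v \in ex_boundary D -> v \in L.
  move=> vD; rewrite -[_ \in _]negbK; apply/negP => vL; apply: (sep v) => //.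
  rewrite in_ex_boundary vL; apply/existsP; move: vD;
    rewrite in_ex_boundary => /andP[_ /existsP[u uv]].
  by exists (fincl DL u).
pose km (u : L) := H * h u - plus_field beta u.
pose kp (u : L) := H * h u + plus_field beta u.
have bnd e u : km u <= gibbs_field h e beta H u <= kp u by exact: gibbs_field_bounds.
have := @ising_boundary_influence R L (coupling beta (L := L)) (fun u v => coupling_ge0 u v b0)
  (coupling_sym beta (L := L)) B Ds (gibbs_field h eta beta H) (gibbs_field h eta' beta H) km kp f
  (fun u => proj1 (andP (bnd eta u))) (fun u => proj2 (andP (bnd eta u)))
  (fun u => proj1 (andP (bnd eta' u))) (fun u => proj2 (andP (bnd eta' u))) same.
move=> infl; apply: (le_trans (infl _ f01 _)) => {infl}.
- move=> u v uD vD vB; rewrite /coupling; case uv: (adj _ _); last by rewrite mulr0.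
  by move: vB vD; rewrite !inE => + vD; rewrite (bd u _ uD uv vD).
- move=> s t st; rewrite /f; congr ((_ \in A)%:R); apply/ffunP => x; rewrite !ffunE.
  by apply: st; rewrite inE /= fsvalP.
have -> : \sum_(x : ex_boundary D) \sum_(y : ex_boundary L) expR (- a * eucl_dist R (val x)
  (val y)) =
    \sum_(x in B) \sum_(y : ex_boundary L) expR (- a * eucl_dist R (val x) (val y)).
  pose F v := \sum_(y : ex_boundary L) expR (- a * eucl_dist R v (val y)).
  rewrite -(big_seq_fsetE _ (ex_boundary D) xpredT F) /=.
  transitivity (\sum_(v : L | val v \in ex_boundary D) F (val v)); last by apply: eq_bigl => v;
    rewrite inE.
  rewrite -(big_seq_fsetE _ L (fun v => v \in ex_boundary D) F) /= -[RHS]big_filter.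
  apply: perm_big; apply: uniq_perm; rewrite ?filter_uniq ?fset_uniq // => v.
  by rewrite mem_filter; case: (boolP (v \in ex_boundary D)) => //= /sub ->.
(* The extreme fields are [H h] plus and minus the same nonnegative boundary field, as
   [ising_plus_influence] requires. *)
apply: ler_sum => x _; apply: (@le_trans _ _ (2 * ising_plus (coupling beta (L := L))
  (plus_field beta (L := L)) x - 1)).
  apply: (ising_plus_influence (coupling_sym beta (L := L)) _ (coupling_diag beta (L := L))).
    by move=> u v; exact: coupling_ge0.
  by move=> u; rewrite mulr_ge0 // deg_out_ge0.
have [y yL] := plus_field_magnetization_le x d0 b0 decay.
move=> hy; apply: (le_trans hy); rewrite (bigD1 [` yL]%fset) //=.
rewrite -[leLHS]addr0; apply: lerD; last by apply: sumr_ge0 => z _; exact: expR_ge0.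
rewrite ler_expR mulNr lerN2 mulrAC -mulrA.
have := eucl_dist_supn (val x) y d4; rewrite supn_distC => hd.
have := ler_wpM2l (ltW a0) hd; lra.
Qed.

End Influence.

Local Open Scope classical_set_scope.
Local Open Scope ring_scope.

Theorem theorem2 (R : realType) (beta : R) :
  0 <= beta -> (beta%:E < beta_c R 2)%E ->
  exists H1 : \bar R,
    [/\ (0 < H1)%E,
        (beta%:E <= beta_P R 2)%E -> H1 = +oo%E,
        (beta_P R 2 < beta%:E)%E -> (H1 < +oo)%E
      & forall H : R, 0 <= H -> (H%:E < H1)%E ->
        exists2 C1 : R, 0 < C1 &
          forall (L D : {fset lattice 2}) (DL : (D `<=` L)%fset) (h : L -> R),
            (forall u, h u = 1 \/ h u = -1) ->
            (ereal_sup [set (tv_dist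
                               (gibbs_marginal h ee.1 beta H DL)
                               (gibbs_marginal h ee.2 beta H DL))%:E
                        | ee in [set: config (ex_boundary L)
                                      * config (ex_boundary L)]]
             <= (\sum_(x : ex_boundary D) \sum_(y : ex_boundary L)
                   expR (- C1 * eucl_dist R (val x) (val y)))%:E)%E].
Proof.
move=> b0 bc; have [a a0 decay] := subcritical_decay b0 bc.
exists (if (beta%:E <= beta_P R 2)%E then +oo%E else 1%E); split.
- by case: ifP => // _; rewrite lte01.
- by move=> ->.
- by rewrite ltNge => /negPf ->; rewrite ltry.
move=> H _ _; exists a => // L D DL h _.
apply: ge_ereal_sup => _ [[eta eta'] _ <-] /=; rewrite lee_fin /tv_dist.
apply: bigmax_le => [|A _]; last exact: marginal_influence.
by apply: sumr_ge0 => x _; apply: sumr_ge0 => y _; exact: expR_ge0.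
Qed.
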